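(* For $p\in[0,1]$ let $$\nu=\frac{1-p}{2}\,\delta_{-1}+p\,\delta_0+\frac{1-p}{2}\,\delta_1 .$$ In ballistic annihilation with speed law $\nu$ and particles started at each site of $\mathbb{Z}$, a speed-$0$ particle survives with positive probability for every $p\geq 0.3325$. If instead the particles are started according to a unit intensity Poisson point process, then a speed-$0$ particle survives with positive probability for every $p\geq 0.3313$.
   Context: (Two-sided) ballistic annihilation with speed law $\nu$: at time $0$ particles are placed at points $\cdots<x_{-1}<x_0=0<x_1<\cdots$ of $\mathbb{R}$. In the first case $x_k=k$ for all $k\in\mathbb{Z}$. In the Poisson case the gaps $x_{k+1}-x_k$, $k\in\mathbb{Z}$, are i.i.d. exponential random variables with mean $1$ (a unit intensity Poisson process seen from one of its particles). Each particle is independently (also of the positions) assigned a velocity with law $\nu$ (called its speed) and moves at constant velocity. When two or more particles meet, all of them are annihilated (removed). A particle survives if it is never annihilated. ''A speed-$0$ particle survives with positive probability'' means that, conditional on the particle started at $x_0=0$ having speed $0$, the probability that it is never annihilated is positive. *)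

(* Defs.v *)
From HB Require Import structures.
From mathcomp Require Import all_boot all_order all_algebra.
From mathcomp Require Import all_classical all_reals all_analysis.

Set Implicit Arguments.
Unset Strict Implicit.
Unset Printing Implicit Defensive.

Import Order.TTheory GRing.Theory Num.Theory.
Import numFieldNormedType.Exports.

Local Open Scope classical_set_scope.
Local Open Scope ring_scope.

Section dynamics.
Context {R : realType}.
Variables (x v : int -> R).

Definition meet (i j : int) (t : R) := x i + v i * t = x j + v j * t.

(** [annihilation_times T]: [T i] is the time at which particle [i] is
    annihilated, [+oo] if it never is.  Particle [i] is annihilated at time [t]
    exactly when it is still present just before [t] and, at time [t], is at the
    same place as another particle which is also present just before [t]; this
    allows simultaneous annihilation of three or more particles.
    When the [x i] are pairwise distinct and finitely many of them lie in each
    bounded interval, and the [v i] are bounded, exactly one such [T] exists: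
    what happens to a particle up to time [t] depends on finitely many others. *)
Definition annihilation_times (T : int -> \bar R) : Prop :=
  (forall i, (0 <= T i)%E) /\
  (forall i (t : R), T i = t%:E <->
     [/\ 0 <= t, (t%:E <= T i)%E &
         exists j, [/\ j != i, meet i j t & (t%:E <= T j)%E]]).

Definition survives (i : int) : Prop :=
  exists T, annihilation_times T /\ T i = +oo%E.

End dynamics.

Section probability_notions.
Context {R : realType} {d : measure_display} {Omega : measurableType d}.
Variable P : probability Omega R.

Definition mutually_independent (I : eqType) (X : I -> Omega -> R) : Prop :=
  forall (s : seq I) (B : I -> set R), uniq s ->
    (forall i, measurable (B i)) ->
    P (\big[setI/setT]_(i <- s) (X i @^-1` B i)) =
    (\prod_(i <- s) P (X i @^-1` B i))%E.

Definition has_law (X : Omega -> R) (mu : set R -> \bar R) : Prop :=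
  forall A : set R, measurable A -> pushforward P X A = mu A.

(** Junk value [0] if [P B = 0]. *)
Definition cond_prob (A B : set Omega) : R := fine (P (A `&` B)) / fine (P B).

End probability_notions.

Section ballistic_annihilation.
Context {R : realType}.

Definition speed_law (p : R) (A : set R) : \bar R :=
  (((1 - p) / 2)%:E * dirac (- 1 : R)%R A + p%:E * dirac (0 : R)%R A
   + ((1 - p) / 2)%:E * dirac (1 : R)%R A)%E.

Context {d : measure_display} {Omega : measurableType d}.
Variable P : probability Omega R.

Definition gap (x : int -> Omega -> R) (k : int) (w : Omega) : R :=
  x (k + 1) w - x k w.

Definition lattice_model (p : R) (x : int -> Omega -> R)
    (v : int -> {RV P >-> R}) : Prop :=
  [/\ forall k w, x k w = k%:~R,
      forall k, has_law P (v k) (speed_law p)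
    & mutually_independent P v].

(** Exponential gaps are positive almost surely, hence
    [... < x (-1) < x 0 = 0 < x 1 < ...] almost surely.  All gaps and all
    velocities together form one independent family. *)
Definition poisson_model (p : R) (x v : int -> {RV P >-> R}) : Prop :=
  [/\ forall w, x 0 w = 0,
      forall k, has_law P (gap x k) (exponential_prob 1),
      forall k, has_law P (v k) (speed_law p)
    & mutually_independent P (fun k : int + int =>
        match k return Omega -> R with inl i => gap x i | inr i => v i end)].

(** The probability is that of the completion of [P]: the survival of particle
    [0] has to agree with an event [E] up to a [P]-null set, and the value does
    not depend on the choice of [E].  On a null set the configuration need not be
    locally finite, and survival is not asked to be measurable there. *)
Definition still_particle_survives_wpp (x v : int -> Omega -> R) : Prop :=
  exists E : set Omega,
    [/\ measurable E,
        \forall w \ae P,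
          E w <-> survives (fun k => x k w) (fun k => v k w) 0
      & 0 < cond_prob P E (v 0 @^-1` [set 0])].

End ballistic_annihilation.

(* Main.v *)
(** Read the particles to the right of a static one from left to right.  If the
    particles of a word [w] annihilate one another completely, then [w ++ t] sends
    at most as many left-movers to its left end as [t] does.  Hence, when [c]
    static particles protect the origin, the number of arrivals still needed to
    reach it goes down by one at a left-mover, up by one at a static particle, and
    is unchanged by a block which starts at a right-mover and stops as soon as it
    has annihilated itself.  This already gives a positive drift for [p > 1/3].
    In a block right-static-left the left-mover may reach the static particle
    before the right-mover does; it is then used up inside the block, whereas it
    would lower the level if the block had stopped at the static particle.  This
    happens when the first gap is [>= 1] and the second one [< 1], and it keeps
    the drift positive at [p = 0.3313]: [z ^ level], corrected during a block, is
    a supermartingale for [z = 199/200].  So, given that the particles [-c..c] are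
    static, each side destroys particle [0] with probability at most [z ^ c],
    and [2 * z ^ c < 1] for [c] large. *)
Require Import Defs.
From HB Require Import structures.
From mathcomp Require Import all_boot all_order all_algebra.
From mathcomp Require Import all_classical all_reals all_analysis.
From mathcomp Require Import measurable_realfun.
From mathcomp Require Import zify lra ring.

Set Implicit Arguments.
Unset Strict Implicit.
Unset Printing Implicit Defensive.

Import Order.TTheory GRing.Theory Num.Theory.
Import numFieldNormedType.Exports.

Local Open Scope classical_set_scope.
Local Open Scope ring_scope.

(** Without the extra gain the level falls with probability [(1 - p) / 2] and rises with probability
    [p], whence the value [1/3]. To exploit the contest right-static-left one would compare two
    adjacent gaps, but then the worth of a half-read block would depend on the exact length of the
    first gap. Comparing each gap with the fixed length 1 makes every event concern a single new
    gap, independent of all that was read before, so that weights depending only on level and mode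
    suffice. The drift estimate then needs only that a gap is [>= 1] with probability at least 1/3
    and [<= 1] with probability at least 1/2. Constant and exponential gaps both satisfy this, so
    one argument with the bound 0.3313 serves both models. A block that never annihilates itself is
    never closed; the level then stays frozen, which favours survival. The dynamics involves
    infinitely many particles and is given only through its annihilation times, whereas blocks are
    finite words. The bridge is finite speed: systems restricted to sets of particles agree inside
    light cones, and the solution for a word is glued from non-interacting pieces along the
    recursion that computes its arrivals. *)

(** * Combinatorics of words: arrivals, balance, superadditivity *)

Section arrivals.
Context {R : realType}.
Variables (x v : int -> R).
Implicit Types (X Y u s t : seq int) (a y l : int).

(* [X] is the stack of the right-movers read so far and still alive, the last one
   on top; [u] is the word still to be read.  [arr X u] lists the left-movers that
   escape to the left, each with the part of [u] behind it; [bal X u] is the number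
   of surviving static particles minus that of escaping left-movers, or [None] if
   a right-mover survives.  In [clash], a static [y] is contested by the right-mover
   [a] and by the first left-mover of [B]; a tie destroys all three. *)
Definition clash (B : seq (int * seq int)) a X y u : seq int * seq int :=
  if B is (l, s) :: _ then
    if x y - x a < x l - x y then (X, u)
    else if x l - x y == x y - x a then (X, s) else (a :: X, s)
  else (X, u).

Fixpoint arr_rec n X u : seq (int * seq int) :=
  if n is n'.+1 then
    if u is y :: u' then
      if v y == -1 then
        if X is _ :: X' then arr_rec n' X' u' else (y, u') :: arr_rec n' [::] u'
      else if v y == 1 then arr_rec n' (y :: X) u'
      else if X is a :: X' then
        let c := clash (arr_rec n' [::] u') a X' y u' in arr_rec n' c.1 c.2
      else behead (arr_rec n' [::] u')
    else [::]
  else [::].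

Fixpoint bal_rec n X u : option int :=
  if n is n'.+1 then
    if u is y :: u' then
      if v y == -1 then
        if X is _ :: X' then bal_rec n' X' u'
        else omap (fun k => k - 1) (bal_rec n' [::] u')
      else if v y == 1 then bal_rec n' (y :: X) u'
      else if X is a :: X' then
        let c := clash (arr_rec n' [::] u') a X' y u' in bal_rec n' c.1 c.2
      else omap (fun k => k + 1) (bal_rec n' [::] u')
    else if X is [::] then Some 0 else None
  else if X is [::] then Some 0 else None.

Definition arr X u := arr_rec (size u) X u.
Definition bal X u := bal_rec (size u) X u.

(** After a clash in which a left-mover reaches the static particle in time, reading resumes behind
    that left-mover, a word that is not structurally smaller. This bounds its length and makes the
    fuel [n] harmless once it is at least [size u]. *)
Lemma arr_rec_suffix n X u l s :
  (l, s) \in arr_rec n X u -> exists u1, u = u1 ++ l :: s.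
Proof.
elim: n X u l s => [|n IH] X [|y u] l s //=.
have consP w : (exists u1, w = u1 ++ l :: s) -> exists u1, y :: w = u1 ++ l :: s.
  by move=> [u1 ->]; exists (y :: u1).
case: ifP => _.
  case: X => [|a X]; last by move/IH/consP.
  by rewrite inE => /orP[/eqP[<- <-]|/IH/consP//]; exists [::].
case: ifP => _; first by move/IH/consP.
case: X => [|a X]; first by move/mem_behead/IH/consP.
rewrite /clash; case E: (arr_rec n [::] u) => [|[l1 s1] r] /=; first by move/IH/consP.
have [u1 Eu] : exists u1, u = u1 ++ l1 :: s1.
  by apply: (IH [::]); rewrite E mem_head.
have catP : (exists u1, s1 = u1 ++ l :: s) -> exists u1, y :: u = u1 ++ l :: s.
  by move=> [u2 Es]; exists (y :: u1 ++ l1 :: u2); rewrite Eu Es /= -catA.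
by case: ifP => _ /=; [move/IH/consP|case: ifP => _ /= /IH/catP].
Qed.

Lemma size_clash B a X y u :
  (forall l s, (l, s) \in B -> exists u1, u = u1 ++ l :: s) ->
  (size (clash B a X y u).2 <= size u)%N.
Proof.
case: B => [|[l s] r] //= /(_ l s (mem_head _ _)) [u1 ->].
by case: ifP => // _; case: ifP => // _ /=; rewrite size_cat /=; lia.
Qed.

Lemma arr_rec_fuel n m X u : (size u <= n)%N -> (size u <= m)%N ->
  arr_rec n X u = arr_rec m X u.
Proof.
elim: n m X u => [|n IH] [|m] X [|y u] //=; rewrite !ltnS => hn hm.
rewrite (IH m [::]) // (IH m (y :: X)) //.
case: ifP => _; first by case: X => // a X; rewrite (IH m).
case: ifP => _ //; case: X => // a X.
by rewrite (IH m) //;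
  [apply: leq_trans hn|apply: leq_trans hm];
  apply: size_clash => l s; apply: arr_rec_suffix.
Qed.

Lemma bal_rec_fuel n m X u : (size u <= n)%N -> (size u <= m)%N ->
  bal_rec n X u = bal_rec m X u.
Proof.
elim: n m X u => [|n IH] [|m] X [|y u] //=; rewrite !ltnS => hn hm.
rewrite (IH m [::]) // (IH m (y :: X)) // (@arr_rec_fuel n m) //.
case: ifP => _; first by case: X => // a X; rewrite (IH m).
case: ifP => _ //; case: X => // a X.
by rewrite (IH m) //;
  [apply: leq_trans hn|apply: leq_trans hm];
  apply: size_clash => l s; apply: arr_rec_suffix.
Qed.

Lemma arr_suffix X u l s : (l, s) \in arr X u -> exists u1, u = u1 ++ l :: s.
Proof. exact: arr_rec_suffix. Qed.

Lemma size_arr_suffix X u l s r : arr X u = (l, s) :: r -> (size s < size u)%N.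
Proof.
move=> E; have [|u1 ->] := @arr_suffix X u l s; first by rewrite E mem_head.
by rewrite size_cat /=; lia.
Qed.

Lemma arr_left0 y u : v y = -1 -> arr [::] (y :: u) = (y, u) :: arr [::] u.
Proof. by move=> e; rewrite /arr /= e eqxx. Qed.

Lemma arr_left a X y u : v y = -1 -> arr (a :: X) (y :: u) = arr X u.
Proof. by move=> e; rewrite /arr /= e eqxx. Qed.

Let oneN1F : (1 == -1 :> R) = false. Proof. by apply/eqP; lra. Qed.

Lemma arr_right X y u : v y = 1 -> arr X (y :: u) = arr (y :: X) u.
Proof.
by move=> e; rewrite /arr /= e eqxx oneN1F.
Qed.

Definition still y := (v y != -1) && (v y != 1).

Lemma arr_still0 y u : still y -> arr [::] (y :: u) = behead (arr [::] u).
Proof. by move=> /andP[/negbTE e /negbTE f]; rewrite /arr /= e f. Qed.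

Lemma arr_still a X y u : still y -> arr (a :: X) (y :: u) =
  let c := clash (arr [::] u) a X y u in arr c.1 c.2.
Proof.
move=> /andP[/negbTE e /negbTE f]; rewrite /arr /= e f.
apply: arr_rec_fuel => //; apply: size_clash => l s; exact: arr_suffix.
Qed.

Lemma bal_nil X : bal X [::] = if X is [::] then Some 0 else None.
Proof. by []. Qed.

Lemma bal_left0 y u : v y = -1 ->
  bal [::] (y :: u) = omap (fun k => k - 1) (bal [::] u).
Proof. by move=> e; rewrite /bal /= e eqxx. Qed.

Lemma bal_left a X y u : v y = -1 -> bal (a :: X) (y :: u) = bal X u.
Proof. by move=> e; rewrite /bal /= e eqxx. Qed.

Lemma bal_right X y u : v y = 1 -> bal X (y :: u) = bal (y :: X) u.
Proof.
by move=> e; rewrite /bal /= e eqxx oneN1F.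
Qed.

Lemma bal_still0 y u : still y ->
  bal [::] (y :: u) = omap (fun k => k + 1) (bal [::] u).
Proof. by move=> /andP[/negbTE e /negbTE f]; rewrite /bal /= e f. Qed.

Lemma bal_still a X y u : still y -> bal (a :: X) (y :: u) =
  let c := clash (arr [::] u) a X y u in bal c.1 c.2.
Proof.
move=> /andP[/negbTE e /negbTE f]; rewrite /bal /arr /= e f.
apply: bal_rec_fuel => //; apply: size_clash => l s; exact: arr_suffix.
Qed.

Variant speed_spec y : Prop :=
| SpeedLeft of v y = -1
| SpeedRight of v y = 1
| SpeedStill of still y.

Lemma speedP y : speed_spec y.
Proof.
have [|n1] := eqVneq (v y) (-1); first exact: SpeedLeft.
have [|n2] := eqVneq (v y) 1; first exact: SpeedRight.
by apply: SpeedStill; rewrite /still n1 n2.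
Qed.

Variant clash_spec B a X y u : seq int * seq int -> Prop :=
| ClashNone of B = [::] : clash_spec B a X y u (X, u)
| ClashFar l s r of B = (l, s) :: r & x y - x a < x l - x y :
    clash_spec B a X y u (X, u)
| ClashTie l s r of B = (l, s) :: r & x l - x y = x y - x a :
    clash_spec B a X y u (X, s)
| ClashClose l s r of B = (l, s) :: r & x l - x y < x y - x a :
    clash_spec B a X y u (a :: X, s).

Lemma clashP B a X y u : clash_spec B a X y u (clash B a X y u).
Proof.
case: B => [|[l s] r] /=; first exact: ClashNone.
case: ltgtP => h; [exact: ClashFar h| |exact: ClashTie (esym h)].
exact: ClashClose h.
Qed.

(** An escaping left-mover sweeps the whole region to its left, so everything in front of it, the
    stack included, is gone; what follows meets an empty stack. *)
Lemma arr_behead X u l s r : arr X u = (l, s) :: r -> r = arr [::] s.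
Proof.
move: {2}(size u) (leqnn (size u)) => n.
elim: n X u l s r => [|n IH] X [|y u] l s r //= hu.
have [e|e|e] := speedP y.
- case: X => [|a X]; first by rewrite arr_left0 // => -[_ <- <-].
  by rewrite arr_left //; apply: IH.
- by rewrite arr_right //; apply: IH.
- case: X => [|a X].
    rewrite arr_still0 //; case E: (arr [::] u) => [|[l1 s1] r1] //= E1.
    have E2 := IH _ _ _ _ _ hu E; rewrite E2 in E1.
    by apply: (IH _ _ _ _ _ _ E1); have := size_arr_suffix E; lia.
  rewrite arr_still //=; case: clashP => [_|l1 s1 r1 _ _|l1 s1 r1 E _|l1 s1 r1 E _] /=;
    try exact: IH.
  + by apply: IH; have := size_arr_suffix E; lia.
  + by apply: IH; have := size_arr_suffix E; lia.
Qed.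

Lemma size_arr_cons X u l s r : arr X u = (l, s) :: r ->
  size (arr X u) = (size (arr [::] s)).+1.
Proof. by move=> E; rewrite E /= (arr_behead E). Qed.

(** A right-mover added at the far left helps left-movers through only by destroying a static
    particle in their way, at most one each. The top of the stack comes first, so [X] lies to the
    left of [Y]. *)
Lemma size_arr_stack Y X u :
  (size (arr (Y ++ X) u) <= size X + size (arr Y u))%N.
Proof.
move: {2}(size u) (leqnn (size u)) => n.
elim: n Y X u => [|n IH] Y X [|y u] //= hu.
have [e|e|e] := speedP y.
- case: Y => [|b Y] /=; last by rewrite !arr_left //; apply: IH.
  case: X => [|a X] /=; first by lia.
  by rewrite arr_left // arr_left0 //=; have := IH [::] X u hu; rewrite cat0s; lia.
- by rewrite !arr_right // -cat_cons; apply: IH.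
- case: Y => [|b Y] /=.
    case: X => [|a X] /=; first by lia.
    rewrite arr_still // arr_still0 //=.
    case: clashP => [E|l s r E _|l s r E _|l s r E _] /=; rewrite ?E ?(arr_behead E) /=.
    + by have := IH [::] X u hu; rewrite cat0s E /=; lia.
    + by have := IH [::] X u hu; rewrite cat0s (size_arr_cons E); lia.
    + by have := IH [::] X s; have := size_arr_suffix E; rewrite cat0s; lia.
    + by have := IH [::] (a :: X) s; have := size_arr_suffix E; rewrite cat0s /=; lia.
  rewrite !arr_still //=.
  rewrite /clash; case E: (arr [::] u) => [|[l s] r] /=; first exact: IH.
  have := size_arr_suffix E => hs.
  case: ifP => _ /=; first exact: IH.
  by case: ifP => _ /=; [|rewrite -cat_cons]; apply: IH; lia.
Qed.

(** No particle in front of the first arrival survives, so the balance starts afresh behind it, with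
    the arrival itself counted. *)
Lemma bal_arr X u l s r : arr X u = (l, s) :: r ->
  bal X u = omap (fun k => k - 1) (bal [::] s).
Proof.
move: {2}(size u) (leqnn (size u)) => n.
elim: n X u l s r => [|n IH] X [|y u] l s r //= hu.
have [e|e|e] := speedP y.
- case: X => [|a X]; first by rewrite arr_left0 // bal_left0 // => -[_ <- _].
  by rewrite arr_left // bal_left //; apply: IH.
- by rewrite arr_right // bal_right //; apply: IH.
- case: X => [|a X].
    rewrite arr_still0 // bal_still0 //; case E: (arr [::] u) => [|[l1 s1] r1] //= E1.
    rewrite (arr_behead E) in E1; have hs := size_arr_suffix E.
    rewrite (IH _ _ _ _ _ hu E) (IH _ _ _ _ _ _ E1); last by lia.
    by case: (bal _ s) => //= k; congr Some; lia.
  rewrite arr_still // bal_still //=.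
  case: clashP => [_|l1 s1 r1 _ _|l1 s1 r1 E _|l1 s1 r1 E _] /=;
    try exact: IH.
  + by apply: IH; have := size_arr_suffix E; lia.
  + by apply: IH; have := size_arr_suffix E; lia.
Qed.

(* If no stacked right-mover can reach a static particle of [u] before any
   left-mover of [u], the stack has no influence on the collisions inside [u]. *)
Lemma arr_late_stack Y X u :
  (forall a y l, a \in X -> y \in u -> l \in u -> x l - x y < x y - x a) ->
  arr Y u = [::] ->
  arr (Y ++ X) u = [::] /\
  forall k, bal (Y ++ X) u = Some k -> bal Y u = Some (k + (size X)%:Z).
Proof.
move: {2}(size u) (leqnn (size u)) => n.
elim: n Y X u => [|n IH] Y X [|y u] //=.
- move=> _ _ _; split=> // k; rewrite !bal_nil.
  by case: Y => [|b Y] //; case: X => //= -[<-].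
- move=> _ _ _; split=> // k; rewrite !bal_nil.
  by case: Y => [|b Y] //; case: X => //= -[<-].
rewrite ltnS => hu hX.
have hXu X' u' : {subset X' <= X} -> {subset u' <= u} -> forall a y l,
    a \in X' -> y \in u' -> l \in u' -> x l - x y < x y - x a.
  by move=> h1 h2 a z l /h1 aX /h2 zu /h2 lu; apply: hX => //; rewrite inE ?zu ?lu orbT.
have hsuf l s r : arr [::] u = (l, s) :: r -> {subset s <= u} /\ l \in u.
  move=> E; have [|u1 ->] := @arr_suffix [::] u l s; first by rewrite E mem_head.
  by split=> [z|]; rewrite mem_cat inE ?eqxx ?orbT // => ->; rewrite !orbT.
have [e|e|e] := speedP y.
- case: Y => [|b Y] /=; first by rewrite arr_left0.
  by rewrite !arr_left // !bal_left //; apply: IH => //; apply: hXu.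
- by rewrite !arr_right // !bal_right // -cat_cons; apply: IH => //; apply: hXu.
- case: Y => [|b Y] /=.
    case: X hX hXu => [|a X] hX hXu /=.
      by move=> ->; split=> // k ->; rewrite addr0.
    rewrite arr_still // arr_still0 // bal_still // bal_still0 //=.
    case: clashP => [E|l s r E c|l s r E c|l s r E _] /=.
    (* Without the stack [y] survives, with it [y] and [a] destroy each other: this is where
       [size X] in the balance comes from. *)
    + move=> _; have [||-> h] := IH [::] X u hu => //.
        by apply: hXu => // z; rewrite inE => ->; rewrite orbT.
      by split=> // k /h -> /=; congr Some; lia.
    + by exfalso; have [_ lu] := hsuf _ _ _ E;
        have := hX a y l (mem_head _ _) (mem_head _ _); rewrite inE lu orbT => /(_ isT); lra.
    + by exfalso; have [_ lu] := hsuf _ _ _ E;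
        have := hX a y l (mem_head _ _) (mem_head _ _); rewrite inE lu orbT => /(_ isT); lra.
    + rewrite E /= (arr_behead E) => E1; have hs := size_arr_suffix E.
      have [su lu] := hsuf _ _ _ E.
      have [||| -> h] := IH [::] (a :: X) s => //; first by lia.
        exact: hXu.
      split=> // k /h hk.
      rewrite (bal_arr E).
      by rewrite hk /=; congr Some; lia.
  rewrite !arr_still // !bal_still //= /clash.
  case E: (arr [::] u) => [|[l s] r] /=; first by apply: IH => //; apply: hXu.
  have hs := size_arr_suffix E; have [su _] := hsuf _ _ _ E.
  case: ifP => _ /=; first by apply: IH => //; apply: hXu.
  case: ifP => _ /=; first by apply: IH => //; [lia|apply: hXu].
  by rewrite -cat_cons; apply: IH => //; [lia|apply: hXu].
Qed.

Definition ordered X u := pairwise (fun i j => x i < x j) (rev X ++ u).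

Lemma ordered_push X y u : ordered X (y :: u) = ordered (y :: X) u.
Proof. by rewrite /ordered rev_cons cat_rcons. Qed.

Lemma ordered_suffix X u1 u : ordered X (u1 ++ u) -> ordered X u.
Proof.
apply: subseq_pairwise; apply: cat_subseq => //; exact: suffix_subseq.
Qed.

Lemma ordered_tail X y u : ordered X (y :: u) -> ordered X u.
Proof. by rewrite -cat1s; exact: ordered_suffix. Qed.

Lemma ordered_pop a X u : ordered (a :: X) u -> ordered X u.
Proof. by rewrite -ordered_push; exact: ordered_tail. Qed.

Lemma ordered_nil X u : ordered X u -> ordered [::] u.
Proof. by apply: subseq_pairwise; exact: suffix_subseq. Qed.

Lemma ordered_ltl X u a i : ordered X u -> a \in X -> i \in u -> x a < x i.
Proof.
rewrite /ordered pairwise_cat => /and3P[/allrelP h _ _] aX iu.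
by apply: h => //; rewrite mem_rev.
Qed.

Lemma ordered_ltr X u1 u2 i j :
  ordered X (u1 ++ u2) -> i \in u1 -> j \in u2 -> x i < x j.
Proof.
by move=> /ordered_nil; rewrite /ordered /= pairwise_cat => /and3P[/allrelP h _ _]; apply: h.
Qed.

(** All of [w] lies between [y] and [l], so distances inside [w] are below the distance from [a] to
    [y], and [X] is behind [a]. This supplies the hypothesis of [arr_late_stack] when the clash at
    [y] is decided by an arrival from beyond [w]. *)
Lemma ordered_late_stack a X y w t l :
  ordered (a :: X) (y :: w ++ t) -> l \in t -> x l - x y <= x y - x a ->
  forall b z m, b \in X -> z \in w -> m \in w -> x m - x z < x z - x b.
Proof.
move=> o lt c b z m bX zw mw.
have h1 : x b < x a.
  by move: o; rewrite -ordered_push => /ordered_ltl; apply; rewrite // mem_head.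
have h2 : x y < x z.
  by apply: (@ordered_ltr (a :: X) [:: y] (w ++ t)) => //; rewrite ?mem_head ?mem_cat ?zw.
have h3 : x m < x l by apply: (@ordered_ltr (a :: X) (y :: w) t) => //; rewrite inE mw orbT.
by lra.
Qed.

Lemma suffix_cat_mem w t u1 l s :
  w ++ t = u1 ++ l :: s -> (size s < size t)%N -> l \in t.
Proof.
elim: w u1 => [|y w IH] u1 /=; first by move=> -> _; rewrite mem_cat mem_head orbT.
case: u1 => [|z u1] /=; last by move=> [_ /IH].
by move=> [_ <-]; rewrite size_cat; lia.
Qed.

(** The two halves are proved together because a clash consults the arrivals of the rest of the
    word: the first fixes the outcome if the contesting arrival is already in [w], the second shows
    that otherwise it comes from [t]. *)
Lemma arr_cat_aux X w t : ordered X (w ++ t) ->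
  (forall l s r, arr X w = (l, s) :: r ->
     exists r', arr X (w ++ t) = (l, s ++ t) :: r') /\
  (forall l s' r', arr X (w ++ t) = (l, s') :: r' -> (size t <= size s')%N ->
     exists s r, s' = s ++ t /\ arr X w = (l, s) :: r).
Proof.
move: {2}(size w) (leqnn (size w)) => n.
have nilP Y : (forall l s r, arr Y [::] = (l, s) :: r ->
     exists r', arr Y ([::] ++ t) = (l, s ++ t) :: r') /\
  (forall l s' r', arr Y ([::] ++ t) = (l, s') :: r' -> (size t <= size s')%N ->
     exists s r, s' = s ++ t /\ arr Y [::] = (l, s) :: r).
  by split=> // l s r /size_arr_suffix /=; lia.
elim: n X w => [|n IH] X [|y w] //.
rewrite cat_cons ltnS => hw o.
have [e|e|e] := speedP y.
- case: X o => [|a X] o.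
    rewrite !arr_left0 //; split=> l s r [-> <- _]; first by exists (arr [::] (w ++ t)).
    by exists w, (arr [::] w).
  by rewrite !arr_left //; apply: IH => //; apply: ordered_tail (ordered_pop o).
- by rewrite !arr_right //; apply: IH => //; rewrite -ordered_push.
have o' := ordered_tail o; have ow := ordered_nil o'.
have [mono trunc] := IH [::] w hw ow.
have shorter l s r : arr [::] w = (l, s) :: r -> (size s <= n)%N /\
    (forall Y, ordered Y (w ++ t) -> ordered Y (s ++ t)).
  move=> E; split; first exact: leq_trans (ltnW (size_arr_suffix E)) hw.
  move=> Y; have [|u1 ->] := @arr_suffix [::] w l s; first by rewrite E mem_head.
  by rewrite -catA -cat1s catA -catA => /ordered_suffix /ordered_tail.
have beyond l s r : arr [::] w = [::] -> arr [::] (w ++ t) = (l, s) :: r ->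
    (size s < size t)%N.
  by move=> E1 E2; rewrite ltnNge; apply/negP => /(trunc _ _ _ E2)[? [? []]]; rewrite E1.
case: X o o' => [|a X] o o'.
  rewrite !arr_still0 //; case E : (arr [::] w) => [|[l1 s1] r1] /=.
    split=> // l s' r'; case E2 : (arr [::] (w ++ t)) => [|[l2 s2] r2] //= E3 hs.
    have := beyond _ _ _ E E2; rewrite (arr_behead E2) in E3.
    by have := size_arr_suffix E3; lia.
  have [r2 E2] := mono _ _ _ E; rewrite E2 /= (arr_behead E) (arr_behead E2).
  by have [? os] := shorter _ _ _ E; apply: IH => //; apply: os.
have oX := ordered_pop o'.
rewrite !arr_still //; case E : (arr [::] w) => [|[l1 s1] r1].
  have [m1 t1] := IH X w hw oX.
  split=> [l s r /= /[dup] E1 /m1[r' E1']|l s' r'].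
    case: clashP => [_|l2 s2 r2 _ _|l2 s2 r2 E2 c|l2 s2 r2 E2 c] /=; try by exists r'.
    (* An arrival from [t] that reaches [y] in time shows that [X] is too late to act inside [w], so
       [w] read with stack [X] would have no arrival at all. *)
    + exfalso; have [|u1 Eu] := @arr_suffix [::] (w ++ t) l2 s2.
        by rewrite E2 mem_head.
      have l2t := suffix_cat_mem Eu (beyond _ _ _ E E2).
      have c' : x l2 - x y <= x y - x a by lra.
      have := @arr_late_stack [::] X w (ordered_late_stack o l2t c') E.
      by rewrite cat0s E1 => -[].
    + exfalso; have [|u1 Eu] := @arr_suffix [::] (w ++ t) l2 s2.
        by rewrite E2 mem_head.
      have l2t := suffix_cat_mem Eu (beyond _ _ _ E E2).
      have := @arr_late_stack [::] X w (ordered_late_stack o l2t (ltW c)) E.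
      by rewrite cat0s E1 => -[].
  rewrite /=; case: clashP => [_|l2 s2 r2 _ _|l2 s2 r2 E2 c|l2 s2 r2 E2 c] /=; try exact: t1.
  + by move=> /size_arr_suffix; have := beyond _ _ _ E E2; lia.
  + by move=> /size_arr_suffix; have := beyond _ _ _ E E2; lia.
have [r2 E2] := mono _ _ _ E; rewrite E2 /=.
have [hs os] := shorter _ _ _ E.
case: ifP => _ /=; first exact: IH.
by case: ifP => _ /=; apply: IH => //; apply: os.
Qed.

Lemma arr_cat X w t l s r : ordered X (w ++ t) -> arr X w = (l, s) :: r ->
  exists r', arr X (w ++ t) = (l, s ++ t) :: r'.
Proof. by move=> /arr_cat_aux[h _]; apply: h. Qed.

Lemma arr_cat_none X w t : ordered X (w ++ t) ->
  arr X (w ++ t) = [::] -> arr X w = [::].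
Proof.
move=> o E; case E2 : (arr X w) => [|[l s] r] //.
by have [r'] := arr_cat o E2; rewrite E.
Qed.

Lemma arr_truncate X w t l s' r' : ordered X (w ++ t) ->
  arr X (w ++ t) = (l, s') :: r' -> (size t <= size s')%N ->
  exists s r, s' = s ++ t /\ arr X w = (l, s) :: r.
Proof. by move=> /arr_cat_aux[_ h]; apply: h. Qed.

Lemma arr_beyond X w t l s r : ordered X (w ++ t) -> arr X w = [::] ->
  arr X (w ++ t) = (l, s) :: r -> l \in t.
Proof.
move=> o E1 E2; have [|u1 Eu] := @arr_suffix X (w ++ t) l s.
  by rewrite E2 mem_head.
apply: (suffix_cat_mem Eu); rewrite ltnNge; apply/negP.
by move=> /(arr_truncate o E2)[? [? []]]; rewrite E1.
Qed.

(* Superadditivity: a word in which no right-mover survives lets through at most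
   [#left - #static] more left-movers than come from its right. *)
Lemma size_arr_cat X w t k : ordered X (w ++ t) -> bal X w = Some k ->
  ((size (arr X (w ++ t)))%:Z <= (size (arr X w))%:Z) \/
  ((size (arr X (w ++ t)))%:Z <= (size (arr [::] t))%:Z - k).
Proof.
move: {2}(size w) (leqnn (size w)) => n.
elim: n X w k => [|n IH] X [|y w] k //=.
- by move=> _ _; rewrite bal_nil; case: X => // -[<-]; right; lia.
- by move=> _ _; rewrite bal_nil; case: X => // -[<-]; right; lia.
rewrite ltnS => hw o.
have o' := ordered_tail o; have ow := ordered_nil o'.
have [e|e|e] := speedP y.
- case: X o o' => [|a X] o o'.
    rewrite !arr_left0 // bal_left0 //; case E : (bal _ w) => [k'|] //= -[<-].
    by have := IH _ _ _ hw ow E; lia.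
  by rewrite !arr_left // bal_left //; apply: IH => //; apply: ordered_pop o'.
- by rewrite !arr_right // bal_right //; apply: IH => //; rewrite -ordered_push.
case: X o o' => [|a X] o o'.
  rewrite !arr_still0 // bal_still0 // !size_behead; case E : (bal _ w) => [k'|] //= -[<-].
  by have := IH _ _ _ hw ow E; lia.
have oX := ordered_pop o'.
have shorter l s r : arr [::] w = (l, s) :: r -> (size s <= n)%N /\
    (forall Y, ordered Y (w ++ t) -> ordered Y (s ++ t)).
  move=> E; split; first exact: leq_trans (ltnW (size_arr_suffix E)) hw.
  move=> Y; have [|u1 ->] := @arr_suffix [::] w l s; first by rewrite E mem_head.
  by rewrite -catA -cat1s catA -catA => /ordered_suffix /ordered_tail.
rewrite !arr_still // bal_still //; case E : (arr [::] w) => [|[l1 s1] r1].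
  rewrite /= => hb.
  (* The clash at [y] turns out differently only if an arrival from [t] reaches [y] in time. Then
     the stack is idle inside [w], so [w] read without it has a balance larger by [size X], and one
     more arrival is spent on [y]. Releasing [X] or [a :: X] gives back at most that many, by
     [size_arr_stack]. *)
  have key l s r : arr [::] (w ++ t) = (l, s) :: r -> x l - x y <= x y - x a ->
      ((size X).+1 + size (arr [::] s))%N%:Z <= (size (arr [::] t))%:Z - k.
    move=> E2 c; have lt := arr_beyond ow E E2.
    have [_ /(_ _ hb) hb0] := @arr_late_stack [::] X w (ordered_late_stack o lt c) E.
    have := IH _ _ _ hw ow hb0; rewrite E (size_arr_cons E2) /=; lia.
  case: clashP => [_|l2 s2 r2 _ _|l2 s2 r2 E2 c|l2 s2 r2 E2 c] /=; try exact: IH.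
  + right; have := @size_arr_stack [::] X s2; rewrite cat0s.
    have c' : x l2 - x y <= x y - x a by rewrite c.
    by have := key _ _ _ E2 c'; lia.
  + right; have := @size_arr_stack [::] (a :: X) s2; rewrite cat0s /=.
    by have := key _ _ _ E2 (ltW c); lia.
have [r2 E2] := arr_cat ow E; rewrite E2 /=.
have [hs os] := shorter _ _ _ E.
case: ifP => _ /=; first exact: IH.
by case: ifP => _ /=; apply: IH => //; apply: os.
Qed.

(** A left-mover escapes only after the stacked right-movers are gone, and for that some prefix must
    have cancelled exactly with the stack. In the contrapositive, a block without a
    self-annihilating prefix emits no left-mover. *)
Lemma arr_prefix_balanced X u : ordered X u -> X != [::] -> arr X u != [::] ->
  exists w t, [/\ u = w ++ t, w != [::], bal X w = Some 0 & arr X w = [::]].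
Proof.
move: {2}(size u) (leqnn (size u)) => n.
elim: n X u => [|n IH] X [|y u] //=; rewrite ltnS => hu o X0.
have o' := ordered_tail o; have ou := ordered_nil o'.
have [e|e|e] := speedP y.
- case: X o o' X0 => [|a X] // o o' _; rewrite arr_left // => A0.
  have [X0|X0] := eqVneq X [::].
    by exists [:: y], u; split=> //; rewrite ?bal_left ?arr_left // X0.
  have [w [t [-> w0 b0 a0]]] := IH _ _ hu (ordered_pop o') X0 A0.
  by exists (y :: w), t; rewrite bal_left // arr_left.
- rewrite arr_right // => A0.
  have [||w [t [-> w0 b0 a0]]] := IH (y :: X) u hu _ isT => //.
    by rewrite -ordered_push.
  by exists (y :: w), t; rewrite bal_right // arr_right.
case: X o o' X0 => [|a X] // o o' _; have oX := ordered_pop o'.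
have base : X = [::] -> exists w t, [/\ y :: u = w ++ t, w != [::],
    bal (a :: X) w = Some 0 & arr (a :: X) w = [::]].
  by move=> ->; exists [:: y], u; rewrite bal_still // arr_still.
have [X0|X0] := eqVneq X [::]; first by move=> _; apply: base.
rewrite arr_still //; case E : (arr [::] u) => [|[l1 s1] r1] /= => [A0|].
  have [w [t [Eu w0 b0 a0]]] := IH _ _ hu oX X0 A0.
  exists (y :: w), t; rewrite Eu bal_still // arr_still //=.
  by rewrite Eu in E ou; rewrite (arr_cat_none ou E).
have [|u1 Eu] := @arr_suffix [::] u l1 s1; first by rewrite E mem_head.
have hs := size_arr_suffix E.
have os Y : ordered Y u -> ordered Y s1.
  by rewrite Eu -cat1s catA => /ordered_suffix.
(* Cutting the word somewhere behind [l1] keeps [l1] as first arrival, so the shortened word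
   resolves the clash at [y] in the same way. *)
have sub w t : s1 = w ++ t -> exists r, arr [::] (u1 ++ l1 :: w) = (l1, w) :: r.
  move=> Es; have Eu' : u = (u1 ++ l1 :: w) ++ t by rewrite Eu Es -catA.
  rewrite Eu' in E ou; have [|s [r [Ews E3]]] := arr_truncate ou E.
    by rewrite Es size_cat leq_addl.
  exists r; rewrite E3; rewrite Es in Ews.
  have hw : size w = size s by move/(congr1 size): Ews; rewrite !size_cat => /addIn.
  by move/eqP: Ews; rewrite eqseq_cat // => /andP[/eqP -> _].
case: ifP => c1 /=; last case: ifP => c2 /=.
- move=> A0; have [w [t [Eu2 w0 b0 a0]]] := IH _ _ hu oX X0 A0.
  exists (y :: w), t; rewrite Eu2 bal_still // arr_still //=.
  (* A contesting arrival inside [w] would be the first arrival of [u] too, hence equally too far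
     away to matter. *)
  suff -> : clash (arr [::] w) a X y w = (X, w) by [].
  case: clashP => // l s r E3 c; rewrite Eu2 in E ou;
    have [r' E4] := arr_cat ou E3; rewrite E4 in E; case: E => El _ _.
    by exfalso; move: c1; rewrite -El c ltxx.
  by exfalso; move: c1; rewrite -El; lra.
- have hs1 : (size s1 <= n)%N by apply: leq_trans (ltnW hs) hu.
  move=> A0; have [w [t [Es w0 b0 a0]]] := IH X s1 hs1 (os _ oX) X0 A0.
  have [r E3] := sub _ _ Es.
  exists (y :: u1 ++ l1 :: w), t; split=> //=; first by rewrite Eu Es -catA.
    by rewrite bal_still // E3 /= c1 c2.
  by rewrite arr_still // E3 /= c1 c2.
- have hs1 : (size s1 <= n)%N by apply: leq_trans (ltnW hs) hu.
  move=> A0; have [w [t [Es w0 b0 a0]]] := IH (a :: X) s1 hs1 (os _ o') isT A0.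
  have [r E3] := sub _ _ Es.
  exists (y :: u1 ++ l1 :: w), t; split=> //=; first by rewrite Eu Es -catA.
    by rewrite bal_still // E3 /= c1 c2.
  by rewrite arr_still // E3 /= c1 c2.
Qed.

End arrivals.

(** * Dynamics restricted to a set of particles, and finite speed of influence *)

Section restricted_dynamics.
Context {R : realType}.
Variables (x v : int -> R).
Hypothesis x_mono : forall i j, i < j -> x i < x j.
Hypothesis v_bound : forall i, -1 <= v i <= 1.
Implicit Types (W : set int) (T : int -> \bar R).

(** The dynamics of the particles of [W] with all others deleted; [T] is unconstrained outside [W].
    Finite words, clusters that die at one point and the full line are all instances. *)
Definition solution W T :=
  (forall i, W i -> (0 <= T i)%E) /\
  (forall i (t : R), W i -> (T i = t%:E <->
     [/\ 0 <= t, (t%:E <= T i)%E &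
         exists j, [/\ W j, j != i, meet x v i j t & (t%:E <= T j)%E]])).

Lemma solution_setT T : solution setT T <-> annihilation_times x v T.
Proof.
split=> -[h1 h2]; split=> [i|i t].
- exact: h1.
- by rewrite h2 //; split=> -[a b [j jP]]; split=> //; exists j; case: jP.
- by move=> _; apply: h1.
- by move=> _; rewrite h2 //; split=> -[a b [j jP]]; split=> //; exists j; case: jP.
Qed.

Lemma x_inj i j : i != j -> x i != x j.
Proof.
by rewrite neq_lt => /orP[] /x_mono; [move/lt_eqF->|move/gt_eqF->].
Qed.

Lemma v_bound_mul k (s : R) : 0 <= s -> - s <= v k * s <= s.
Proof. by move=> s0; have /andP[? ?] := v_bound k; apply/andP; split; nra. Qed.

Lemma meet_sym i j t : meet x v i j t -> meet x v j i t.
Proof. by []. Qed.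

(** For equal speeds the inverse of zero makes this 0, so [0 < meet_time i j] also excludes parallel
    trajectories. *)
Definition meet_time i j := (x j - x i) / (v i - v j).

Lemma meet_timeE i j t : i != j -> meet x v i j t -> t = meet_time i j.
Proof.
move=> /x_inj xij; rewrite /meet /meet_time => h.
have d : v i - v j != 0.
  apply/eqP => e; move/eqP: xij; apply.
  have e' : v i = v j by apply/eqP; rewrite -subr_eq0 e.
  by rewrite e' in h; apply: addIr h.
by apply: (mulIf d); rewrite divfK // mulrBr (mulrC t) (mulrC t); lra.
Qed.

Lemma solution_meet W T i j t : solution W T -> W i -> W j -> i != j -> 0 <= t ->
  meet x v i j t -> (t%:E <= T i)%E -> (t%:E <= T j)%E -> T i = t%:E.
Proof.
move=> [_ h] Wi Wj ij t0 m hi hj; apply/(h _ _ Wi).2; split=> //.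
by exists j; split=> //; rewrite eq_sym.
Qed.

Lemma solution_partner W T i t : solution W T -> W i -> T i = t%:E ->
  0 <= t /\ exists j, [/\ W j, j != i, meet x v i j t & T j = t%:E].
Proof.
move=> s Wi Ti; have [t0 ti [j [Wj ji m tj]]] := (s.2 _ _ Wi).1 Ti.
split=> //; exists j; split=> //.
by apply: (@solution_meet W T j i).
Qed.

(** To exchange their order the two would have to meet before [t] while both are present, and they
    would be destroyed there. *)
Lemma solution_le W T i j t : solution W T -> W i -> W j -> x i < x j -> 0 <= t ->
  (t%:E <= T i)%E -> (t%:E <= T j)%E -> x i + v i * t <= x j + v j * t.
Proof.
move=> sT Wi Wj xij t0 hi hj; rewrite leNgt; apply/negP => c.
have d : 0 < v i - v j by nra.
pose s := meet_time i j.
have s0 : 0 < s by rewrite /s /meet_time divr_gt0 // subr_gt0.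
have sE : s * (v i - v j) = x j - x i by rewrite /s divfK // gt_eqF.
have st : s < t by nra.
have m : meet x v i j s by rewrite /meet; nra.
have st' : (s%:E < t%:E)%E by rewrite lte_fin.
have nij : i != j by apply: contraTneq xij => ->; rewrite ltxx.
have Ti := solution_meet sT Wi Wj nij (ltW s0) m
  (le_trans (ltW st') hi) (le_trans (ltW st') hj).
by move: hi; rewrite Ti lee_fin leNgt st.
Qed.

Lemma solution_lt W T i j t : solution W T -> W i -> W j -> x i < x j -> 0 <= t ->
  (t%:E <= T i)%E -> (t%:E <= T j)%E -> (t%:E < T i)%E \/ (t%:E < T j)%E ->
  x i + v i * t < x j + v j * t.
Proof.
move=> sT Wi Wj xij t0 hi hj h; rewrite lt_neqAle (solution_le sT) // andbT.
have nij : i != j by apply: contraTneq xij => ->; rewrite ltxx.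
apply/eqP => m; case: h.
  by rewrite (solution_meet sT Wi Wj nij t0 m hi hj) ltxx.
by rewrite eq_sym in nij; rewrite (solution_meet sT Wj Wi nij t0 (meet_sym m) hj hi) ltxx.
Qed.

(* Induction on the rank stands for induction on time: among finitely many
   particles only finitely many meeting times precede [s]. *)
Definition meet_rank (A : seq int) (s : R) :=
  count (fun p => meet_time p.1 p.2 < s) (allpairs pair A A).

Lemma meet_rank_lt A k j s s' : k \in A -> j \in A -> k != j ->
  meet x v k j s' -> s' < s -> (meet_rank A s' < meet_rank A s)%N.
Proof.
move=> kA jA kj m lt; rewrite /meet_rank.
have e := meet_timeE kj m.
have : (k, j) \in allpairs pair A A by apply/allpairsP; exists (k, j).
elim: (allpairs pair A A) => //= p r IH; rewrite inE => /orP[/eqP<-|/IH h] /=.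
  rewrite -e ltxx lt /= add0n add1n ltnS; apply: sub_count => q /= h.
  exact: lt_trans h lt.
rewrite -addnS; apply: leq_add => //.
by case: (ltP _ s') => // h'; rewrite (lt_trans h' lt).
Qed.

Section agreement.
Variables (W1 W2 : set int) (T1 T2 : int -> \bar R).
Variables (Q : int -> R -> Prop) (A : seq int).
Hypotheses (sol1 : solution W1 T1) (sol2 : solution W2 T2).
Hypothesis QA : forall k s, Q k s -> [/\ W1 k, W2 k & k \in A].
Hypothesis Qle : forall k s s', Q k s -> 0 <= s' <= s -> Q k s'.
Hypothesis Q1 : forall k j s, Q k s -> W1 j -> 0 <= s -> j != k ->
  meet x v k j s -> (s%:E <= T1 k)%E -> (s%:E <= T1 j)%E -> Q j s.
Hypothesis Q2 : forall k j s, Q k s -> W2 j -> 0 <= s -> j != k ->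
  meet x v k j s -> (s%:E <= T2 k)%E -> (s%:E <= T2 j)%E -> Q j s.

Let rank := meet_rank A.

Let agree_step Wa Wb Ta Tb k s :
  solution Wa Ta -> solution Wb Tb ->
  (forall k s, Q k s -> [/\ Wa k, Wb k & k \in A]) ->
  (forall k j s, Q k s -> Wa j -> 0 <= s -> j != k -> meet x v k j s ->
     (s%:E <= Ta k)%E -> (s%:E <= Ta j)%E -> Q j s) ->
  (forall k j s, Q k s -> Wb j -> 0 <= s -> j != k -> meet x v k j s ->
     (s%:E <= Tb k)%E -> (s%:E <= Tb j)%E -> Q j s) ->
  (forall k' s', Q k' s' -> (rank s' < rank s)%N -> Ta k' = s'%:E <-> Tb k' = s'%:E) ->
  Q k s -> Ta k = s%:E -> Tb k = s%:E.
Proof.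
move=> sa sb hA ha hb IH Qk Tk.
have [Wak Wbk kA] := hA _ _ Qk.
have [s0 [j [Waj jk m Tj]]] := solution_partner sa Wak Tk.
have Qj : Q j s by apply: (ha k) => //; rewrite ?Tk ?Tj.
have [_ Wbj jA] := hA _ _ Qj.
(* An earlier death of [i] in the second system has smaller rank, so by induction it would have
   occurred in the first one as well. *)
have alive i : Q i s -> Ta i = s%:E -> (s%:E <= Tb i)%E.
  move=> Qi Ti; rewrite leNgt; apply/negP.
  have [_ Wbi iA] := hA _ _ Qi.
  have := sb.1 _ Wbi; case E : (Tb i) => [s'| |] // s'0 lt.
  rewrite lee_fin in s'0; rewrite lte_fin in lt.
  have Qi' : Q i s' by apply: Qle Qi _; rewrite s'0 ltW.
  have [_ [j' [Wbj' ji' m' Tj']]] := solution_partner sb Wbi E.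
  have Qj' : Q j' s' by apply: (hb i) => //; rewrite ?E ?Tj'.
  have [_ _ j'A] := hA _ _ Qj'.
  have r : (rank s' < rank s)%N by apply: (meet_rank_lt iA j'A) => //; rewrite eq_sym.
  by move: ((IH _ _ Qi' r).2 E); rewrite Ti => -[e]; rewrite e ltxx in lt.
have kj : k != j by rewrite eq_sym.
by apply: (solution_meet sb Wbk Wbj kj s0 m); apply: alive.
Qed.

(** [Q] is a space-time region closed under going back along a trajectory and under passing to a
    particle met there, so a first difference inside it would need an earlier one. It is used for
    light cones and for the region to the left of the path of a left-mover. *)
Lemma solution_agree k s : Q k s -> T1 k = s%:E <-> T2 k = s%:E.
Proof.
have [n] := ubnP (rank s); elim: n k s => // n IH k s /ltnSE hn Qk.
have IH' k' s' : Q k' s' -> (rank s' < rank s)%N ->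
    T1 k' = s'%:E <-> T2 k' = s'%:E.
  by move=> Q' r; apply: IH => //; apply: leq_trans r hn.
split; first by apply: (@agree_step W1 W2 T1 T2).
apply: (@agree_step W2 W1 T2 T1) => // [k' s' /QA[]|k' s' Q' r] //.
by rewrite IH'.
Qed.

End agreement.

(* Speeds are at most 1, so the fate of [k0] until [s0] depends only on the
   particles that start within distance [s0] of its position at time [s0]. *)
Lemma solution_cone W1 W2 T1 T2 k0 s0 (A : seq int) :
  solution W1 T1 -> solution W2 T2 -> W1 k0 -> W2 k0 -> 0 <= s0 ->
  (forall j, - s0 <= x j - (x k0 + v k0 * s0) <= s0 ->
     (W1 j <-> W2 j) /\ (W1 j -> j \in A)) ->
  T1 k0 = s0%:E <-> T2 k0 = s0%:E.
Proof.
move=> sol1 sol2 W1k W2k s00 hA; pose y0 := x k0 + v k0 * s0.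
pose Q k s := [/\ 0 <= s, W1 k, W2 k & - (s0 - s) <= x k + v k * s - y0 <= s0 - s].
have near k s : 0 <= s -> - (s0 - s) <= x k + v k * s - y0 <= s0 - s ->
    - s0 <= x k - y0 <= s0.
  by move=> s1 /andP[h1 h2]; have /andP[h3 h4] := v_bound_mul k s1; apply/andP; split; lra.
have nbr k j s : Q k s -> meet x v k j s ->
    - (s0 - s) <= x j + v j * s - y0 <= s0 - s.
  by move=> [_ _ _ h] <-.
apply: (@solution_agree W1 W2 T1 T2 Q A) => //.
- by move=> k s [s1 h1 h2 /(near _ _ s1) /hA[_]]; split=> //; auto.
- move=> k s s' [s1 h1 h2 /andP[h3 h4]] /andP[s2 s3]; split=> //.
  have d : 0 <= s - s' by lra.
  have /andP[h5 h6] := v_bound_mul k d.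
  by rewrite mulrBr in h5 h6; apply/andP; split; lra.
- move=> k j s Qk Wj s1 _ /(nbr _ _ _ Qk) h _ _; split=> //.
  by have [/(_ Wj)] := (hA _ (near _ _ s1 h)).1.
- move=> k j s Qk Wj s1 _ /(nbr _ _ _ Qk) h _ _; split=> //.
  by have [_ /(_ Wj)] := (hA _ (near _ _ s1 h)).1.
- split=> //; rewrite /y0; apply/andP; split; lra.
Qed.

Lemma solution_cone_le W1 W2 T1 T2 k0 s0 (A : seq int) :
  solution W1 T1 -> solution W2 T2 -> W1 k0 -> W2 k0 ->
  (forall j, - s0 <= x j - (x k0 + v k0 * s0) <= s0 ->
     (W1 j <-> W2 j) /\ (W1 j -> j \in A)) ->
  (s0%:E <= T1 k0)%E -> (s0%:E <= T2 k0)%E.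
Proof.
move=> sol1 sol2 W1k W2k hA h1; rewrite leNgt; apply/negP.
have := sol2.1 _ W2k; case E : (T2 k0) => [s| |] //; rewrite lee_fin lte_fin => s1 lt.
suff e : T1 k0 = s%:E by move: h1; rewrite e lee_fin leNgt lt.
apply/(@solution_cone W1 W2 T1 T2 k0 s A) => // j /andP[h2 h3]; apply: hA.
have d : 0 <= s0 - s by lra.
have /andP[h5 h6] := v_bound_mul k0 d.
by rewrite mulrBr in h5 h6; apply/andP; split; lra.
Qed.

Definition join_times W1 (T1 T2 : int -> \bar R) i := if `[< W1 i >] then T1 i else T2 i.

Lemma join_times1 W1 T1 T2 i : W1 i -> join_times W1 T1 T2 i = T1 i.
Proof. by move=> h; rewrite /join_times; case: asboolP. Qed.

Lemma join_times2 W1 T1 T2 i : ~ W1 i -> join_times W1 T1 T2 i = T2 i.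
Proof. by move=> h; rewrite /join_times; case: asboolP. Qed.

(** The tool for building solutions: a cluster that destroys itself is put next to a solution for
    the remaining particles. *)
Lemma solution_glue W1 W2 T1 T2 : solution W1 T1 -> solution W2 T2 ->
  (forall i, W1 i -> ~ W2 i) ->
  (forall i j t, W1 i -> W2 j -> 0 <= t -> meet x v i j t ->
     (t%:E <= T1 i)%E -> (t%:E <= T2 j)%E -> False) ->
  solution (fun i => W1 i \/ W2 i) (join_times W1 T1 T2).
Proof.
move=> s1 s2 dis cross.
have g2 i : W2 i -> join_times W1 T1 T2 i = T2 i.
  by move=> W2i; apply: join_times2 => /dis.
split=> [i [Wi|Wi]|i t [Wi|Wi]].
- by rewrite join_times1 //; apply: s1.1.
- by rewrite g2 //; apply: s2.1.
- rewrite join_times1 // s1.2 //; split=> -[t0 ti [j [Wj ji m tj]]]; split=> //; exists j.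
    by split=> //; rewrite ?join_times1 //; left.
  case: Wj => Wj; first by split=> //; rewrite join_times1 in tj.
  by exfalso; apply: (cross i j t) => //; rewrite -(g2 j).
- rewrite g2 // s2.2 //; split=> -[t0 ti [j [Wj ji m tj]]]; split=> //; exists j.
    by split=> //; rewrite ?g2 //; right.
  case: Wj => Wj; last by split=> //; rewrite g2 in tj.
  by exfalso; apply: (cross j i t) => //; rewrite join_times1 in tj.
Qed.

End restricted_dynamics.

(** * The word recursion computes the dynamics of finitely many particles *)

Section finite_solutions.
Context {R : realType}.
Variables (x v : int -> R).
Hypothesis x_mono : forall i j, i < j -> x i < x j.
Hypothesis v_range : forall i, [\/ v i = -1, v i = 0 | v i = 1].
Implicit Types (W : set int) (T : int -> \bar R) (X Y u s : seq int).

Let v_bound i : -1 <= v i <= 1.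
Proof. by case: (v_range i) => ->; apply/andP; split; lra. Qed.

Lemma ge_left i t : 0 <= t -> x i - t <= x i + v i * t.
Proof. by move=> t0; have /andP[? ?] := v_bound_mul v_bound i t0; lra. Qed.

Lemma solution_ext W W' T : (forall i, W i <-> W' i) ->
  solution x v W T -> solution x v W' T.
Proof. by move=> h; have -> : W' = W by apply/predeqP => i; rewrite h. Qed.

Lemma solution_sub W V T : solution x v W T -> (forall i, V i -> W i) ->
  (forall i j t, V i -> W j -> 0 <= t -> meet x v i j t -> T i = t%:E ->
     T j = t%:E -> V j) -> solution x v V T.
Proof.
move=> sW VW closed; split=> [i Vi|i t Vi]; first exact/sW.1/VW.
split=> [Ti|[t0 ti [j [Vj ji m tj]]]]; last first.
  by apply: (@solution_meet _ x v W T i j) => //; rewrite 1?eq_sym//; exact: VW.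
have [t0 [j [Wj ji m Tj]]] := solution_partner sW (VW _ Vi) Ti.
split=> //; first by rewrite Ti.
by exists j; split=> //; [exact: (closed i j t)|rewrite Tj].
Qed.

Lemma solution_infty W : (forall i j t, W i -> W j -> i != j -> 0 <= t ->
  ~ meet x v i j t) -> solution x v W (fun=> +oo%E).
Proof.
move=> h; split=> // i t Wi; split=> // -[t0 _ [j [Wj ji m _]]].
by exfalso; apply: (h j i t) => //; exact: meet_sym.
Qed.

Lemma solution_cluster W (p : R) (t0 : R) : 0 <= t0 ->
  (forall i, W i -> x i + v i * t0 = p) ->
  (forall i, W i -> exists j, W j /\ j != i) ->
  solution x v W (fun=> t0%:E).
Proof.
move=> t00 hp h; split=> [i _|i t Wi]; first by rewrite lee_fin.
split=> [[<-]|[t1 _ [j [Wj ji m _]]]].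
  split=> //; have [j [Wj ji]] := h _ Wi; exists j; split=> //.
  by rewrite /meet (hp _ Wi) (hp _ Wj).
congr EFin; rewrite eq_sym in ji.
have m0 : meet x v i j t0 by rewrite /meet (hp _ Wi) (hp _ Wj).
by rewrite (meet_timeE x_mono ji m) (meet_timeE x_mono ji m0).
Qed.

(** Only a left-mover can come to [y] from the right. Beyond [y] it meets nobody: the other
    left-movers are parallel to it, and all other particles stay to the right of [y]. *)
Lemma solution_reach W T (y : R) k t : solution x v W T ->
  (forall j, W j -> y < x j) -> W k -> 0 <= t -> (t%:E <= T k)%E ->
  x k + v k * t <= y -> v k = -1 /\ T k = +oo%E.
Proof.
move=> sT hy Wk t0 tk r; have yk := hy _ Wk.
have vk : v k = -1 by case: (v_range k) => // e; rewrite e in r; lra.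
split=> //; have := sT.1 _ Wk; case E : (T k) => [s| |] // _.
have [s0 [j [Wj jk m _]]] := solution_partner sT Wk E.
rewrite E lee_fin in tk; have yj := hy _ Wj.
rewrite /meet vk in m; rewrite vk in r.
exfalso; case: (v_range j) => e; rewrite e in m; try lra.
by move: (x_inj x_mono jk) => /eqP; apply; lra.
Qed.

Section glue_through.
Variables (y l : int) (u1 s Y : seq int) (T' T2 : int -> \bar R) (C : set int).
Let tau := x l - x y.
Hypothesis ord : ordered x [:: y] (u1 ++ l :: s).
Hypothesis sol' : solution x v (fun i => i \in u1 ++ l :: s) T'.
Hypothesis vl : v l = -1.
Hypothesis Tl : T' l = +oo%E.
Hypothesis Tu1 : forall k, k \in u1 -> T' k <> +oo%E.
Hypothesis C_range : forall i, C i ->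
  [\/ i = y /\ v i = 0, i = l | v i = 1 /\ x i + tau = x y].
Hypothesis C_sol : solution x v C (fun=> tau%:E).
Hypothesis Y_late : forall i, i \in Y -> v i = 1 /\ x i + tau < x y.
Hypothesis sol2 : solution x v (fun i => i \in Y \/ i \in s) T2.

Let lw : l \in u1 ++ l :: s. Proof. by rewrite mem_cat mem_head orbT. Qed.
Let u1w i : i \in u1 -> i \in u1 ++ l :: s. Proof. by rewrite mem_cat => ->. Qed.
Let yw j : j \in u1 ++ l :: s -> x y < x j.
Proof. by move=> h; apply: (ordered_ltl ord) => //; rewrite mem_head. Qed.
Let u1l i : i \in u1 -> x i < x l.
Proof. by move=> h; apply: (ordered_ltr ord) => //; rewrite mem_head. Qed.
Let ls j : j \in s -> x l < x j.
Proof.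
move: ord; rewrite -[l :: s]cat1s catA => o h; apply: (ordered_ltr o) => //.
by rewrite mem_cat mem_head orbT.
Qed.

Let u1_before i t : i \in u1 -> 0 <= t -> (t%:E <= T' i)%E ->
  x y < x i + v i * t /\ x i + v i * t < x l - t.
Proof.
move=> iu t0 ti; split.
  rewrite ltNge; apply/negP => /(solution_reach sol' yw (u1w iu) t0 ti)[_].
  exact: Tu1.
have := solution_lt sol' (u1w iu) lw (u1l iu) t0 ti.
by rewrite Tl leey vl mulN1r => /(_ isT); apply; right; rewrite ltry.
Qed.

Let T1 := join_times C (fun=> tau%:E) T'.

Let Cu1 i : C i -> ~ (i \in u1).
Proof.
move=> Ci iu; have h1 := yw (u1w iu); have h2 := u1l iu; have h3 := yw lw.
by case: (C_range Ci) => [[e _]|e|[_ e]];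
  [rewrite e ltxx in h1|rewrite e ltxx in h2|rewrite /tau in e; lra].
Qed.

Let sol1 : solution x v (fun i => C i \/ i \in u1) T1.
Proof.
apply: solution_glue => //.
  apply: (solution_sub sol') => [i|i j t iu]; first exact: u1w.
  rewrite mem_cat inE => /or3P[//|/eqP->|js] t0 m Ti Tj.
    by rewrite Tl in Tj.
  have ti : (t%:E <= T' i)%E by rewrite Ti.
  have [_ h] := u1_before iu t0 ti.
  by have := ge_left j t0; have := ls js; rewrite /meet in m; lra.
move=> i j t Ci ju t0 m; rewrite lee_fin => tt tj.
have [h1 h2] := u1_before ju t0 tj.
case: (C_range Ci) => [[e1 e2]|e|[e1 e2]].
- by move: m; rewrite /meet e2 e1; lra.
- by move: m; rewrite /meet e vl; lra.
- by move: m; rewrite /meet e1; rewrite /tau in e2 tt *; lra.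
Qed.

(** [l] is the first arrival at the static [y]; [C] is what dies at [y] at time [tau]: [y], [l] and,
    in a tie, one right-mover. The particles of [u1] die inside the triangle between [y] and the
    path of [l], those of [s] stay behind that path since nothing is faster than [l], and those of
    [Y] could reach [y] only after [tau]. Hence the pieces do not touch. *)
Lemma solution_through : exists T,
  [/\ solution x v (fun i => (C i \/ i \in u1) \/ (i \in Y \/ i \in s)) T,
      forall i, C i \/ i \in u1 -> T i <> +oo%E
    & forall i, i \in s -> T i = T2 i].
Proof.
have dis i : C i \/ i \in u1 -> ~ (i \in Y \/ i \in s).
  have h0 := yw lw.
  move=> [Ci|iu] [iY|iS].
  - have [_ h] := Y_late iY; case: (C_range Ci) => [[e _]|e|[_ e]];
      rewrite /tau ?e in h *; rewrite /tau in e; lra.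
  - have h := ls iS; case: (C_range Ci) => [[e _]|e|[_ e]]; rewrite ?e in h *; rewrite /tau in e; lra.
  - by have [_ h] := Y_late iY; have := yw (u1w iu); rewrite /tau in h; lra.
  - by have := ls iS; have := u1l iu; lra.
exists (join_times (fun i => C i \/ i \in u1) T1 T2); split.
- apply: solution_glue => // i j t Wi Wj t0 m t1 t2.
  have h0 := yw lw.
  have jl : j \in s -> x l - t < x j + v j * t.
    by move=> /ls; have := ge_left j t0; lra.
  move: t1; rewrite /T1; case: Wi => [Ci|iu].
    rewrite join_times1 // lee_fin => tt.
    case: (C_range Ci) => [[e1 e2]|e|[e1 e2]]; case: Wj => [/Y_late[vj hj]|/jl hj];
      move: m; rewrite /meet ?vj; rewrite /tau in hj tt *.
    + by rewrite e2 e1; lra.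
    + by rewrite e2 e1; lra.
    + by rewrite e vl; lra.
    + by rewrite e vl; lra.
    + by rewrite e1; rewrite /tau in e2; lra.
    + by rewrite e1; rewrite /tau in e2; lra.
  rewrite join_times2; last by move=> /Cu1.
  move=> /(u1_before iu t0)[h1 h2].
  case: Wj => [/Y_late[vj hj]|/jl hj]; move: m; rewrite /meet ?vj; rewrite /tau in hj *; lra.
- move=> i h; rewrite join_times1 // /T1; case: (pselect (C i)) => Ci; first by rewrite join_times1.
  by rewrite join_times2 //; case: h => // /Tu1.
- by move=> i iS; rewrite join_times2 // => /dis; apply; right.
Qed.

End glue_through.

(** Only the first arrival is described; by [arr_behead] the later ones are first arrivals of
    suffixes. *)
Definition certified X u T :=
  [/\ solution x v (fun i => i \in X \/ i \in u) T,
      arr x v X u = [::] -> forall k, k \in u -> v k = -1 -> T k <> +oo%E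
    & forall l s r, arr x v X u = (l, s) :: r ->
       [/\ v l = -1, T l = +oo%E & forall k, k \in u -> x k < x l -> T k <> +oo%E]].

Lemma certified_step X u X2 u2 T T2 : certified X2 u2 T2 ->
  solution x v (fun i => i \in X \/ i \in u) T ->
  arr x v X u = arr x v X2 u2 ->
  (forall k, k \in u2 -> T k = T2 k) ->
  (forall k, k \in u -> k \notin u2 -> T k <> +oo%E) ->
  certified X u T.
Proof.
move=> [_ c1 c2] sT e e2 e3; split=> //; rewrite e.
- move=> /c1 h k ku vk; have [k2|k2] := boolP (k \in u2); last exact: e3.
  by rewrite e2 //; apply: h.
- move=> l s r E; have [h1 h2 h3] := c2 _ _ _ E; split=> //.
    rewrite e2 //; have [|w ->] := @arr_suffix _ x v X2 u2 l s.
      by rewrite E mem_head.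
    by rewrite mem_cat mem_head orbT.
  move=> k ku kl; have [k2|k2] := boolP (k \in u2); last exact: e3.
  by rewrite e2 //; apply: h3.
Qed.

Ltac decide_membership :=
  rewrite ?inE ?mem_cat ?inE;
  repeat match goal with
  | |- context [?a \in ?b] => case: (a \in b)
  | |- context [?a == ?b] => case: (a == b)
  end; rewrite /=; clear; intuition discriminate.

(** The induction follows [arr_rec]: a right-mover joins the stack, a colliding pair or triple
    becomes a cluster, and the cluster is glued to the solution for the stack and word with which
    the recursion continues. *)
Lemma certified_exists X u : ordered x X u -> (forall a, a \in X -> v a = 1) ->
  exists T, certified X u T.
Proof.
move: {2}(size u) (leqnn (size u)) => n.
elim: n X u => [|n IH] X [|y u] //=.
- move=> _ _ vX; exists (fun=> +oo%E); split=> //.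
  apply: solution_infty => i j t [/vX vi|//] [/vX vj|//] ij t0.
  by rewrite /meet vi vj; have /eqP := x_inj x_mono ij; lra.
- move=> _ _ vX; exists (fun=> +oo%E); split=> //.
  apply: solution_infty => i j t [/vX vi|//] [/vX vj|//] ij t0.
  by rewrite /meet vi vj; have /eqP := x_inj x_mono ij; lra.
rewrite ltnS => hu o vX.
have o' := ordered_tail o; have ou := ordered_nil o'.
have yu j : j \in u -> x y < x j.
  by move=> ju; apply: (@ordered_ltr _ x X [:: y] u) => //; rewrite mem_head.
have Xy j : j \in X -> x j < x y.
  by move=> jX; apply: (ordered_ltl o) => //; rewrite mem_head.
have yNu : y \notin u by apply/negP => /yu; rewrite ltxx.
have [vy|vy|sy] := speedP v y.
- case: X o o' vX Xy => [|a X] o o' vX Xy.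
    have [T2 [s2 c1 c2]] := IH [::] u hu ou (fun _ => ltac:(by [])).
    exists (join_times (fun i => i == y) (fun=> +oo%E) T2); split.
    + apply: (solution_ext (W := fun i => i == y \/ (i \in [::] \/ i \in u))).
        by move=> i; decide_membership.
      apply: solution_glue => //.
      * by apply: solution_infty => i j t /eqP-> /eqP->; rewrite eqxx.
      * by move=> i /eqP-> []//; apply/negP.
      * move=> i j t /eqP-> []// ju t0; rewrite /meet vy => m _ _.
        by have := ge_left j t0; have := yu _ ju; lra.
    + by rewrite arr_left0.
    + rewrite arr_left0 // => l s r [<- _ _]; split=> //; first by rewrite join_times1.
      by move=> k; rewrite inE => /orP[/eqP->|/yu h1 h2]; [rewrite ltxx|exfalso; lra].
  have oX := ordered_pop o'.
  have [|T2 c] := IH X u hu oX.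
    by move=> b bX; apply: vX; rewrite inE bX orbT.
  have aX b : b \in X -> x b < x a.
    by move=> bX; move: o; rewrite -ordered_push => /ordered_ltl; apply; rewrite ?mem_head.
  have va : v a = 1 by apply: vX; rewrite mem_head.
  have ay : x a < x y by apply: Xy; rewrite mem_head.
  have aNy : a != y by apply: contraTneq ay => ->; rewrite ltxx.
  pose C i := (i == a) || (i == y); pose tau := (x y - x a) / 2.
  have vXb b : b \in X -> v b = 1 by move=> bX; apply: vX; rewrite inE bX orbT.
  exists (join_times C (fun=> tau%:E) T2).
  have CX i : C i -> ~ (i \in X \/ i \in u).
    move=> /orP[] /eqP-> [].
    + by move/aX; rewrite ltxx.
    + move=> h; have := yu _ h; lra.
    + by move=> h; have := Xy y; rewrite inE h orbT ltxx => /(_ isT).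
    + by rewrite (negbTE yNu).
  apply: (certified_step c); rewrite ?arr_left //.
  + apply: (solution_ext (W := fun i => C i \/ (i \in X \/ i \in u))).
      by move=> i; rewrite /C; decide_membership.
    apply: solution_glue => //; last 1 first.
    * move=> i j t /orP[] /eqP-> Wj t0 m; rewrite lee_fin /tau => tt _; move: m.
        rewrite /meet va; case: Wj => [jX|ju].
          by rewrite vXb //; have := aX _ jX; lra.
        by have := ge_left j t0; have := yu _ ju; lra.
      rewrite /meet vy; case: Wj => [jX|ju].
        by rewrite vXb //; have := aX _ jX; lra.
      by have := ge_left j t0; have := yu _ ju; lra.
    * apply: (@solution_cluster C (x a + tau)); first by rewrite /tau; lra.
        by move=> i /orP[] /eqP->; rewrite ?va ?vy /tau; lra.
      move=> i /orP[] /eqP->; [exists y|exists a]; rewrite /C eqxx ?orbT //.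
      by rewrite eq_sym.
    * by case: c.
  + by move=> k ku; rewrite join_times2 // => /CX; apply; right.
  + move=> k; rewrite inE => /orP[/eqP->|->//] _.
    by rewrite join_times1 // /C eqxx orbT.
- have [||T [s c1 c2]] := IH (y :: X) u hu.
  + by rewrite -ordered_push.
  + by move=> a; rewrite inE => /orP[/eqP->//|/vX].
  exists T; split.
  + by apply: solution_ext s => i; decide_membership.
  + rewrite arr_right // => /c1 h k; rewrite inE => /orP[/eqP->|/h//].
    by rewrite vy => ?; exfalso; lra.
  + move=> l t r; rewrite arr_right // => E; have [h1 h2 h3] := c2 _ _ _ E.
    split=> // k; rewrite inE => /orP[/eqP->|ku] kl; last exact: h3.
    (* If [y] survived along with [l], the two would have exchanged places by time [x l - x y]. *)
    move=> Ty; have lu : l \in u.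
      have [|w ->] := @arr_suffix _ x v (y :: X) u l t; first by rewrite E mem_head.
      by rewrite mem_cat mem_head orbT.
    have t0 : 0 <= x l - x y by lra.
    have Wy : y \in y :: X \/ y \in u by left; rewrite mem_head.
    have := solution_le s Wy (or_intror lu) kl t0.
    by rewrite Ty h2 leey vy h1 => /(_ isT isT); lra.
have vy : v y = 0 by case: (v_range y) sy => // e /andP[]; rewrite e eqxx.
have [|T' c'] := IH [::] u hu ou; first by [].
have [s' c1' c2'] := c'.
have sol' : solution x v (fun i => i \in u) T'.
  by apply: solution_ext s' => i; decide_membership.
have short s : (size s < size u)%N -> (size s <= n)%N.
  by move=> h; apply: leq_trans (ltnW h) hu.
have reach j t : j \in u -> 0 <= t -> (t%:E <= T' j)%E -> x j + v j * t <= x y ->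
    v j = -1 /\ T' j = +oo%E.
  by move=> ju t0; apply: (solution_reach sol').
have through l s r Y (C : int -> bool) : arr x v [::] u = (l, s) :: r ->
    ordered x Y (y :: u) -> (forall i, i \in Y -> v i = 1 /\ x i + (x l - x y) < x y) ->
    {subset [:: y; l] <= C} ->
    (forall i, C i -> [\/ i = y /\ v i = 0, i = l | v i = 1 /\ x i + (x l - x y) = x y]) ->
    exists T T2, certified Y s T2 /\
     [/\ solution x v (fun i => (C i || (i \in Y)) \/ i \in u) T,
      forall i, i \in u -> i \notin s -> T i <> +oo%E,
      T y <> +oo%E
    & forall i, i \in s -> T i = T2 i].
  move=> E oY hY Cyl hC; have [|u1 Eu] := @arr_suffix _ x v [::] u l s.
    by rewrite E mem_head.
  have [vl Tl Tu] := c2' _ _ _ E.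
  have oYs : ordered x Y s.
    by move/ordered_tail: oY; rewrite Eu -cat1s catA => /ordered_suffix.
  have [|T2 c2] := IH Y s (short _ (size_arr_suffix E)) oYs.
    by move=> i /hY[].
  have lu : l \in u by rewrite Eu mem_cat mem_head orbT.
  have yl := yu _ lu.
  have Cy : C y by apply: Cyl; rewrite mem_head.
  have Cl : C l by apply: Cyl; rewrite inE mem_head orbT.
  have [|||||||||T [h1 h2 h3]] := @solution_through y l u1 s Y T' T2 C.
  + by move: (ordered_nil oY); rewrite ordered_push -Eu.
  + by rewrite -Eu.
  + by [].
  + by [].
  + move=> k ku1; apply: Tu; first by rewrite Eu mem_cat ku1.
    by apply: (@ordered_ltr _ x [::] u1 (l :: s)); rewrite -?Eu ?mem_head.
  + exact: hC.
  + apply: (@solution_cluster C (x y)); first by lra.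
      by move=> i /hC[[-> ->]|->|[-> e]]; rewrite ?vl; lra.
    move=> i _; have [->|iy] := eqVneq i y; last by exists y; rewrite eq_sym.
    by exists l; split=> //; apply: contraTneq yl => ->; rewrite ltxx.
  + exact: hY.
  + by case: c2.
  exists T, T2; split=> //; split.
  + apply: solution_ext h1 => i; rewrite Eu.
    have : i == l -> C i by move/eqP->.
    by rewrite /=; case: (C i); decide_membership.
  + move=> i; rewrite Eu mem_cat inE => /or3P[iu|/eqP->|->//] _; apply: h2.
      by right.
    by left.
  + by apply: h2; left.
  + by [].
case: X o o' vX Xy => [|a X] o o' vX Xy.
  case E : (arr x v [::] u) => [|[l s] r].
    exists (join_times (fun i => i == y) (fun=> +oo%E) T'); split.
    + apply: (solution_ext (W := fun i => i == y \/ i \in u)).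
        by move=> i; decide_membership.
      apply: solution_glue => //.
      * by apply: solution_infty => i j t /eqP-> /eqP->; rewrite eqxx.
      * by move=> i /eqP->; apply/negP.
      * move=> i j t /eqP-> ju t0; rewrite /meet vy mul0r addr0 => m _ tj.
        have [|vj Tj] := reach j t ju t0 tj; first by rewrite -m.
        exact: (c1' E j).
    + move=> _ k; rewrite inE => /orP[/eqP->|ku vk]; first by rewrite vy => ?; exfalso; lra.
      rewrite join_times2; first exact: c1'.
      by move/eqP => e; rewrite -e ku in yNu.
    + by rewrite arr_still0 // E.
  have [||||T [T2 [c2 [h1 h2 h3 h4]]]] := through l s r [::] (fun i => (i == y) || (i == l)) E.
  + exact: o.
  + by [].
  + by move=> i; rewrite !inE => /orP[] /eqP->; rewrite /in_mem /= eqxx ?orbT.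
  + by move=> i /orP[/eqP->|/eqP->]; [constructor 1|constructor 2].
  exists T; apply: (certified_step c2).
  + apply: solution_ext h1 => i.
    have [|u1 Eu] := @arr_suffix _ x v [::] u l s; first by rewrite E mem_head.
    by rewrite Eu; decide_membership.
  + by rewrite arr_still0 // E /= (arr_behead E).
  + exact: h4.
  + by move=> k; rewrite inE => /orP[/eqP-> _|]; [|exact: h2].
have oX := ordered_pop o'.
have vXb b : b \in X -> v b = 1 by move=> bX; apply: vX; rewrite inE bX orbT.
have aX b : b \in X -> x b < x a.
  by move=> bX; move: o; rewrite -ordered_push => /ordered_ltl; apply; rewrite ?mem_head.
have va : v a = 1 by apply: vX; rewrite mem_head.
have ay : x a < x y by apply: Xy; rewrite mem_head.
have aNy : a != y by apply: contraTneq ay => ->; rewrite ltxx.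
have far : (forall j, j \in u -> v j = -1 -> T' j = +oo%E -> x y - x a < x j - x y) ->
    arr x v (a :: X) (y :: u) = arr x v X u -> exists T, certified (a :: X) (y :: u) T.
  move=> hfar hA; have [|T2 c] := IH X u hu oX; first by [].
  pose C i := (i == a) || (i == y); pose tau := x y - x a.
  exists (join_times C (fun=> tau%:E) T2).
  have CX i : C i -> ~ (i \in X \/ i \in u).
    move=> /orP[] /eqP-> [].
    + by move/aX; rewrite ltxx.
    + move=> h; have := yu _ h; lra.
    + by move=> h; have := Xy y; rewrite inE h orbT ltxx => /(_ isT).
    + by rewrite (negbTE yNu).
  have [s2 _ _] := c.
  apply: (certified_step c) => //.
  + apply: (solution_ext (W := fun i => C i \/ (i \in X \/ i \in u))).
      by move=> i; rewrite /C; decide_membership.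
    apply: solution_glue => //; last 1 first.
    * move=> i j t Ci Wj t0 m; rewrite lee_fin /tau => tt tj.
      have hp : x i + v i * t <= x y /\ x a <= x i + v i * t - t.
        by case/orP: Ci => /eqP->; rewrite ?va ?vy; lra.
      rewrite /meet in m; rewrite m in hp.
      case: Wj => [jX|ju]; first by move: hp; rewrite vXb //; have := aX _ jX; lra.
      (* The point reached at time [t] is at least [x a + t], so its light cone contains no starting
         point to the left of [a]. The stack [X] is invisible there, and the fate of [j] is the one
         it has in [u] alone. *)
      have tj' : (t%:E <= T' j)%E.
        apply: (@solution_cone_le _ x v x_mono v_bound _ _ T2 T' j t (X ++ u) s2 sol') => //.
          by right.
        move=> k /andP[hk1 hk2]; rewrite mem_cat; split; last by case=> ->; rewrite ?orbT.
        by split; [case=> // /aX; lra|right].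
      have [vj Tj] := reach j t ju t0 tj' hp.1.
      by have := hfar _ ju vj Tj; move: hp; rewrite vj; lra.
    * apply: (@solution_cluster C (x y)); first by rewrite /tau; lra.
        by move=> i /orP[] /eqP->; rewrite ?va ?vy /tau; lra.
      move=> i /orP[] /eqP->; [exists y|exists a]; rewrite /C eqxx ?orbT //.
      by rewrite eq_sym.
  + by move=> k ku; rewrite join_times2 // => /CX; apply; right.
  + move=> k; rewrite inE => /orP[/eqP->|->//] _.
    by rewrite join_times1 // /C eqxx orbT.
have A := arr_still x a X u sy.
rewrite /= in A; move: A.
case: clashP => [E|l s r E c|l s r E c|l s r E c] /= A.
- by apply: far => // j ju vj Tj; exfalso; apply: (c1' E j).
- apply: far => // j ju vj Tj; have [_ _ h] := c2' _ _ _ E.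
  suff : x l <= x j by lra.
  by rewrite leNgt; apply/negP => /(h _ ju).
- have [||||T [T2 [c2 [h1 h2 h3 h4]]]] :=
    through l s r X (fun i => [|| i == a, i == y | i == l]) E.
  + exact: ordered_pop o.
  + by move=> i iX; split; [exact: vXb|have := aX _ iX; lra].
  + by move=> i; rewrite !inE => /orP[] /eqP->; rewrite /in_mem /= eqxx ?orbT.
  + by move=> i /or3P[/eqP->|/eqP->|/eqP->]; [constructor 3; lra|constructor 1|constructor 2].
  exists T; apply: (certified_step c2) => //.
  + apply: solution_ext h1 => i.
    have [|u1 Eu] := @arr_suffix _ x v [::] u l s; first by rewrite E mem_head.
    by rewrite Eu; decide_membership.
  + by move=> k; rewrite inE => /orP[/eqP-> _|]; [|exact: h2].
- have [||||T [T2 [c2 [h1 h2 h3 h4]]]] :=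
    through l s r (a :: X) (fun i => (i == y) || (i == l)) E.
  + exact: o.
  + move=> i; rewrite inE => /orP[/eqP->|iX]; first by split=> //; lra.
    by split; [exact: vXb|have := aX _ iX; lra].
  + by move=> i; rewrite !inE => /orP[] /eqP->; rewrite /in_mem /= eqxx ?orbT.
  + by move=> i /orP[/eqP->|/eqP->]; [constructor 1|constructor 2].
  exists T; apply: (certified_step c2) => //.
  + apply: solution_ext h1 => i.
    have [|u1 Eu] := @arr_suffix _ x v [::] u l s; first by rewrite E mem_head.
    by rewrite Eu; decide_membership.
  + by move=> k; rewrite inE => /orP[/eqP-> _|]; [|exact: h2].
Qed.

End finite_solutions.

(** * Exploration of the particles to the right of the origin *)

Definition seg n m : seq int := [seq Posz i | i <- iota n m].

Lemma segS n m : seg n m.+1 = Posz n :: seg n.+1 m. Proof. by []. Qed.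

Lemma seg_cat n m k : seg n (m + k) = seg n m ++ seg (n + m) k.
Proof. by rewrite /seg iotaD map_cat. Qed.

Lemma mem_seg n m k : (k \in seg n m) = (n%:Z <= k < (n + m)%:Z).
Proof.
apply/mapP/idP => [[i]|]; first by rewrite mem_iota => /andP[? ?] ->; lia.
case: k => k h; last by lia.
by exists k => //; rewrite mem_iota; lia.
Qed.

Section link.
Context {R : realType}.
Variables (x v : int -> R).
Hypothesis x_mono : forall i j, i < j -> x i < x j.
Hypothesis v_range : forall i, [\/ v i = -1, v i = 0 | v i = 1].

Let v_bound i : -1 <= v i <= 1.
Proof. by case: (v_range i) => ->; apply/andP; split; lra. Qed.

Lemma ordered_seg n m : ordered x [::] (seg n m).
Proof.
rewrite /ordered /=; elim: m n => //= m IH n; rewrite IH andbT.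
by apply/allP => k; rewrite mem_seg => h; apply: x_mono; lia.
Qed.

(** Without an arrival, [l] would die when the word [1..n] is run alone. This cannot happen at [t]
    or later, since [l] is then at or beyond the origin, out of reach of the word. If it happened
    before [t], it would also happen in the full system: up to [t] particle 0 is alive and shields
    what lies between it and the path of [l]. *)
Lemma hit_from_right T t l : annihilation_times x v T -> v 0 = 0 -> 0 < l ->
  T 0 = t%:E -> T l = t%:E -> meet x v 0 l t ->
  exists n, [/\ l = Posz n, v l = -1 & arr x v [::] (seg 1 n) <> [::]].
Proof.
move=> /solution_setT sT v0 l0 T0 Tl m.
have x0l := x_mono l0.
have t0 : 0 <= t by have := sT.1 0 Logic.I; rewrite T0 lee_fin.
have vl : v l = -1.
  by move: m; rewrite /meet v0; case: (v_range l) => // ->; lra.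
have tE : t = x l - x 0 by move: m; rewrite /meet v0 vl; lra.
have [n ln] : exists n, l = Posz n by case: l {Tl m x0l vl tE} l0 => // n _; exists n.
exists n; split=> // A0.
have lseg : l \in seg 1 n by rewrite mem_seg ln; move: l0; rewrite ln; clear; lia.
have [|T2 [s2 c1 _]] := certified_exists x_mono v_range (ordered_seg 1 n); first by [].
have sol2 : solution x v (fun i => i \in seg 1 n) T2.
  by apply: solution_ext s2 => i; split=> [[]|] //; right.
have := c1 A0 _ lseg vl; have := sol2.1 _ lseg.
case E : (T2 l) => [s| |] //; rewrite lee_fin => s0 _.
have [ts|st] := leP t s.
  have [_ [j [js jl mj _]]] := solution_partner sol2 lseg E.
  have x0j : x 0 < x j by apply: x_mono; move: js; rewrite mem_seg; clear; lia.
  move: mj; rewrite /meet vl; case: (v_range j) => ->; try lra.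
  by move=> h; move: (x_inj x_mono jl) => /eqP; apply; lra.
suff : T l = s%:E by rewrite Tl => -[e]; move: st; rewrite e ltxx.
pose Q k (s : R) := [/\ k \in seg 1 n, 0 <= s, s < t & x k + v k * s <= x l - s].
apply/(@solution_agree _ x v x_mono setT (fun i => i \in seg 1 n) T T2 Q (seg 1 n)) => //.
- by move=> k r [].
- move=> k r r' [ks r0 rt h] /andP[r'0 r'r]; split=> //; first by lra.
  by have /andP[? ?] := v_bound k; nra.
- move=> k j r [ks r0 rt h] _ _ jk mk rk rj.
  have x0k : x 0 < x k by apply: x_mono; move: ks; rewrite mem_seg; clear; lia.
  have r0' : (r%:E < T 0%R)%E by rewrite T0 lte_fin.
  have hk : x 0 < x k + v k * r.
    by have := @solution_lt _ x v setT T (Posz 0) k r sT Logic.I Logic.I x0k r0 (ltW r0') rk (or_introl r0');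
       rewrite v0; lra.
  suff js : j \in seg 1 n by split=> //; rewrite -mk.
  rewrite mem_seg; apply/andP; split.
    rewrite leNgt; apply/negP => j1.
    have [j0|j0] : j = 0 \/ j < 0 by move: j1; clear; lia.
      by move: mk; rewrite j0 /meet v0; lra.
    have := @solution_lt _ x v setT T j (Posz 0) r sT Logic.I Logic.I (x_mono j0) r0 rj (ltW r0') (or_intror r0').
    by move: mk; rewrite /meet v0; lra.
  rewrite ltNge; apply/negP => jn.
  have xlj : x l < x j by apply: x_mono; rewrite ln; move: jn; clear; lia.
  by have := ge_left x v_range j r0; move: mk; rewrite /meet; lra.
- by move=> k j r [ks r0 rt h] js _ _ mk _ _; split=> //; rewrite -mk.
- by split=> //; rewrite vl; lra.
Qed.

Lemma arr_still_prefix w u : (forall i, i \in w -> still v i) ->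
  size (arr x v [::] (w ++ u)) = (size (arr x v [::] u) - size w)%N.
Proof.
elim: w => [|i w IH] h /=; first by rewrite subn0.
rewrite arr_still0; last by apply: h; rewrite mem_head.
rewrite size_behead IH => [|j jw]; first by rewrite subnS.
by apply: h; rewrite inE jw orbT.
Qed.

(* A state [(c, m, q)] records the number [c] of arrivals still needed, the block
   [q] being read, and a mode [m]: 0 between blocks, 1 after a right-mover, 2 after
   right-static with gap [>= 1], 3 inside any other block.  In mode 2 the block has
   annihilated itself but is kept open for one more particle. *)
Definition settle c q : nat * nat * seq int :=
  if (bal x v [::] q == Some 0) && (arr x v [::] q == [::]) then (c, 0%N, [::])
  else (c, 3%N, q).

(** In mode 2 the first gap is at least 1, so a left-mover with gap at most 1 reaches the static
    particle no later than the right-mover. If strictly earlier, the right-mover is left over and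
    reopens the block; in a tie all three vanish. With a larger gap the left-mover is booked as
    coming after a closed block, which is a valid bound in whichever order the collisions occur. A
    right-mover in mode 2 opens a block in mode 3, for which no gain is claimed. *)
Definition step (st : nat * nat * seq int) (k : int) : nat * nat * seq int :=
  let: (c, m, q) := st in
  if c == 0%N then st else
  match m with
  | 0 => if v k == -1 then (c.-1, 0%N, [::])
         else if v k == 1 then (c, 1%N, [:: k]) else (c.+1, 0%N, [::])
  | 1 => if still v k && (1 <= x k - x (k - 1)) then (c, 2%N, rcons q k)
         else settle c (rcons q k)
  | 2 => if v k == -1 then
           if x k - x (k - 1) <= 1 then
             if q is [:: r; s] then
               if x k - x s < x s - x r then (c, 3%N, [:: r]) else (c, 0%N, [::])
             else (c, 0%N, [::])
           else (c.-1, 0%N, [::])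
         else if v k == 1 then (c, 3%N, [:: k]) else (c.+1, 0%N, [::])
  | _ => settle c (rcons q k)
  end.

Definition explore c n m := foldl step (c, 0%N, [::]) (seg n m).

Let good w := bal x v [::] w = Some 0 /\ arr x v [::] w = [::].

(** The condition on prefixes in mode 3 is the one that, by [arr_prefix_balanced], keeps an
    unfinished block from emitting left-movers. *)
Definition step_inv n (st : nat * nat * seq int) : Prop :=
  let: (c, m, q) := st in
  (forall j, ordered x [::] (q ++ seg n j)) /\
  match m with
  | 0 => q = [::]
  | 1 => q = [:: n%:Z - 1] /\ v (n%:Z - 1) = 1
  | 2 => [/\ q = [:: n%:Z - 2; n%:Z - 1], v (n%:Z - 2) = 1, still v (n%:Z - 1)
           & 1 <= x (n%:Z - 1) - x (n%:Z - 2)]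
  | _ => [/\ v (head 0 q) = 1, q != [::]
           & forall w t, q = w ++ t -> w != [::] -> ~ good w]
  end.

Let good1 r : v r = 1 -> ~ good [:: r].
Proof. by move=> vr [+ _]; rewrite bal_right. Qed.

Lemma explore_absorbed st u : st.1.1 = 0%N -> (foldl step st u).1.1 = 0%N.
Proof. by elim: u st => //= k u IH [[c m] q] /= c0; apply: IH; rewrite c0. Qed.

Lemma step_inv_arr n c m q : step_inv n (c, m, q) -> arr x v [::] q = [::].
Proof.
move=> [ho]; case: m => [->|[[-> vr]|[[-> vr ss _]|m [vr q0 h]]]] //.
- by rewrite arr_right.
- by rewrite arr_right // arr_still.
case: q vr q0 h ho => // r q /= vr _ h ho; rewrite arr_right //; apply/eqP.
apply/negPn/negP => A0.
have oq : ordered x [:: r] q.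
  by have := ho 0%N; rewrite cats0 ordered_push.
have [w [t [Eq w0 b0 a0]]] := arr_prefix_balanced oq isT A0.
by apply: (h (r :: w) t); rewrite ?Eq // /good bal_right // arr_right.
Qed.

Lemma settle_inv n m c q : (0 < c)%N ->
  (forall j, ordered x [::] (q ++ seg n j)) -> q != [::] -> v (head 0 q) = 1 ->
  (forall w t, q = w ++ t -> t != [::] -> w != [::] -> ~ good w) ->
  (c <= size (arr x v [::] (q ++ seg n m)))%N ->
  step_inv n (settle c q) /\
  ((settle c q).1.1 <= size (arr x v [::] ((settle c q).2 ++ seg n m)))%N.
Proof.
move=> c0 o q0 vq h hc; rewrite /settle; case: ifP => [/andP[/eqP b0 /eqP a0]|/negP ng] /=.
  split; first by split=> // j; exact: ordered_seg.
  by have := size_arr_cat (o m) b0; rewrite a0 /=; lia.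
split=> //; split=> //; split=> // w t Eq w0 gw.
have [t0|t0] := eqVneq t [::]; last by apply: (h w t).
by apply: ng; move: gw; rewrite /good Eq t0 cats0 => -[-> ->].
Qed.

Let leq_pred_lt c k : (0 < c)%N -> (c <= k.-1)%N -> (c < k)%N.
Proof. by case: k => //; case: c. Qed.

Lemma step_invP n m st : (0 < st.1.1)%N -> step_inv n st ->
  (st.1.1 <= size (arr x v [::] (st.2 ++ seg n m.+1)))%N ->
  step_inv n.+1 (step st n) /\
  ((step st n).1.1 <= size (arr x v [::] ((step st n).2 ++ seg n.+1 m)))%N.
Proof.
case: st => [[c md] q] /= c0 [ho]; have o := ho; rewrite (gtn_eqF c0).
have fresh j : (forall i, ordered x [::] ([::] ++ seg j i)) /\ [::] = [::] :> seq int.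
  by split=> // i; exact: ordered_seg.
have nE : n.+1%:Z - 1 = n%:Z by lia.
have one q' : (forall j, ordered x [::] (q' ++ seg n j)) ->
    forall j, ordered x [::] (rcons q' n%:Z ++ seg n.+1 j).
  by move=> h j; rewrite cat_rcons -segS.
case: md => [q0|[[Eq vr]|[[Eq vr ss gap]|md [vr q0 h]]]].
- rewrite q0 /=; case: (speedP v n) => vn.
  + rewrite vn eqxx arr_left0 //= => h; split; first exact: (fresh n.+1).
    by rewrite -ltnS prednK.
  + have e : v n == -1 = false by rewrite vn; apply/eqP; lra.
    rewrite e vn eqxx /= => h; split=> //; rewrite nE; split=> //.
    by move=> j; exact: (@ordered_seg n j.+1).
  + case/andP: (vn) => /negbTE-> /negbTE->; rewrite arr_still0 // size_behead => h.
    split; first exact: (fresh n.+1).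
    exact: leq_pred_lt.
- rewrite Eq /=; set r := n%:Z - 1 in Eq vr *.
  have oq j : ordered x [::] ([:: r; n%:Z] ++ seg n.+1 j).
    by have := one q o j; rewrite Eq.
  move=> hc; case: ifP => [/andP[sn gap]|_].
    rewrite /= nE; split; last exact: hc.
    split; first exact: oq.
    have e2 : n.+1%:Z - 2 = r by rewrite /r; lia.
    by rewrite e2.
  apply: settle_inv => // w t; case: w => // a w [<-].
  case: w => [|b w]; first by move=> _ _ _; apply: good1.
  by case: w => [|d w] //= [_ <-].
- have oq j : ordered x [::] ([:: n%:Z - 2; n%:Z - 1; n%:Z] ++ seg n.+1 j).
    by have := one q o j; rewrite Eq.
  have os : ordered x [::] ([:: n%:Z - 2; n%:Z - 1] ++ seg n m.+1).
    by have := o m.+1; rewrite Eq.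
  rewrite Eq /= => hc.
  (* The pair right-static is balanced already, so superadditivity allows dropping it. This serves
     every case except a left-mover with gap at most 1. *)
  have hc' : (c <= size (arr x v [::] (n%:Z :: seg n.+1 m)))%N.
    have b0 : bal x v [::] [:: n%:Z - 2; n%:Z - 1] = Some 0.
      by rewrite bal_right // bal_still.
    have a0 : size (arr x v [::] [:: n%:Z - 2; n%:Z - 1]) = 0%N.
      by rewrite arr_right // arr_still.
    have key (a b z : nat) : z = 0%N -> (a%:Z <= z%:Z) \/ (a%:Z <= b%:Z - 0) ->
        (c <= a)%N -> (c <= b)%N by clear -c0; lia.
    exact: (key _ _ _ a0 (size_arr_cat os b0) hc).
  case: (speedP v n) => vn.
  + rewrite vn eqxx; have [g1|_] := leP (x n - x (n%:Z - 1)) 1; last first.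
      rewrite /=; split; first exact: (fresh n.+1).
      by rewrite -ltnS prednK //; move: hc'; rewrite arr_left0.
    move: hc; rewrite arr_right // arr_still // arr_left0 //=.
    rewrite ltNge (le_trans g1 gap) /=.
    have [close|close] := ltP (x n - x (n%:Z - 1)) (x (n%:Z - 1) - x (n%:Z - 2)).
      rewrite lt_eqF //= => hc; split; last by rewrite arr_right.
      split=> [j|].
        have := oq j; rewrite /ordered /=; case/and3P => /andP[_ /andP[_ ->]] _.
        by case/andP.
      split=> // w t; case: w => // a w [<-]; case: w => // _ _.
      exact: good1.
    have -> : x n - x (n%:Z - 1) = x (n%:Z - 1) - x (n%:Z - 2).
      by apply/eqP; rewrite eq_le close (le_trans g1 gap).
    by rewrite eqxx /= => hc; split; first exact: (fresh n.+1).
  + have e : v n == -1 = false by rewrite vn; apply/eqP; lra.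
    rewrite e vn eqxx /=; split=> //; split.
      by move=> j; exact: (@ordered_seg n j.+1).
    split=> // w t; case: w => // a w [<-]; case: w => // _ _.
    exact: good1.
  + case/andP: (vn) => /negbTE-> /negbTE->; rewrite /=; split; first exact: (fresh n.+1).
    by apply: leq_pred_lt => //; move: hc'; rewrite arr_still0 // size_behead.
- move=> hc; apply: settle_inv => //.
  + exact: one.
  + by case: q {o ho vr q0 h hc}.
  + by case: q vr q0 {o ho h hc}.
  + move=> w t; case/lastP: t => // t z; rewrite -rcons_cat => /rcons_inj[Eq _] _ w0.
    exact: (h w t).
  + by rewrite cat_rcons.
Qed.

(** At the end of the word the pending block sends nothing to the left, and a level bounded by its
    number of arrivals must be 0. *)
Lemma foldl_step_hits n m st : step_inv n st ->
  (st.1.1 <= size (arr x v [::] (st.2 ++ seg n m)))%N ->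
  (foldl step st (seg n m)).1.1 = 0%N.
Proof.
elim: m n st => [|m IH] n st i h.
  move: st i h => [[c md] q] i; rewrite cats0 /= (step_inv_arr i) /=; lia.
have [c0|c0] := posnP st.1.1; first exact: explore_absorbed.
by have [i' h'] := step_invP c0 i h; apply: IH.
Qed.

(** The static particles [1..c] absorb [c] arrivals, so a hit on 0 needs at least [c + 1] from
    beyond them, which covers the level [c] from which the exploration counts down. *)
Lemma explore_hits T t l c : annihilation_times x v T ->
  (forall i : nat, (i <= c)%N -> v i = 0) -> 0 < l ->
  T 0 = t%:E -> T l = t%:E -> meet x v 0 l t ->
  exists m, (explore c c.+1 m).1.1 = 0%N.
Proof.
move=> sT v0 l0 T0 Tl m.
have [n [ln vl A0]] := hit_from_right sT (v0 0%N isT) l0 T0 Tl m.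
have cn : (c < n)%N.
  rewrite ltnNge; apply/negP => nc; move: vl; rewrite ln v0 //; lra.
(* The word read is [c+1..n], ending at the particle that hits 0. *)
exists (n - c)%N; apply: foldl_step_hits => /=; first by split=> // j; exact: ordered_seg.
move: A0; rewrite -{1}(subnKC (ltnW cn)) seg_cat => A0.
have : (0 < size (arr x v [::] (seg 1 c ++ seg (1 + c) (n - c))))%N.
  by case: (arr _ _ _ _) A0.
rewrite arr_still_prefix; first by rewrite /seg !size_map size_iota add1n; lia.
move=> i; rewrite mem_seg => /andP[h1 h2].
case: i h1 h2 => // i h1 h2; rewrite /still v0; last by lia.
by apply/andP; split; apply/eqP; lra.
Qed.

End link.

(** * Construction of the infinite dynamics from finite-depth collision tests *)

Section infinite_system.
Context {R : realType}.
Variables (x v : int -> R).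

Notation tau := (meet_time x v).

(* [collide n i j] decides with recursion depth [n] whether [i] and [j] meet before
   either of them has collided.  Only finitely many meetings matter, so the answer
   is eventually constant in [n]; this exhibits survival as a measurable event. *)
Fixpoint collide n (i j : int) : Prop :=
  if n is n'.+1 then
    0 < tau i j /\ forall k, (collide n' i k -> tau i j <= tau i k) /\
                             (collide n' j k -> tau i j <= tau j k)
  else False.

Definition collides i j := exists n0, forall n, (n0 <= n)%N -> collide n i j.

Lemma meet_timeC i j : tau i j = tau j i.
Proof. by rewrite /meet_time -opprB -(opprB (v j)) invrN mulrNN. Qed.

Lemma collide_pos n i j : collide n i j -> 0 < tau i j.
Proof. by case: n => //= n []. Qed.

Lemma collides_pos i j : collides i j -> 0 < tau i j.
Proof. by move=> [n /(_ n (leqnn n))/collide_pos]. Qed.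

Lemma collideC n i j : collide n i j -> collide n j i.
Proof.
case: n => //= n [t0 h]; rewrite meet_timeC; split=> // k.
by have [] := h k.
Qed.

Lemma collidesC i j : collides i j -> collides j i.
Proof. by move=> [n h]; exists n => m /h/collideC. Qed.

Hypothesis x_mono : forall i j, i < j -> x i < x j.
Hypothesis v_bound : forall i, -1 <= v i <= 1.
Hypothesis locally_finite :
  forall b : R, exists A : seq int, forall k, - b <= x k <= b -> k \in A.

Lemma meet_meet_time i j : 0 < tau i j -> meet x v i j (tau i j).
Proof.
move=> t0; have d : v i - v j != 0.
  by apply: contraTneq t0; rewrite /meet_time => ->; rewrite invr0 mulr0 ltxx.
have : tau i j * (v i - v j) = x j - x i by rewrite divfK.
by rewrite /meet mulrBr (mulrC _ (v i)) (mulrC _ (v j)); lra.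
Qed.

Lemma meet_time_neq i j : 0 < tau i j -> i != j.
Proof. by apply: contraTneq => ->; rewrite /meet_time subrr mul0r ltxx. Qed.

Section cone.
Variables (A : seq int) (y0 s0 : R).
Hypothesis coneA : forall k, - s0 <= x k - y0 <= s0 -> k \in A.

Let in_cone i s := 0 <= s /\ - (s0 - s) <= x i + v i * s - y0 <= s0 - s.

Let in_coneA i s : in_cone i s -> i \in A.
Proof.
move=> [t0 /andP[h1 h2]]; apply: coneA; have /andP[? ?] := v_bound_mul v_bound i t0.
by apply/andP; split; lra.
Qed.

Let in_cone_le i s s' : in_cone i s -> 0 <= s' <= s -> in_cone i s'.
Proof.
move=> [t0 /andP[h1 h2]] /andP[h3 h4]; split=> //.
have d : 0 <= s - s' by lra.
by have /andP[] := v_bound_mul v_bound i d; rewrite mulrBr => ? ?; apply/andP; split; lra.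
Qed.

Let in_cone_meet i j s : in_cone i s -> meet x v i j s -> in_cone j s.
Proof. by move=> [? h] m; split=> //; rewrite -m. Qed.

Let rank := meet_rank x v A.

(** Only strictly earlier meetings inside the cone can overturn the answer, and each unfolding
    lowers their number; a depth beyond that number adds nothing. *)
Lemma collide_stable n m i j : in_cone i (tau i j) -> 0 < tau i j ->
  (rank (tau i j) < n)%N -> (n <= m)%N -> collide n i j <-> collide m i j.
Proof.
elim: n m i j => // n IH [|m] i j // ci t0 rn nm.
have cj : in_cone j (tau i j) by apply: in_cone_meet ci (meet_meet_time t0).
have stable l k : in_cone l (tau i j) ->
    (collide n l k -> tau i j <= tau l k) <-> (collide m l k -> tau i j <= tau l k).
  move=> cl; have [le|lt] := leP (tau i j) (tau l k); first by split.
  have [lk0|lk0] := ltP 0 (tau l k); last first.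
    by split=> _ /collide_pos; rewrite ltNge lk0.
  have clk : in_cone l (tau l k) by apply: in_cone_le cl _; rewrite !ltW.
  have ck := in_cone_meet clk (meet_meet_time lk0).
  have r : (rank (tau l k) < n)%N.
    apply: leq_trans (ltnSE rn); apply: (@meet_rank_lt _ x v x_mono A l k) lt => //.
    - exact: in_coneA clk.
    - exact: in_coneA ck.
    - exact: meet_time_neq.
    - exact: meet_meet_time.
  by have e := IH m l k clk lk0 r nm; split=> h /e.
split=> /= -[_ h]; split=> // k; have [h1 h2] := h k; split; apply/stable => //.
Qed.

End cone.

Lemma collide_limit i j : 0 < tau i j -> exists n0, forall n, (n0 <= n)%N ->
  (collide n i j <-> collides i j) /\
  forall k, tau i k < tau i j -> (collide n i k <-> collides i k).
Proof.
move=> t0; pose s := tau i j; pose y0 := x i + v i * s.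
have [A hA] := locally_finite (`|y0| + s).
have cone k : - s <= x k - y0 <= s -> k \in A.
  move=> /andP[h1 h2]; apply: hA; apply/andP.
  by have := ler_norm y0; have := ler_norm (- y0); rewrite normrN; split; lra.
exists (meet_rank x v A s).+1 => n hn.
have limit k : tau i k <= s -> collide n i k <-> collides i k.
  move=> ks; have [k0|k0] := ltP 0 (tau i k); last first.
    by split=> [/collide_pos|/collides_pos]; rewrite ltNge k0.
  have r : (meet_rank x v A (tau i k) < n)%N.
    apply: leq_trans hn; rewrite ltnS; apply: sub_count => p /= h.
    exact: lt_le_trans h ks.
  have c : 0 <= tau i k /\
      - (s - tau i k) <= x i + v i * tau i k - y0 <= s - tau i k.
    split; first exact: ltW.
    have d : 0 <= s - tau i k by lra.
    by have /andP[] := v_bound_mul v_bound i d; rewrite /y0 mulrBr => ? ?; apply/andP; split; lra.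
  split=> [h|[n1 h]].
    by exists n => m nm; apply/(collide_stable cone c k0 r nm).
  apply/(collide_stable cone c k0 r (leq_maxl n n1)).
  by apply: h; rewrite leq_maxr.
by split=> [|k /ltW]; apply: limit.
Qed.

(** The fixed-point equation that [collide] approximates. One depth serves all [k] because
    [collide_limit] is uniform over the meetings before [tau i j]. *)
Lemma collidesE i j : collides i j <-> 0 < tau i j /\
  forall k, (collides i k -> tau i j <= tau i k) /\
            (collides j k -> tau i j <= tau j k).
Proof.
have common : 0 < tau i j -> exists n, (collide n.+1 i j <-> collides i j) /\
    forall k, (tau i k < tau i j -> (collide n i k <-> collides i k)) /\
              (tau j k < tau i j -> (collide n j k <-> collides j k)).
  move=> t0; have [n1 h1] := collide_limit t0.
  have [|n2 h2] := @collide_limit j i; first by rewrite meet_timeC.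
  exists (maxn n1 n2); split.
    by apply: (h1 _ _).1; rewrite leqW ?leq_maxl.
  move=> k; split; first exact: (h1 _ (leq_maxl _ _)).2.
  by rewrite (meet_timeC i); exact: (h2 _ (leq_maxr _ _)).2.
split=> [h|[t0 h]].
  have t0 := collides_pos h; have [n [e1 e2]] := common t0.
  split=> // k; have [_ /(_ k)[g1 g2]] := e1.2 h; have [e3 e4] := e2 k.
  by split=> c; rewrite leNgt; apply/negP => lt; move: (lt);
    [move/e3|move/e4] => e; [have := g1 (e.2 c)|have := g2 (e.2 c)]; rewrite leNgt lt.
have [n [e1 e2]] := common t0; apply/e1; split=> // k.
have [e3 e4] := e2 k; have [g1 g2] := h k.
by split=> c; rewrite leNgt; apply/negP => lt; move: (lt);
  [move/e3|move/e4] => e; [have := g1 (e.1 c)|have := g2 (e.1 c)]; rewrite leNgt lt.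
Qed.

(** By [collidesE] all partners with which [i] collides give the same time, so the choice does not
    matter. *)
Definition first_time i : \bar R :=
  if pselect (exists j, collides i j) is left e then (tau i (sval (cid e)))%:E
  else +oo%E.

Lemma first_timeE i j : collides i j -> first_time i = (tau i j)%:E.
Proof.
move=> c; rewrite /first_time; case: pselect => [e|[]]; last by exists j.
case: (cid e) => k /= ck; congr EFin; apply/eqP; rewrite eq_le.
have [_ /(_ j)[h1 _]] := (collidesE i k).1 ck.
by have [_ /(_ k)[h2 _]] := (collidesE i j).1 c; rewrite h1 // h2.
Qed.

Lemma first_time_lt i : first_time i <> +oo%E -> exists j, collides i j.
Proof. by rewrite /first_time; case: pselect. Qed.

Lemma annihilation_first_time : annihilation_times x v first_time.
Proof.
split=> [i|i t].
  rewrite /first_time; case: pselect => // e; case: (cid e) => j /=.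
  by move=> /collides_pos/ltW; rewrite lee_fin.
split=> [Ti|[t0 ti [j [ji m tj]]]].
  have [|j c] := @first_time_lt i; first by rewrite Ti.
  have tE : t = tau i j by apply: EFin_inj; rewrite -Ti (first_timeE c).
  have c0 := collides_pos c; rewrite tE; split; [exact: ltW|by rewrite -tE Ti|].
  exists j; split.
  - by rewrite eq_sym; exact: meet_time_neq.
  - exact: meet_meet_time.
  - by rewrite (first_timeE (collidesC c)) meet_timeC.
rewrite eq_sym in ji; have tE := meet_timeE x_mono ji m.
have t1 : 0 < tau i j.
  rewrite -tE lt_neqAle t0 andbT; apply: contraNneq (x_inj x_mono ji) => e.
  by move: m; rewrite /meet -e !mulr0 !addr0 => ->.
suff c : collides i j by rewrite (first_timeE c) tE.
apply/collidesE; split=> // k; rewrite -tE; split=> c.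
  by move: ti; rewrite (first_timeE c) lee_fin.
by move: tj; rewrite (first_timeE c) lee_fin.
Qed.

(** Light cones force any annihilation times to agree with [first_time] at a collision, so the
    existential in [survives] leaves no freedom. *)
Lemma survivesE i : survives x v i <-> forall j, ~ collides i j.
Proof.
split=> [[T [/solution_setT sT Ti]] j c|h].
  have s1 := (solution_setT x v first_time).2 annihilation_first_time.
  pose s := tau i j; pose y0 := x i + v i * s.
  have [A hA] := locally_finite (`|y0| + s).
  suff : T i = s%:E by rewrite Ti.
  apply/(@solution_cone _ x v x_mono v_bound setT setT T first_time i s A) => //.
  - exact/ltW/(collides_pos c).
  - move=> k /andP[h1 h2]; split=> // _; apply: hA; apply/andP.
    by have := ler_norm y0; have := ler_norm (- y0); rewrite normrN /y0 in h1 h2 *; split; lra.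
  - exact: first_timeE.
exists first_time; split; first exact: annihilation_first_time.
by rewrite /first_time; case: pselect => // e; exfalso; case: e => j /h.
Qed.

End infinite_system.

(** * Measurability of the event of survival *)

Section measurable_collisions.
Context {R : realType} {d : measure_display} {Omega : measurableType d}.

Lemma measurable_set_lt (f g : Omega -> R) : measurable_fun setT f ->
  measurable_fun setT g -> measurable [set w | f w < g w].
Proof.
move=> mf mg.
by have := measurable_fun_ltr mf mg measurableT (Logic.I : measurable [set true]); rewrite setTI.
Qed.

Lemma measurable_set_le (f g : Omega -> R) : measurable_fun setT f ->
  measurable_fun setT g -> measurable [set w | f w <= g w].
Proof.
move=> mf mg.
by have := measurable_fun_ler mf mg measurableT (Logic.I : measurable [set true]); rewrite setTI.
Qed.

Lemma measurable_set_eq (f g : Omega -> R) : measurable_fun setT f ->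
  measurable_fun setT g -> measurable [set w | f w == g w].
Proof.
move=> mf mg.
by have := measurable_fun_eqr mf mg measurableT (Logic.I : measurable [set true]); rewrite setTI.
Qed.

Lemma measurable_forall (U : countType) (F : U -> set Omega) :
  (forall u, measurable (F u)) -> measurable [set w | forall u, F u w].
Proof.
move=> mF; rewrite (_ : [set w | _] = ~` \bigcup_(u in setT) ~` F u).
  apply: measurableC; apply: countable_bigcupT_measurable; first exact: countableP.
  by move=> u; apply: measurableC.
by apply/seteqP; split=> w /=; [move=> h [u _ []]|move=> h u; apply: contrapT => n; apply: h; exists u].
Qed.

Lemma measurable_exists (U : countType) (F : U -> set Omega) :
  (forall u, measurable (F u)) -> measurable [set w | exists u, F u w].
Proof.
move=> mF; rewrite (_ : [set w | _] = \bigcup_(u in setT) F u).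
  by apply: countable_bigcupT_measurable; first exact: countableP.
by apply/seteqP; split=> w /= [u]; [exists u|exists u].
Qed.

Lemma measurable_imply (A B : set Omega) : measurable A -> measurable B ->
  measurable [set w | A w -> B w].
Proof.
move=> mA mB; rewrite (_ : [set w | _] = ~` A `|` B).
  by apply: measurableU => //; exact: measurableC.
apply/seteqP; split=> w /= h; last by case: h.
by case: (pselect (A w)) => Aw; [right; apply: h|left].
Qed.

Lemma measurable_invr : measurable_fun setT (@GRing.inv R).
Proof.
have -> : [set: R] = [set 0] `|` ~` [set 0] by rewrite setUCr.
apply/measurable_funU => //; first exact: measurableC.
split; first exact: measurable_fun_set1.
apply: open_continuous_measurable_fun.
  by apply: closed_openC; exact: closed_eq.
by move=> y; rewrite inE /= => /eqP; exact: inv_continuous.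
Qed.

Variables (x v : int -> Omega -> R).
Hypotheses (mx : forall i, measurable_fun setT (x i))
           (mv : forall i, measurable_fun setT (v i)).

Lemma measurable_meet_time i j :
  measurable_fun setT (fun w => meet_time (x ^~ w) (v ^~ w) i j).
Proof.
apply: measurable_funM; first exact: measurable_funB.
by apply: (measurableT_comp measurable_invr); exact: measurable_funB.
Qed.

Lemma measurable_collide n i j :
  measurable [set w | collide (x ^~ w) (v ^~ w) n i j].
Proof.
elim: n i j => [|n IH] i j /=; first exact: measurable0.
have mt := measurable_meet_time.
apply: measurableI; first by apply: measurable_set_lt.
apply: measurable_forall => k; apply: measurableI.
  exact: measurable_imply (IH i k) (measurable_set_le (mt i j) (mt i k)).
exact: measurable_imply (IH j k) (measurable_set_le (mt i j) (mt j k)).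
Qed.

Lemma measurable_uncollided i :
  measurable [set w | forall j, ~ collides (x ^~ w) (v ^~ w) i j].
Proof.
apply: measurable_forall => j; apply: measurableC.
apply: measurable_exists => n0; apply: measurable_forall => n.
case: (leqP n0 n) => h.
  rewrite (_ : (fun _ => _) = [set w | collide (x ^~ w) (v ^~ w) n i j]).
    exact: measurable_collide.
  by apply/seteqP; split=> w /=; auto.
rewrite (_ : (fun _ => _) = setT); first exact: measurableT.
by apply/seteqP; split.
Qed.

End measurable_collisions.

(** * Independence of fresh variables from a generated sigma-algebra *)

Section independence.
Context {R : realType} {d : measure_display} {Omega : measurableType d}.
Variable P : probability Omega R.
Variables (I : choiceType) (Y : I -> Omega -> R).
Hypothesis mY : forall i, measurable_fun setT (Y i).
Hypothesis indepY : mutually_independent P Y.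

Definition cylinder (K : set I) (A : set Omega) := exists (s : seq I) (B : I -> set R),
  [/\ forall i, i \in s -> K i, forall i, measurable (B i)
    & A = [set w | forall i, i \in s -> B i (Y i w)]].

Lemma cylinder_bigsetI (s : seq I) (B : I -> set R) :
  [set w | forall i, i \in s -> B i (Y i w)] =
  \big[setI/setT]_(i <- undup s) (Y i @^-1` B i).
Proof.
rewrite -bigcap_seq; apply/seteqP; split=> w /= h i /=.
  by rewrite mem_undup; exact: h.
by move=> si; apply: h; rewrite /= mem_undup.
Qed.

Lemma preimage_measurable i (B : set R) : measurable B -> measurable (Y i @^-1` B).
Proof. by move=> mB; rewrite -[_ @^-1` _]setTI; exact: mY. Qed.

Lemma cylinder_measurable K A : cylinder K A -> measurable A.
Proof.
move=> [s [B [_ mB ->]]]; rewrite cylinder_bigsetI.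
by apply: bigsetI_measurable => i _; exact: preimage_measurable.
Qed.

Lemma cylinder_setI_closed K : setI_closed (cylinder K).
Proof.
move=> A A' [s [B [sK mB ->]]] [s' [B' [sK' mB' ->]]].
exists (s ++ s'), (fun i => (if i \in s then B i else setT) `&`
                          (if i \in s' then B' i else setT)); split.
- by move=> i; rewrite mem_cat => /orP[/sK|/sK'].
- by move=> i; apply: measurableI; case: ifP.
- apply/seteqP; split=> w /=.
    move=> [h h'] i; rewrite mem_cat => _; split.
      by case: ifP => // /h.
    by case: ifP => // /h'.
  move=> h; split=> i si; have := h i; rewrite mem_cat si ?orbT => /(_ isT)[].
    by [].
  by [].
Qed.

Lemma independence_pair i j (B B' : set R) : i != j -> measurable B -> measurable B' ->
  P (Y i @^-1` B `&` Y j @^-1` B') = (P (Y i @^-1` B) * P (Y j @^-1` B'))%E.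
Proof.
move=> ij mB mB'; pose C k := if k == i then B else B'.
have := @indepY [:: i; j] C; rewrite !big_cons !big_nil setIT mule1 /C eqxx.
rewrite eq_sym (negbTE ij) => -> //=; first by rewrite inE ij.
by move=> k; case: ifP.
Qed.

(** Dynkin's argument: cylinders over [K] are stable under intersection, and the events independent
    of [C] form a lambda-system. Two fresh variables are taken at once because a step of the
    exploration reads a speed and a gap. *)
Lemma independence_sigma K i j A (B B' : set R) : ~ K i -> ~ K j -> i != j ->
  measurable B -> measurable B' -> <<s cylinder K >> A ->
  P (A `&` (Y i @^-1` B `&` Y j @^-1` B')) =
  (P A * (P (Y i @^-1` B) * P (Y j @^-1` B')))%E.
Proof.
move=> Ki Kj ij mB mB'; set C := (Y i @^-1` B) `&` _.
have mC : measurable C.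
  by apply: measurableI; [exact: preimage_measurable mB|exact: preimage_measurable mB'].
rewrite -independence_pair // -/C.
pose H := [set A | measurable A /\ P (A `&` C) = (P A * P C)%E].
suff : <<s cylinder K >> `<=` H by move=> /[apply] -[].
apply: lambda_system_subset => //.
- exact: cylinder_setI_closed.
- apply/dynkin_lambda_system; split.
  + by split=> //; rewrite setTI probability_setT mul1e.
  + move=> F [mF e]; split; first exact: measurableC.
    rewrite setIC -setDE measureD //; last by rewrite ltey_eq fin_num_measure.
    rewrite [X in (_ - X)%E](_ : _ = (P F * P C)%E); last by rewrite setIC; exact: e.
    rewrite probability_setC //.
    have fin A0 : measurable A0 -> P A0 = (fine (P A0))%:E.
      by move=> mA0; rewrite fineK ?fin_num_measure.
    have q : (P C - P F * P C)%E = ((1 - P F) * P C)%E.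
      rewrite (fin _ mC) (fin _ mF) -EFinM -!EFinB -EFinM; congr EFin; ring.
    exact: q.
  + move=> F tF HF; have mF n : measurable (F n) by have [] := HF n.
    split; first exact: bigcupT_measurable.
    rewrite setI_bigcupl measure_semi_bigcup; last 3 first.
      by move=> n; apply: measurableI.
      exact: trivIset_setIr.
      by apply: bigcupT_measurable => n; apply: measurableI.
    rewrite measure_semi_bigcup //; last exact: bigcupT_measurable.
    have [c cE] : exists c, P C = c%:E by exists (fine (P C)); rewrite fineK ?fin_num_measure.
    rewrite cE muleC -nneseriesZl //.
    by apply: eq_eseriesr => n _; have [_ h] := HF n; apply: (eq_trans h); rewrite cE muleC.
- move=> F cF; split; first exact: cylinder_measurable cF.
  move: cF => [s [D [sK mD ->]]].
  pose D' k := if k == i then B else if k == j then B' else D k.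
  have ij' : (j == i) = false by rewrite eq_sym; apply/negbTE.
  have is' : i \notin undup s by rewrite mem_undup; apply/negP => /sK.
  have js' : j \notin undup s by rewrite mem_undup; apply/negP => /sK.
  have mD' k : measurable (D' k) by rewrite /D'; case: ifP => // _; case: ifP.
  have out k : k \in undup s -> D' k = D k.
    rewrite /D' => ks; case: eqP => [e|_]; first by rewrite -e ks in is'.
    by case: eqP => // e; rewrite -e ks in js'.
  have U : uniq [:: i, j & undup s].
    by rewrite /= inE negb_or ij is' js' undup_uniq.
  have := indepY U mD'; rewrite !big_cons /D' eqxx ij' eqxx -/D'.
  have e1 : \big[setI/setT]_(k <- undup s) Y k @^-1` D' k =
            \big[setI/setT]_(k <- undup s) Y k @^-1` D k.
    by apply: eq_big_seq => k ks; rewrite out.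
  have e2 : (\prod_(k <- undup s) P (Y k @^-1` D' k))%E =
            (\prod_(k <- undup s) P (Y k @^-1` D k))%E.
    by apply: eq_big_seq => k ks; rewrite out.
  rewrite cylinder_bigsetI e1 e2 -(indepY (undup_uniq s) mD) => h.
  by rewrite [LHS](_ : _ = P (Y i @^-1` B `&` (Y j @^-1` B' `&`
     \big[setI/setT]_(i0 <- undup s) Y i0 @^-1` D i0)));
   [rewrite h independence_pair // muleA muleC|rewrite setIC setIA].
Qed.

End independence.

(** * Measurability of the exploration *)

Section discrete_measurability.
Context {R : realType} {d : measure_display} {T : measurableType d}.
Implicit Types C D : countType.

Definition discrete_measurable C (f : T -> C) := forall c, measurable (f @^-1` [set c]).

Lemma discrete_cst C (c : C) : discrete_measurable (fun=> c).
Proof. by move=> c'; rewrite preimage_cst; case: ifP. Qed.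

(** [g c] has to be measurable only for the values [c] taken by [f]; for the others the fibre is
    empty. This matters because the words returned by [arr_rec] are known to be suffixes only when
    they are attained. *)
Lemma discrete_bind C D (f : T -> C) (g : C -> T -> D) : discrete_measurable f ->
  (forall w, discrete_measurable (g (f w))) ->
  discrete_measurable (fun w => g (f w) w).
Proof.
move=> mf mg e.
rewrite (_ : _ @^-1` _ = [set w | exists c, (f @^-1` [set c] `&` g c @^-1` [set e]) w]).
  apply: measurable_exists => c.
  have [->|/set0P[w [/= <- _]]] := eqVneq (f @^-1` [set c] `&` g c @^-1` [set e]) set0.
    exact: measurable0.
  by apply: measurableI; [exact: mf|exact: mg].
apply/seteqP; split=> w /=; first by exists (f w).
by move=> [c [<-]].
Qed.

Lemma discrete_comp C D (f : T -> C) (h : C -> D) : discrete_measurable f ->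
  discrete_measurable (h \o f).
Proof. by move=> mf; apply: (discrete_bind (g := fun c _ => h c)) => // w; exact: discrete_cst. Qed.

Lemma discrete_bool (b : T -> bool) : measurable [set w | b w] -> discrete_measurable b.
Proof.
move=> mb; have mT : measurable (b @^-1` [set true]) by [].
case=> //; rewrite (_ : _ @^-1` _ = ~` (b @^-1` [set true])); first exact: measurableC.
by apply/seteqP; split=> w /=; case: (b w).
Qed.

Lemma discrete_set C (f : T -> C) (A : set C) : discrete_measurable f ->
  measurable (f @^-1` A).
Proof.
move=> mf; rewrite (_ : f @^-1` A = [set w | exists c, (f @^-1` [set c] `&` [set _ | A c]) w]).
  apply: measurable_exists => c; apply: measurableI => //.
  case: (pselect (A c)) => Ac; first by rewrite (_ : [set _ | _] = setT) //; apply/seteqP; split.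
  by rewrite (_ : [set _ | _] = set0) //; apply/seteqP; split.
by apply/seteqP; split=> w /=; [exists (f w)|move=> [c [<-]]].
Qed.

Lemma discrete_if C (b : T -> bool) (f g : T -> C) : discrete_measurable b ->
  discrete_measurable f -> discrete_measurable g ->
  discrete_measurable (fun w => if b w then f w else g w).
Proof.
move=> mb mf mg; apply: (discrete_bind (g := fun b' w => if b' then f w else g w)) => // w.
by case: (b w).
Qed.

Variables (x v : int -> T -> R).

Definition observable (s : seq int) := forall i, i \in s ->
  measurable_fun setT (x i) /\ measurable_fun setT (v i).

Lemma observable_sub s s' : {subset s' <= s} -> observable s -> observable s'.
Proof. by move=> h o i /h/o. Qed.

Lemma discrete_speed y r : measurable_fun setT (v y) ->
  discrete_measurable (fun w => v y w == r).
Proof. by move=> m; apply: discrete_bool; apply: measurable_set_eq. Qed.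

Lemma measurable_gap y z : measurable_fun setT (x y) -> measurable_fun setT (x z) ->
  measurable_fun setT (fun w => x y w - x z w).
Proof. by move=> m1 m2; exact: measurable_funB. Qed.

Lemma discrete_clash D (F : seq int * seq int -> T -> D) B a X y u :
  observable [:: a; y] -> (forall l s r, B = (l, s) :: r -> observable [:: l]) ->
  discrete_measurable (F (X, u)) ->
  (forall l s r, B = (l, s) :: r -> discrete_measurable (F (X, s)) /\
     discrete_measurable (F (a :: X, s))) ->
  discrete_measurable (fun w => F (clash (x ^~ w) B a X y u) w).
Proof.
case: B => [|[l s] r] //= oay ol m0 ms.
have mx i : i \in [:: a; y] -> measurable_fun setT (x i) by move=> /oay[].
have mxa : measurable_fun setT (x a) by apply: mx; rewrite mem_head.
have mxy : measurable_fun setT (x y) by apply: mx; rewrite inE mem_head orbT.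
have [mxl _] := ol _ _ _ erefl l (mem_head _ _).
have [ms1 ms2] := ms _ _ _ erefl.
have -> : (fun w => F (if x y w - x a w < x l w - x y w then (X, u)
    else if x l w - x y w == x y w - x a w then (X, s) else (a :: X, s)) w) =
  (fun w => if x y w - x a w < x l w - x y w then F (X, u) w
    else if x l w - x y w == x y w - x a w then F (X, s) w else F (a :: X, s) w).
  by apply/funext => w; case: ifP => // _; case: ifP.
apply: discrete_if => //.
  by apply/discrete_bool/measurable_set_lt; exact: measurable_gap.
apply: discrete_if => //.
by apply/discrete_bool/measurable_set_eq; exact: measurable_gap.
Qed.

Let suffix_sub n X u y B w l s r : B = arr_rec (x ^~ w) (v ^~ w) n X u ->
  B = (l, s) :: r -> {subset s <= y :: u} /\ l \in y :: u.
Proof.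
move=> -> E; have [|u1 ->] := @arr_rec_suffix _ (x ^~ w) (v ^~ w) n X u l s.
  by rewrite E mem_head.
by split=> [z zs|]; rewrite inE mem_cat inE ?zs ?eqxx ?orbT.
Qed.

Lemma discrete_arr_rec n X u : observable (X ++ u) ->
  discrete_measurable (fun w => arr_rec (x ^~ w) (v ^~ w) n X u).
Proof.
elim: n X u => [|n IH] X [|y u] o /=; try exact: discrete_cst.
have [mxy mvy] : measurable_fun setT (x y) /\ measurable_fun setT (v y).
  by apply: o; rewrite mem_cat mem_head orbT.
have mu : discrete_measurable (fun w => arr_rec (x ^~ w) (v ^~ w) n [::] u).
  by apply: IH; apply: observable_sub o => i iu; rewrite mem_cat inE iu !orbT.
apply: discrete_if; first exact: discrete_speed.
  case: X o => [|a X] o; first exact: (discrete_comp (cons (y, u))).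
  apply: IH; apply: observable_sub o => i; rewrite !(inE, mem_cat).
  by move=> /orP[]->; rewrite !orbT.
apply: discrete_if; first exact: discrete_speed.
  apply: IH; apply: observable_sub o => i; rewrite !(inE, mem_cat).
  by move=> /or3P[] ->; rewrite ?orbT.
case: X o => [|a X] o; first exact: (discrete_comp (behead)).
apply: (discrete_bind (g := fun B w =>
  let c := clash (x ^~ w) B a X y u in arr_rec (x ^~ w) (v ^~ w) n c.1 c.2)) => // w.
have sub Z s : {subset Z <= a :: X} -> {subset s <= y :: u} -> observable (Z ++ s).
  move=> hZ hs; apply: observable_sub o => i; rewrite !mem_cat.
  by move=> /orP[/hZ|/hs] ->; rewrite ?orbT.
have tl (b : int) s : {subset s <= b :: s} by move=> i; rewrite inE orbC => ->.
apply: (discrete_clash (F := fun c w => arr_rec (x ^~ w) (v ^~ w) n c.1 c.2)).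
- by apply: (sub [:: a] [:: y]) => i; rewrite !inE => /eqP->; rewrite eqxx.
- move=> l s r E; have [_ lu] := @suffix_sub n [::] u y _ w l s r erefl E.
  by apply: (sub [::] [:: l]) => // i; rewrite inE => /eqP->.
- by apply: IH; apply: sub; exact: tl.
- move=> l s r E; have [su _] := @suffix_sub n [::] u y _ w l s r erefl E.
  by split; apply: IH; apply: sub => //; exact: tl.
Qed.

Lemma discrete_bal_rec n X u : observable (X ++ u) ->
  discrete_measurable (fun w => bal_rec (x ^~ w) (v ^~ w) n X u).
Proof.
elim: n X u => [|n IH] X [|y u] o /=; try exact: discrete_cst.
have [mxy mvy] : measurable_fun setT (x y) /\ measurable_fun setT (v y).
  by apply: o; rewrite mem_cat mem_head orbT.
have mu : discrete_measurable (fun w => bal_rec (x ^~ w) (v ^~ w) n [::] u).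
  by apply: IH; apply: observable_sub o => i iu; rewrite mem_cat inE iu !orbT.
apply: discrete_if; first exact: discrete_speed.
  case: X o => [|a X] o; first exact: (discrete_comp (omap (fun k => k - 1))).
  apply: IH; apply: observable_sub o => i; rewrite !(inE, mem_cat).
  by move=> /orP[]->; rewrite !orbT.
apply: discrete_if; first exact: discrete_speed.
  apply: IH; apply: observable_sub o => i; rewrite !(inE, mem_cat).
  by move=> /or3P[] ->; rewrite ?orbT.
case: X o => [|a X] o; first exact: (discrete_comp (omap (fun k => k + 1))).
apply: (discrete_bind (g := fun B w =>
  let c := clash (x ^~ w) B a X y u in bal_rec (x ^~ w) (v ^~ w) n c.1 c.2)) => [|w].
  by apply: discrete_arr_rec; apply: observable_sub o => i /= iu; rewrite !(inE, mem_cat) iu !orbT.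
have sub Z s : {subset Z <= a :: X} -> {subset s <= y :: u} -> observable (Z ++ s).
  move=> hZ hs; apply: observable_sub o => i; rewrite !mem_cat.
  by move=> /orP[/hZ|/hs] ->; rewrite ?orbT.
have tl (b : int) s : {subset s <= b :: s} by move=> i; rewrite inE orbC => ->.
apply: (discrete_clash (F := fun c w => bal_rec (x ^~ w) (v ^~ w) n c.1 c.2)).
- by apply: (sub [:: a] [:: y]) => i; rewrite !inE => /eqP->; rewrite eqxx.
- move=> l s r E; have [_ lu] := @suffix_sub n [::] u y _ w l s r erefl E.
  by apply: (sub [::] [:: l]) => // i; rewrite inE => /eqP->.
- by apply: IH; apply: sub; exact: tl.
- move=> l s r E; have [su _] := @suffix_sub n [::] u y _ w l s r erefl E.
  by split; apply: IH; apply: sub => //; exact: tl.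
Qed.

Lemma discrete_settle c q : observable q ->
  discrete_measurable (fun w => settle (x ^~ w) (v ^~ w) c q).
Proof.
move=> o; have b : discrete_measurable (fun w => bal (x ^~ w) (v ^~ w) [::] q).
  exact: discrete_bal_rec.
have a : discrete_measurable (fun w => arr (x ^~ w) (v ^~ w) [::] q).
  exact: discrete_arr_rec.
apply: discrete_if; try exact: discrete_cst.
apply: (discrete_bind (g := fun k w =>
  (k == Some 0) && (arr (x ^~ w) (v ^~ w) [::] q == [::]))) => // w.
exact: (discrete_comp (fun A => (_ == Some 0) && (A == [::]))).
Qed.

Lemma discrete_step st k : observable (k :: k - 1 :: st.2) ->
  discrete_measurable (fun w => step (x ^~ w) (v ^~ w) st k).
Proof.
case: st => [[c m] q] /= o.
have [mxk mvk] := o k (mem_head _ _).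
have [mxk1 _] : measurable_fun setT (x (k - 1)) /\ measurable_fun setT (v (k - 1)).
  by apply: o; rewrite !inE eqxx orbT.
have mg := measurable_gap mxk mxk1.
have orc : observable (rcons q k).
  apply: observable_sub o => i; rewrite mem_rcons !inE => /orP[]->; rewrite ?orbT //.
have [_|_] := eqVneq c 0%N; first exact: discrete_cst.
case: m => [|[|[|m]]]; last exact: discrete_settle.
- by apply: discrete_if; [exact: discrete_speed|exact: discrete_cst|];
    apply: discrete_if; [exact: discrete_speed|exact: discrete_cst|exact: discrete_cst].
- apply: discrete_if; [|exact: discrete_cst|exact: discrete_settle].
  apply: discrete_bool.
  rewrite (_ : [set w | _] = ~` [set w | v k w == -1] `&` ~` [set w | v k w == 1]
                              `&` [set w | 1 <= x k w - x (k - 1) w]).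
    apply: measurableI; last exact: measurable_set_le.
    by apply: measurableI; apply: measurableC; exact: measurable_set_eq.
  apply/seteqP; split=> w /=; first by move=> /andP[/andP[/negP h1 /negP h2] h3].
  by move=> [[/negP h1 /negP h2] h3]; rewrite /still h1 h2.
- apply: discrete_if; first exact: discrete_speed.
    apply: discrete_if; [|case: q o orc => [|r [|s [|t q]]] o orc|exact: discrete_cst];
      try exact: discrete_cst.
      by apply: discrete_bool; exact: measurable_set_le.
    apply: discrete_if; try exact: discrete_cst.
    have [mr _] : measurable_fun setT (x r) /\ measurable_fun setT (v r).
      by apply: o; rewrite !inE eqxx !orbT.
    have [ms _] : measurable_fun setT (x s) /\ measurable_fun setT (v s).
      by apply: o; rewrite !inE eqxx !orbT.
    by apply/discrete_bool/measurable_set_lt; exact: measurable_gap.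
  by apply: discrete_if; [exact: discrete_speed|exact: discrete_cst|exact: discrete_cst].
Qed.

Lemma step_pending (x0 v0 : int -> R) st k :
  {subset (step x0 v0 st k).2 <= rcons st.2 k}.
Proof.
have settleP c q : {subset (settle x0 v0 c q).2 <= q}.
  by move=> i; rewrite /settle; case: ifP.
case: st => [[c m] q] i /=; case: ifP => _.
  by rewrite mem_rcons inE => /= ->; rewrite orbT.
have kP : i \in [:: k] -> i \in rcons q k by rewrite mem_rcons !inE => /eqP->; rewrite eqxx.
case: m => [|[|[|m]]]; last exact: settleP.
- by case: ifP => // _; case: ifP.
- by case: ifP => // _; exact: settleP.
- case: ifP => // _; last by case: ifP.
  case: ifP => // _; case: q {kP} => [|r [|s [|t q]]] //; case: ifP => // _ /=.
  by rewrite !inE => /eqP->; rewrite eqxx.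
Qed.

Lemma explore_pending (x0 v0 : int -> R) c n m :
  {subset (explore x0 v0 c n m).2 <= seg n m}.
Proof.
elim: m => [|m IH] i //.
rewrite /explore -addn1 seg_cat foldl_cat /= => /step_pending.
by rewrite mem_rcons mem_cat !inE => /orP[->|/IH->]; rewrite ?orbT.
Qed.

(** [T] will carry the sigma-algebra of the past, for which only the particles already read are
    measurable; hence the bound on the indices. *)
Lemma discrete_explore c n m : (0 < n)%N ->
  (forall i : int, i < (n + m)%N%:Z ->
     0 <= i -> measurable_fun setT (x i) /\ measurable_fun setT (v i)) ->
  discrete_measurable (fun w => explore (x ^~ w) (v ^~ w) c n m).
Proof.
move=> n0; elim: m => [|m IH] h; first exact: discrete_cst.
have -> : (fun w => explore (x ^~ w) (v ^~ w) c n m.+1) =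
    (fun w => step (x ^~ w) (v ^~ w) (explore (x ^~ w) (v ^~ w) c n m) (n + m)%N).
  by apply/funext => w; rewrite /explore -addn1 seg_cat foldl_cat.
apply: (discrete_bind (g := fun st w => step (x ^~ w) (v ^~ w) st (n + m)%N)).
  by apply: IH => i i1 i0; apply: h => //; lia.
move=> w; apply: discrete_step => i.
rewrite !inE => /or3P[/eqP->|/eqP->|/explore_pending]; try (apply: h; lia).
by rewrite mem_seg => /andP[h1 h2]; apply: h; lia.
Qed.

End discrete_measurability.

(** * Real-valued probabilities *)

Section real_probability.
Context {R : realType} {d : measure_display} {Omega : measurableType d}.
Variable P : probability Omega R.

Definition pr (A : set Omega) : R := fine (P A).

Lemma prE A : measurable A -> P A = (pr A)%:E.
Proof. by move=> mA; rewrite /pr fineK ?fin_num_measure. Qed.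

Lemma pr_ge0 A : 0 <= pr A.
Proof. exact: fine_ge0. Qed.

Lemma pr_le A B : measurable A -> measurable B -> A `<=` B -> pr A <= pr B.
Proof.
by move=> mA mB AB; rewrite -lee_fin -!prE //; apply: le_measure; rewrite ?inE.
Qed.

Lemma pr_split A B : measurable A -> measurable B ->
  pr A = pr (A `&` B) + pr (A `&` ~` B).
Proof.
move=> mA mB; have mC := measurableC mB.
apply: EFin_inj; rewrite EFinD -!prE //; try exact: measurableI.
rewrite -measureU //; try exact: measurableI; first by rewrite -setIUr setUCr setIT.
by rewrite setIACA setICr setI0.
Qed.

Lemma pr_setT : pr setT = 1. Proof. by rewrite /pr probability_setT. Qed.

Lemma pr_setC A : measurable A -> pr (~` A) = 1 - pr A.
Proof.
move=> mA; rewrite -pr_setT (pr_split measurableT mA) !setTI; ring.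
Qed.

Lemma pr_set0 : pr set0 = 0. Proof. by rewrite /pr measure0. Qed.

Lemma pr_bigcup_le (F : (set Omega)^nat) (c : R) : (forall n, measurable (F n)) ->
  {homo F : n m / (n <= m)%N >-> n `<=` m} ->
  (forall n, pr (F n) <= c) -> pr (\bigcup_n F n) <= c.
Proof.
move=> mF hF hc; have mU := bigcupT_measurable _ mF.
rewrite -lee_fin -prE //.
have cvg := nondecreasing_cvg_mu (mu := P) mF mU (fun n m h => ltac:(exact/subsetPset/hF)).
rewrite -(cvg_lim _ cvg) //; apply: lime_le.
  by apply/cvg_ex; exists (P (\bigcup_n F n)).
by apply: nearW => n /=; rewrite prE // lee_fin.
Qed.

Lemma pr_cover (s : seq (set Omega)) X : measurable X ->
  (forall C, List.In C s -> measurable C) -> X `<=` foldr setU set0 s ->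
  pr X <= foldr (fun C r => pr (X `&` C) + r) 0 s.
Proof.
(* The event on the left shrinks along the induction while the summands keep [X], hence the separate
   copy [Z]. *)
move=> mX; have [Z [mZ XZ]] : exists Z, measurable Z /\ Z = X by exists X.
rewrite -{1 2}XZ; have : Z `<=` X by rewrite XZ.
clear XZ; elim: s Z mZ => [|C s IH] Z mZ ZX mC /= Zs.
  by rewrite (_ : Z = set0) ?pr_set0 //; apply/seteqP; split.
have mC0 : measurable C by apply: mC; left.
rewrite (pr_split mZ mC0) lerD //.
  by apply: pr_le; [exact: measurableI|exact: measurableI|exact: setSI].
apply: IH; first by apply: measurableI => //; exact: measurableC.
- by move=> w [/ZX].
- by move=> D Ds; apply: mC; right.
- by move=> w [/Zs[]].
Qed.

End real_probability.

(** * One-step inequalities for the weights *)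

Section drift_arithmetic.
Context {R : realType}.
Variables (K A z zi p q w : R).

(** [K] stands for [z ^ c], [A] for the probability of the current event, [zi] for the inverse of
    [z], [w] for a mode weight and [q] for the probability of a gap event. Products that would be
    nonlinear come in as sign hypotheses, so linear arithmetic is enough. *)
Lemma mode0_sum : 0 <= K * A * (1 - ((1 - p) / 2 * zi + (1 - p) / 2 * w + p * z)) ->
  K * zi * (A * ((1 - p) / 2 * 1)) +
    (K * w * (A * ((1 - p) / 2 * 1)) + z * K * (A * (p * 1))) <= K * 1 * A.
Proof. lra. Qed.

(** The product of the two lower bounds is [0.1104...]. *)
Lemma mode1_gain : 3313 / 10000 <= p -> 1 / 3 <= q -> 11 / 100 <= p * q.
Proof. nra. Qed.

Lemma mode1_sum : 0 <= K * A * ((1 - w) * (p * q - 11 / 100)) ->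
  K * w * (A * (p * q)) +
    (K * (A * (p * (1 - q))) + K * (A * ((1 - p) * 1))) <=
  K * (1 - 11 / 100 * (1 - w)) * A.
Proof. lra. Qed.

Lemma mode2_sum : 0 <= K * A * ((1 - p) / 2 * ((q - 1 / 2) * (zi - 1))) ->
  K * (A * ((1 - p) / 2 * q)) + (K * zi * (A * ((1 - p) / 2 * (1 - q))) +
    (K * (A * ((1 - p) / 2 * 1)) + z * K * (A * (p * 1)))) <=
  K * ((1 - p) / 2 * (3 / 2 + zi / 2) + p * z) * A.
Proof. lra. Qed.

End drift_arithmetic.

(** * The supermartingale bound for the exploration *)

Section exploration_bound.
Context {R : realType} {d : measure_display} {Omega : measurableType d}.
Variables (P : probability Omega R) (p : R) (x v : int -> Omega -> R).

Definition gaps_and_speeds (k : int + int) : Omega -> R :=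
  match k with inl i => gap x i | inr i => v i end.

Definition annihilation_model := [/\ forall w, x 0 w = 0,
  forall k, measurable_fun setT (gaps_and_speeds k),
  forall k, has_law P (v k) (speed_law p) &
  mutually_independent P gaps_and_speeds].

(** The constant gap 1 lies in both of the first two events. For exponential gaps their
    probabilities are [exp(-1) = 0.367...] and [1 - exp(-1) = 0.632...]. *)
Definition spread_gaps := forall k,
  [/\ 1 / 3 <= pr P (gap x k @^-1` [set r | 1 <= r]),
      1 / 2 <= pr P (gap x k @^-1` [set r | r <= 1])
    & pr P (gap x k @^-1` [set r | r <= 0]) = 0].

Hypothesis model : annihilation_model.
Hypothesis spread : spread_gaps.
Hypothesis p_bound : 3313 / 10000 <= p <= 1.

Notation Y := gaps_and_speeds.

Let x0 w : x 0 w = 0. Proof. by case: model. Qed.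
Let mY k : measurable_fun setT (Y k). Proof. by case: model. Qed.
Let law k : has_law P (v k) (speed_law p). Proof. by case: model. Qed.
Let indep : mutually_independent P Y. Proof. by case: model. Qed.

Lemma measurable_ge (r0 : R) : measurable [set r : R | r0 <= r].
Proof. by apply: measurable_set_le => //; exact: measurable_id. Qed.

Lemma measurable_le (r0 : R) : measurable [set r : R | r <= r0].
Proof. by apply: measurable_set_le => //; exact: measurable_id. Qed.

Lemma speed_lawE (B : set R) : measurable B -> speed_law p B =
  ((1 - p) / 2 * (-1 \in B)%:R + p * (0 \in B)%:R + (1 - p) / 2 * (1 \in B)%:R)%:E.
Proof. by move=> mB; rewrite /speed_law !diracE -!EFinM -!EFinD. Qed.

Lemma pr_speed k (B : set R) : measurable B -> pr P (v k @^-1` B) =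
  (1 - p) / 2 * (-1 \in B)%:R + p * (0 \in B)%:R + (1 - p) / 2 * (1 \in B)%:R.
Proof. by move=> mB; have := law k mB; rewrite /pushforward /pr => ->; rewrite speed_lawE. Qed.

(** Gap [i] ends at particle [i + 1], so gap [k - 1] is still fresh when particle [k] is about to be
    read. Negative indices are included, so that a symmetric window of static particles is an event
    of the past. *)
Definition known (k : int) : set (int + int) :=
  [set j | match j with inl i => i + 1 < k | inr i => i < k end].

Definition past k := g_sigma_algebraType (cylinder Y (known k)).

Definition in_past k (A : set Omega) := <<s cylinder Y (known k) >> A.

Lemma in_past_measurable k A : in_past k A -> measurable A.
Proof.
apply: smallest_sub; first exact: sigma_algebra_measurable.
by move=> B; exact: cylinder_measurable.
Qed.

Lemma in_pastS k k' : k <= k' -> in_past k `<=` in_past k'.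
Proof.
move=> kk'; apply: sub_sigma_algebra2 => A [s [B [h1 h2 h3]]]; exists s, B; split=> //.
by move=> [i|i] /h1 /=; move: kk'; clear; lia.
Qed.

Lemma in_pastI k A B : in_past k A -> in_past k B -> in_past k (A `&` B).
Proof. by move=> hA hB; apply: (@measurableI _ (past k)). Qed.

Lemma in_pastC k A : in_past k A -> in_past k (~` A).
Proof. by move=> hA; apply: (@measurableC _ (past k)). Qed.

Lemma in_past_variable k j (B : set R) : known k j -> measurable B ->
  in_past k (Y j @^-1` B).
Proof.
move=> kj mB; apply: sub_sigma_algebra; exists [:: j], (fun=> B); split=> //.
  by move=> i; rewrite inE => /eqP->.
by apply/seteqP; split=> w /= h; [move=> i; rewrite inE => /eqP->|apply: h; rewrite mem_head].
Qed.

Lemma past_measurable_variable k j : known k j ->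
  measurable_fun (setT : set (past k)) (Y j : past k -> R).
Proof. by move=> kj _ B mB; rewrite setTI; exact: in_past_variable. Qed.

Lemma past_measurable_position k (i : nat) : i%:Z < k ->
  measurable_fun (setT : set (past k)) (x i : past k -> R).
Proof.
elim: i => [|i IH] ik.
  rewrite (_ : x 0%N = (fun=> 0)); last by apply/funext => w; rewrite x0.
  exact: measurable_cst.
have -> : (x i.+1 : past k -> R) = (fun w => x i w + gap x i w).
  apply/funext => w; rewrite /gap (_ : i%:Z + 1 = i.+1%:Z); last by clear; lia.
  ring.
apply: measurable_funD; first by apply: IH; move: ik; clear; lia.
by apply: (@past_measurable_variable k (inl i%:Z)); rewrite /known /=; move: ik; clear; lia.
Qed.

Section backward_induction.
Variable c0 : nat.

Let st m w := explore (x ^~ w) (v ^~ w) c0 c0.+1 m.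
Let now m : int := (c0.+1 + m)%N%:Z.

Lemma in_past_state m (S : set (nat * nat * seq int)) : in_past (now m) (st m @^-1` S).
Proof.
apply: (@discrete_set _ (past (now m)) _ (st m : past (now m) -> _)).
apply: discrete_explore => // -[i|i] // h _; split.
  exact: past_measurable_position.
exact: (@past_measurable_variable (now m) (inr i%:Z)).
Qed.

Definition hit m := [set w | (st m w).1.1 = 0%N].

Lemma measurable_hit m : measurable (hit m).
Proof.
exact: (in_past_measurable (@in_past_state m [set s | s.1.1 = 0%N])).
Qed.

(* [W1] and [W2] correct [z ^ c] in modes 1 and 2.  [3/2 + z^-1/2] averages, over
   the events gap [<= 1] (probability at least 1/2) and gap [> 1], the effect [1]
   or [z^-1] of a left-mover, plus [1] for a right-mover; [11/100] bounds from below
   the probability of a static particle preceded by a gap [>= 1]. *)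
Let z : R := 199 / 200.
Let W2 : R := (1 - p) / 2 * (3 / 2 + z^-1 / 2) + p * z.
Let W1 : R := 1 - 11 / 100 * (1 - W2).

Let zV : z^-1 = 200 / 199. Proof. by rewrite /z; field. Qed.
Let W2_range : 0 <= W2 <= 1.
Proof. by have /andP[? ?] := p_bound; rewrite /W2 zV /z; apply/andP; split; lra. Qed.
Let z_le1 : 0 <= z^-1 - 1. Proof. by rewrite zV; lra. Qed.
Let W1_range : 0 <= W1 <= 1.
Proof. by have /andP[? ?] := W2_range; rewrite /W1; apply/andP; split; lra. Qed.

(** At [p = 0.3313] the first-order gain is about [0.003 * (1 - z)] and the second-order loss about
    [(1 - z)^2 / 3], which leaves room for [1 - z = 1/200]. The expression is quadratic in [p],
    hence the auxiliary product of the two slacks. *)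
Let drift : (1 - p) / 2 * z^-1 + (1 - p) / 2 * W1 + p * z <= 1.
Proof.
have /andP[h1 h2] := p_bound.
have h : 0 <= (p - 3313 / 10000) * (1 - p) by apply: mulr_ge0; lra.
by rewrite /W1 /W2 zV /z; nra.
Qed.

Let mode_weight (md : nat) : R := if md is 1 then W1 else if md is 2 then W2 else 1.
Let weight (c md : nat) : R := if c is 0 then 1 else z ^+ c * mode_weight md.

Let weight_ge0 c md : 0 <= weight c md.
Proof.
rewrite /weight; case: c => // c; apply: mulr_ge0; first by rewrite exprn_ge0 // /z; lra.
have /andP[? _] := W1_range; have /andP[? _] := W2_range.
by case: md => [|[|[|md]]].
Qed.

Let piece m (B B' : set R) := v (now m) @^-1` B `&` gap x (now m - 1) @^-1` B'.

Let pr_piece m A B B' : in_past (now m) A -> measurable B -> measurable B' ->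
  pr P (A `&` piece m B B') =
  pr P A * (pr P (v (now m) @^-1` B) * pr P (gap x (now m - 1) @^-1` B')).
Proof.
move=> hA mB mB'.
have := @independence_sigma _ _ _ P _ Y mY indep (known (now m)) (inr (now m))
  (inl (now m - 1)) A B B'.
rewrite /known /= => /(_ _ _ _ mB mB' hA) e.
have mv k : measurable_fun setT (v k) by exact: (mY (inr k)).
have mg k : measurable_fun setT (gap x k) by exact: (mY (inl k)).
have mpre (f : Omega -> R) (C : set R) : measurable_fun setT f -> measurable C ->
    measurable (f @^-1` C) by move=> mf mC; rewrite -[_ @^-1` _]setTI; exact: mf.
have e' : P (A `&` piece m B B') = (P A * (P (v (now m) @^-1` B) *
    P (gap x (now m - 1) @^-1` B')))%E.
  by apply: e => //; [rewrite ltxx|rewrite subrK ltxx].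
have mA := in_past_measurable hA.
by rewrite /pr e' fineM ?fin_num_measure ?fineM ?fin_numM ?fin_num_measure //;
  try exact: mpre.
Qed.

Let still_set : set R := ~` [set -1; 1].

Let mS : measurable still_set. Proof. by apply: measurableC; apply: measurableU. Qed.

Let pr_left k : pr P (v k @^-1` [set -1]) = (1 - p) / 2.
Proof.
rewrite pr_speed // mem_set // !memNset /=; first by lra.
- by move=> e; lra.
- by move=> e; lra.
Qed.

Let pr_right k : pr P (v k @^-1` [set 1]) = (1 - p) / 2.
Proof.
rewrite pr_speed // [1 \in _]mem_set // !memNset /=; first by lra.
- by move=> e; lra.
- by move=> e; lra.
Qed.

Let pr_still k : pr P (v k @^-1` still_set) = p.
Proof.
rewrite pr_speed // [0 \in _]mem_set; last by move=> [] /= e; lra.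
by rewrite !memNset /=; [lra|move=> h; apply: h; right|move=> h; apply: h; left].
Qed.

Let pr_moving k : pr P (v k @^-1` [set -1; 1]) = 1 - p.
Proof.
rewrite pr_speed; last exact: measurableU.
rewrite [0 \in _]memNset; last by move=> [] /= e; lra.
by rewrite !mem_set /=; [lra|right|left].
Qed.

Let pr_any k : pr P (gap x k @^-1` setT) = 1.
Proof. by rewrite preimage_setT pr_setT. Qed.

Let stS m w : st m.+1 w = step (x ^~ w) (v ^~ w) (st m w) (now m).
Proof. by rewrite /st /explore -(addn1 m) seg_cat foldl_cat. Qed.

Let nowS m : now m < now m.+1. Proof. by rewrite /now; clear; lia. Qed.

Let in_past_piece m A B B' : in_past (now m) A -> measurable B -> measurable B' ->
  in_past (now m.+1) (A `&` piece m B B').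
Proof.
move=> hA mB mB'; apply: in_pastI; first exact: in_pastS (ltW (nowS m)) _ hA.
apply: in_pastI.
  by apply: (@in_past_variable (now m.+1) (inr (now m))) => //; exact: nowS.
by apply: (@in_past_variable (now m.+1) (inl (now m - 1))) => //=; rewrite subrK; exact: nowS.
Qed.

Let weight_plain c : weight c 0 = z ^+ c.
Proof. by case: c => [|c]; rewrite /weight ?mulr1. Qed.

Let weight_pos c md : (0 < c)%N -> weight c md = z ^+ c * mode_weight md.
Proof. by case: c. Qed.

Let weight_pred c : (0 < c)%N -> weight c.-1 0 = z ^+ c * z^-1.
Proof.
case: c => // c _; rewrite weight_plain /= exprSr mulfK //.
by rewrite /z; apply/eqP; lra.
Qed.

Let zc_ge0 c : 0 <= z ^+ c. Proof. by rewrite exprn_ge0 // /z; lra. Qed.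

(** The supermartingale property in integrated form, on events of the past where level and mode are
    constant. The next particle cuts [A] into pieces given by its speed and the gap before it; both
    are independent of [A], so each piece contributes a plain factor. *)
Lemma hit_bound N m c md A : in_past (now m) A ->
  (forall w, A w -> (st m w).1 = (c, md)) ->
  pr P (A `&` hit (m + N)) <= weight c md * pr P A.
Proof.
elim: N m c md A => [|N IH] m c md A hA Ast; have mA := in_past_measurable hA.
  rewrite addn0; case: c Ast => [|c] Ast.
    by rewrite mul1r; apply: pr_le => //; apply: measurableI => //; exact: measurable_hit.
  rewrite (_ : A `&` hit m = set0); last first.
    by apply/seteqP; split=> // w [/Ast e]; rewrite /hit /= e.
  by rewrite pr_set0 mulr_ge0 ?weight_ge0 ?pr_ge0.
case: (posnP c) Ast => [->|c_gt0] Ast.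
  by rewrite mul1r; apply: pr_le => //; apply: measurableI => //; exact: measurable_hit.
rewrite -addSnnS; have mH := @measurable_hit (m.+1 + N).
(* Whether a block closes may depend on positions already read. Modes 0 and 3 have the same weight,
   so it is enough to split the event by the resulting state. *)
have plain Q c' : in_past (now m.+1) Q ->
    (forall w, Q w -> (st m.+1 w).1 = (c', 0%N) \/ (st m.+1 w).1 = (c', 3%N)) ->
    pr P (Q `&` hit (m.+1 + N)) <= z ^+ c' * pr P Q.
  move=> hQ Qst; have mQ := in_past_measurable hQ.
  pose F := st m.+1 @^-1` [set s | s.1 = (c', 0%N)].
  have hF : in_past (now m.+1) F by exact: in_past_state.
  have mF := in_past_measurable hF.
  rewrite (pr_split P mQ mF) (pr_split P (measurableI _ _ mQ mH) mF) mulrDr.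
  rewrite ![Q `&` hit _ `&` _]setIAC; apply: lerD.
    rewrite -(weight_plain c'); apply: IH; first exact: in_pastI.
    by move=> w [_].
  have -> : z ^+ c' = weight c' 3 by rewrite -weight_plain; case: (c').
  apply: IH; first by apply: in_pastI => //; exact: in_pastC.
  by move=> w [Qw nF]; case: (Qst w Qw).
have via B B' c' md' : measurable B -> measurable B' ->
    (forall w, A w -> B (v (now m) w) -> B' (gap x (now m - 1) w) ->
       (st m.+1 w).1 = (c', md')) ->
    pr P (A `&` hit (m.+1 + N) `&` piece m B B') <=
    weight c' md' * (pr P A * (pr P (v (now m) @^-1` B) *
                               pr P (gap x (now m - 1) @^-1` B'))).
  move=> mB mB' h; rewrite setIAC -pr_piece //.
  apply: IH; first exact: in_past_piece.
  by move=> w [Aw [Bw B'w]]; apply: h.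
have via_plain B B' c' : measurable B -> measurable B' ->
    (forall w, A w -> B (v (now m) w) -> B' (gap x (now m - 1) w) ->
       (st m.+1 w).1 = (c', 0%N) \/ (st m.+1 w).1 = (c', 3%N)) ->
    pr P (A `&` hit (m.+1 + N) `&` piece m B B') <=
    z ^+ c' * (pr P A * (pr P (v (now m) @^-1` B) *
                               pr P (gap x (now m - 1) @^-1` B'))).
  move=> mB mB' h; rewrite setIAC -pr_piece //.
  apply: plain; first exact: in_past_piece.
  by move=> w [Aw [Bw B'w]]; apply: h.
have mP B B' : measurable B -> measurable B' -> measurable (piece m B B').
  move=> mB mB'; apply: measurableI; rewrite -[_ @^-1` _]setTI.
    exact: (mY (inr (now m))).
  exact: (mY (inl (now m - 1))).
have mAH : measurable (A `&` hit (m.+1 + N)) by exact: measurableI.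
have stE w : A w -> exists q, st m.+1 w = step (x ^~ w) (v ^~ w) (c, md, q) (now m).
  move=> /Ast e; exists (st m w).2; rewrite stS; congr step.
  by rewrite -e; case: (st m w).
have c_neq0 : (c == 0%N) = false by apply/negbTE; rewrite -lt0n.
have gapE w : x (now m) w - x (now m - 1) w = gap x (now m - 1) w.
  by rewrite /gap subrK.
have settleE w q : (settle (x ^~ w) (v ^~ w) c q).1 = (c, 0%N) \/
                   (settle (x ^~ w) (v ^~ w) c q).1 = (c, 3%N).
  by rewrite /settle; case: ifP; [left|right].
have stillE w : still_set (v (now m) w) ->
    (v (now m) w == -1) = false /\ (v (now m) w == 1) = false.
  by move=> h; split; apply/negbTE/eqP => e; apply: h; [left|right].
have oneN1 : (1 == -1 :> R) = false by apply/eqP; lra.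
have [h1 h2] := (p_bound, drift).
have a0 : 0 <= pr P A := pr_ge0 P A.
have [g1 g2 _] := spread (now m - 1).
set D1 := [set r : R | 1 <= r] in g1 *; set D2 := [set r : R | r <= 1] in g2 *.
have mD1 : measurable D1 by exact: measurable_ge.
have mD2 : measurable D2 by exact: measurable_le.
have mpre B : measurable B -> measurable (gap x (now m - 1) @^-1` B).
  by move=> mB; rewrite -[_ @^-1` _]setTI; exact: (mY (inl (now m - 1))).
have q1C : pr P (gap x (now m - 1) @^-1` ~` D1) = 1 - pr P (gap x (now m - 1) @^-1` D1).
  by rewrite preimage_setC pr_setC //; exact: mpre mD1.
have q2C : pr P (gap x (now m - 1) @^-1` ~` D2) = 1 - pr P (gap x (now m - 1) @^-1` D2).
  by rewrite preimage_setC pr_setC //; exact: mpre mD2.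
have q1le : pr P (gap x (now m - 1) @^-1` D1) <= 1.
  by rewrite -(pr_setT P); apply: pr_le => //; exact: mpre mD1.
have q2le : pr P (gap x (now m - 1) @^-1` D2) <= 1.
  by rewrite -(pr_setT P); apply: pr_le => //; exact: mpre mD2.
have /andP[p1 p2] := p_bound.
have := zc_ge0 c; set zc := z ^+ c => zc0.
have weightE : weight c md = zc * mode_weight md by exact: weight_pos.
rewrite weightE.
have case_speed (B' : set R) w : (piece m [set -1] setT `|` (piece m [set 1] setT `|`
    (piece m still_set setT `|` set0))) w.
  have [e|n1] := eqVneq (v (now m) w) (-1); first by left.
  right; have [e|n2] := eqVneq (v (now m) w) 1; first by left.
  by right; left; split=> // -[] /= e; [rewrite e eqxx in n1|rewrite e eqxx in n2].
have K0 : 0 <= zc * pr P A by exact: mulr_ge0.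
case: md Ast stE weightE => [|[|[|md]]] Ast stE weightE.
- have cov := @pr_cover _ _ _ P [:: piece m [set -1] setT; piece m [set 1] setT;
    piece m still_set setT] _ mAH.
  apply: le_trans (cov _ _) _ => {cov}.
  + by move=> C /= [<-|[<-|[<-|[]]]]; apply: mP.
  + by move=> w _; exact: (case_speed setT).
  have l1 := @via [set -1] setT c.-1 0%N (measurable_set1 _) measurableT.
  have l2 := @via [set 1] setT c 1%N (measurable_set1 _) measurableT.
  have l3 := @via still_set setT c.+1 0%N mS measurableT.
  rewrite pr_left pr_any weight_pred // in l1.
  rewrite pr_right pr_any in l2; rewrite pr_still pr_any weight_plain exprS in l3.
  have w1 : weight c 1 = zc * W1 by exact: (weight_pos 1).
  rewrite w1 in l2; rewrite /= addr0.
  move: l1 => /(_ _)/(le_trans _) l1; move: l2 => /(_ _) l2; move: l3 => /(_ _) l3.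
  apply: (@le_trans _ _ (zc * z^-1 * (pr P A * ((1 - p) / 2 * 1)) +
    (zc * W1 * (pr P A * ((1 - p) / 2 * 1)) + z * zc * (pr P A * (p * 1))))).
    apply: lerD; last apply: lerD.
    + apply: l1 => // w /stE[q ->] /= -> _; by rewrite c_neq0 eqxx.
    + apply: l2 => w /stE[q ->] /= -> _; by rewrite c_neq0 oneN1 eqxx.
    + by apply: l3 => w /stE[q ->] /stillE[e1 e2] _; rewrite /= c_neq0 e1 e2.
  have : 0 <= zc * pr P A * (1 - ((1 - p) / 2 * z^-1 + (1 - p) / 2 * W1 + p * z)).
    by apply: mulr_ge0 => //; rewrite subr_ge0.
  exact: mode0_sum.
- have cov := @pr_cover _ _ _ P [:: piece m still_set D1; piece m still_set (~` D1);
    piece m [set -1; 1] setT] _ mAH.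
  apply: le_trans (cov _ _) _ => {cov}.
  + by move=> C /= [<-|[<-|[<-|[]]]]; apply: mP => //;
      [exact: measurableC|exact: measurableU].
  + move=> w _ /=; case: (case_speed setT w) => [[e _]|[[e _]|[[e _]|//]]].
    * by right; right; left; split=> //; left.
    * by right; right; left; split=> //; right.
    * by have [h|h] := pselect (D1 (gap x (now m - 1) w)); [left|right; left].
  have l1 := @via still_set D1 c 2%N mS mD1.
  have l2 := @via_plain still_set (~` D1) c mS (measurableC mD1).
  have l3 := @via_plain [set -1; 1] setT c _ measurableT.
  rewrite pr_still in l1; rewrite pr_still q1C in l2; rewrite pr_moving pr_any in l3.
  have w2 : weight c 2 = zc * W2 by exact: (weight_pos 2).
  rewrite w2 in l1; rewrite /= addr0.
  set q1 := pr P (gap x (now m - 1) @^-1` D1) in g1 q1le l1 l2 *.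
  apply: (@le_trans _ _ (zc * W2 * (pr P A * (p * q1)) +
    (zc * (pr P A * (p * (1 - q1))) + zc * (pr P A * ((1 - p) * 1))))).
    apply: lerD; last apply: lerD.
    + apply: l1 => w /stE[q ->] /stillE[e1 e2]; rewrite /D1 /= => hg.
      by rewrite c_neq0 /still e1 e2 gapE hg.
    + apply: l2 => w /stE[q ->] _; rewrite /D1 /= => /negP/negbTE hg.
      by rewrite c_neq0 gapE hg andbF; exact: settleE.
    + apply: l3; first exact: measurableU.
      move=> w /stE[q ->] hv _ /=; rewrite c_neq0 /still.
      by case: hv => /= ->; rewrite eqxx ?andbF; exact: settleE.
  have /andP[w21 w22] := W2_range.
  have pq : 11 / 100 <= p * q1 by exact: mode1_gain.
  have : 0 <= zc * pr P A * ((1 - W2) * (p * q1 - 11 / 100)).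
    by apply: mulr_ge0 => //; apply: mulr_ge0; rewrite subr_ge0.
  exact: mode1_sum.
- have cov := @pr_cover _ _ _ P [:: piece m [set -1] D2; piece m [set -1] (~` D2);
    piece m [set 1] setT; piece m still_set setT] _ mAH.
  apply: le_trans (cov _ _) _ => {cov}.
  + by move=> C /= [<-|[<-|[<-|[<-|[]]]]]; apply: mP => //; exact: measurableC.
  + move=> w _ /=; case: (case_speed setT w) => [[e _]|[[e _]|[[e _]|//]]].
    * by have [h|h] := pselect (D2 (gap x (now m - 1) w)); [left|right; left].
    * by right; right; left.
    * by right; right; right; left.
  have l1 := @via_plain [set -1] D2 c (measurable_set1 _) mD2.
  have l2 := @via [set -1] (~` D2) c.-1 0%N (measurable_set1 _) (measurableC mD2).
  have l3 := @via_plain [set 1] setT c (measurable_set1 _) measurableT.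
  have l4 := @via still_set setT c.+1 0%N mS measurableT.
  rewrite pr_left in l1; rewrite pr_left q2C weight_pred // in l2.
  rewrite pr_right pr_any in l3; rewrite pr_still pr_any weight_plain exprS in l4.
  rewrite /= addr0.
  set q2 := pr P (gap x (now m - 1) @^-1` D2) in g2 q2le l1 l2 *.
  apply: (@le_trans _ _ (zc * (pr P A * ((1 - p) / 2 * q2)) +
    (zc * z^-1 * (pr P A * ((1 - p) / 2 * (1 - q2))) +
    (zc * (pr P A * ((1 - p) / 2 * 1)) + z * zc * (pr P A * (p * 1)))))).
    apply: lerD; last apply: lerD; last apply: lerD.
    + apply: l1 => w /stE[q ->] /= ->; rewrite /D2 /= => hg.
      rewrite c_neq0 eqxx gapE hg.
      by case: q => [|r [|s [|? ?]]]; try (by left); case: ifP; [right|left].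
    + apply: l2 => w /stE[q ->] /= ->; rewrite /D2 /= => /negP/negbTE hg.
      by rewrite c_neq0 eqxx gapE hg.
    + by apply: l3 => w /stE[q ->] /= -> _; rewrite c_neq0 oneN1 eqxx; right.
    + by apply: l4 => w /stE[q ->] /stillE[e1 e2] _; rewrite /= c_neq0 e1 e2.
  have : 0 <= zc * pr P A * ((1 - p) / 2 * ((q2 - 1 / 2) * (z^-1 - 1))).
    by apply: mulr_ge0 => //; apply: mulr_ge0; [apply: divr_ge0; rewrite ?subr_ge0 ?ler0n|
      apply: mulr_ge0; rewrite ?z_le1 // subr_ge0].
  exact: mode2_sum.
- rewrite /mode_weight mulr1; apply: plain; first exact: in_pastS (ltW (nowS m)) _ hA.
  by move=> w /stE[q ->] /=; rewrite c_neq0; exact: settleE.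
Qed.

End backward_induction.
End exploration_bound.

Lemma expr_small {R : realType} (q e : R) : 0 <= q < 1 -> 0 < e -> exists n, q ^+ n < e.
Proof.
move=> /andP[q0 q1] e0; have /cvgrPdist_lt/(_ _ e0) [n _ h] : q ^+ k @[k --> \oo] --> (0 : R).
  by apply: cvg_expr; rewrite ger0_norm.
by exists n; have := h n (leqnn n); rewrite /= sub0r normrN ger0_norm ?exprn_ge0.
Qed.

(** * Almost sure regularity of the configuration *)

Section almost_sure_configuration.
Context {R : realType} {d : measure_display} {Omega : measurableType d}.
Variables (P : probability Omega R) (p : R) (x v : int -> Omega -> R).
Hypothesis model : annihilation_model P p x v.
Hypothesis spread : spread_gaps P x.

(** Infinitely many gaps of length at least 1 on each side give local finiteness. [Negz j] is the
    index [-j - 1]. *)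
Definition regular (w : Omega) :=
  [/\ forall k, 0 < gap x k w, forall k, [\/ v k w = -1, v k w = 0 | v k w = 1],
      forall N, exists j, (N <= j)%N /\ 1 <= gap x (Posz j) w
    & forall N, exists j, (N <= j)%N /\ 1 <= gap x (Negz j) w].

Let mY k : measurable_fun setT (gaps_and_speeds x v k). Proof. by case: model. Qed.

Lemma position_succ k w : x (k + 1) w = x k w + gap x k w.
Proof. by rewrite /gap [RHS]addrC subrK. Qed.

Lemma regular_mono w : regular w -> forall i j, i < j -> x i w < x j w.
Proof.
move=> [g _ _ _] i j ij; have [n ->] : exists n : nat, j = i + n%:Z + 1.
  by exists (absz (j - i - 1)%R); move: ij; clear; lia.
elim: n => [|n IH].
  by rewrite addr0 position_succ ltrDl.
apply: lt_trans IH _.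
by rewrite (_ : i + n.+1%:Z = i + n%:Z + 1) ?[X in _ < X]position_succ ?ltrDl //; lia.
Qed.

Lemma regular_unbounded w (M : nat) : x 0 w = 0 -> regular w ->
  (exists n : nat, M%:R <= x (Posz n) w) /\ (exists n : nat, x (- Posz n) w <= - M%:R).
Proof.
move=> x0 r; have mono := regular_mono r.
have mono_le i j : i <= j -> x i w <= x j w.
  by rewrite le_eqVlt => /orP[/eqP->//|/mono/ltW].
case: r => _ _ right left; elim: M => [|M [[n hn] [m hm]]].
  by split; exists 0%N; rewrite ?oppr0 x0.
split.
  have [j [nj g]] := right n; exists j.+1.
  have := mono_le n j _; rewrite lez_nat => /(_ nj) h.
  by rewrite (_ : Posz j.+1 = Posz j + 1) ?position_succ -?natr1; [lra|lia].
have [j [mj g]] := left m; exists j.+1.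
have := mono_le (- Posz j) (- Posz m) _; rewrite lerN2 lez_nat => /(_ mj) h.
have e : - Posz j = Negz j + 1 by lia.
by move: h; rewrite e position_succ -NegzE -natr1; lra.
Qed.

Lemma regular_locally_finite w : x 0 w = 0 -> regular w ->
  forall b : R, exists A : seq int, forall k, - b <= x k w <= b -> k \in A.
Proof.
move=> x0 r b; have mono := regular_mono r.
have [M bM] : exists M : nat, b < M%:R.
  exists (Num.bound `|b|); apply: le_lt_trans (ler_norm b) _.
  exact: archi_boundP (normr_ge0 b).
have [[n hn] [m hm]] := regular_unbounded M x0 r.
exists [seq Posz i - Posz m | i <- iota 0 (n + m)] => k /andP[h1 h2].
have kn : k < Posz n.
  rewrite ltNge le_eqVlt; apply/negP => /orP[/eqP e|/mono h].
    by rewrite -e in h2; lra.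
  by lra.
have km : - Posz m < k.
  rewrite ltNge le_eqVlt; apply/negP => /orP[/eqP e|/mono h].
    by rewrite e in h1; lra.
  by lra.
apply/mapP; exists (absz (k + Posz m)%R); last by move: km; clear; lia.
by rewrite mem_iota; move: kn km; clear; lia.
Qed.

Let mpre k (B : set R) : measurable B -> measurable (gaps_and_speeds x v k @^-1` B).
Proof. by move=> mB; rewrite -[_ @^-1` _]setTI; exact: mY. Qed.

Let small : set R := ~` [set r | 1 <= r].
Let msmall : measurable small. Proof. by apply: measurableC; exact: measurable_ge. Qed.

(** By independence, [n] given gaps are all below 1 with probability at most [(2/3)^n], the base
    being the complement of the [1/3] in [spread_gaps]. *)
Lemma null_small_gaps (f : nat -> int) : injective f ->
  P.-negligible [set w | forall j, small (gap x (f j) w)].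
Proof.
move=> inj_f; set A := [set w | _].
have mA : measurable A.
  apply: (@measurable_forall _ _ _ (fun j => (gap x (f j)) @^-1` small)) => j.
  exact: (@mpre (inl (f j))).
exists A; split=> //; apply/eqP; rewrite eq_le measure_ge0 andbT (prE P mA) lee_fin.
rewrite leNgt; apply/negP => A0.
have q : 0 <= (2 / 3 : R) < 1 by apply/andP; split; lra.
have [n hn] := expr_small q A0.
pose s := [seq inl (f j) : int + int | j <- iota 0 n].
have us : uniq s.
  by rewrite map_inj_uniq ?iota_uniq // => i j [] /inj_f.
have [_ _ _ indep] := model.
have := indep s (fun=> small) us (fun=> msmall).
have mB : measurable (\big[setI/setT]_(i <- s) (gaps_and_speeds x v i @^-1` small)).
  by apply: bigsetI_measurable => i _; exact: mpre.
rewrite (prE P mB) => /(congr1 fine) /= e.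
have le1 : pr P A <= pr P (\big[setI/setT]_(i <- s) (gaps_and_speeds x v i @^-1` small)).
  apply: pr_le => // w Aw; rewrite -bigcap_seq => i /= /mapP[j _ ->] /=; exact: Aw.
move: le1; rewrite e leNgt => /negP; apply; apply: le_lt_trans hn.
have -> : n = size s by rewrite size_map size_iota.
have sinl i : i \in s -> exists k, i = inl k by move=> /mapP[j _ ->]; exists (f j).
suff : (0 <= \prod_(i <- s) P (gaps_and_speeds x v i @^-1` small) <= ((2 / 3) ^+ size s)%:E)%E.
  by case: (\prod_(i <- s) _)%E => [r| |] //=; rewrite !lee_fin => /andP[].
elim: s sinl {us mB e} => [|i s IH] sinl.
  by rewrite big_nil expr0 lee_fin lexx ler01.
rewrite big_cons exprS EFinM.
have /andP[h1 h2] : (0 <= \prod_(i <- s) P (gaps_and_speeds x v i @^-1` small) <=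
    ((2 / 3) ^+ size s)%:E)%E.
  by apply: IH => j js; apply: sinl; rewrite inE js orbT.
apply/andP; split; first exact: mule_ge0.
apply: lee_pmul => //.
have [k ->] := sinl i (mem_head _ _).
rewrite (prE P (mpre (inl k) msmall)) lee_fin /= /small preimage_setC pr_setC; last first.
  exact: (@mpre (inl k)) (measurable_ge _).
by have [h _ _] := spread k; lra.
Qed.

Lemma negligible_exists_int (Q : int -> set Omega) :
  (forall k, P.-negligible (Q k)) -> P.-negligible [set w | exists k, Q k w].
Proof.
move=> h; apply: (@negligibleS _ _ _ _
  (\bigcup_n Q (Posz n) `|` \bigcup_n Q (Negz n))).
  by move=> w [[n|n] q]; [left|right]; exists n.
by apply: negligibleU; apply: negligible_bigcup.
Qed.

Lemma null_event (A : set Omega) : measurable A -> pr P A = 0 -> P.-negligible A.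
Proof. by move=> mA A0; exists A; split=> //; rewrite prE // A0. Qed.

Lemma regular_ae : P.-negligible (~` regular).
Proof.
pose B1 := [set w | exists k, gap x k w <= 0].
pose B2 := [set w | exists k, (v k @^-1` (~` [set -1; 0; 1])) w].
pose B3 (f : nat -> int) := \bigcup_N [set w | forall j, small (gap x (f (N + j)%N) w)].
apply: (@negligibleS _ _ _ _ (B1 `|` B2 `|` (B3 Posz `|` B3 Negz))).
  move=> w nr; apply: contrapT => nB; apply: nr; split.
  - by move=> k; rewrite ltNge; apply/negP => h; apply: nB; left; left; exists k.
  - move=> k; apply: contrapT => h; apply: nB; left; right; exists k => /= h'; apply: h.
    by case: h' => [[]|] /= ->; [constructor 1|constructor 2|constructor 3].
  - move=> N; apply: contrapT => h; apply: nB; right; left; exists N => // j g.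
    by apply: h; exists (N + j)%N; rewrite leq_addr.
  - move=> N; apply: contrapT => h; apply: nB; right; right; exists N => // j g.
    by apply: h; exists (N + j)%N; rewrite leq_addr.
have null3 (f : nat -> int) : injective f -> P.-negligible (B3 f).
  move=> inj_f; apply: negligible_bigcup => N; apply: (@null_small_gaps (fun j => f (N + j)%N)).
  by move=> i j /inj_f/addnI.
apply: negligibleU; apply: negligibleU; try (by apply: null3 => i j []).
- apply: negligible_exists_int => k; apply: null_event.
    exact: (@mpre (inl k)) (measurable_le _).
  by have [_ _] := spread k.
- apply: negligible_exists_int => k.
  have mB : measurable (~` [set -1; 0; 1] : set R).
    by apply: measurableC; do 2 apply: measurableU => //.
  apply: null_event; first exact: (@mpre (inr k)).
  rewrite (pr_speed model) //.
  by rewrite !memNset ?mulr0 ?addr0 // => h; apply: h; [right|left; right|left; left].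
Qed.

End almost_sure_configuration.

(** * Reflection at the origin *)

Section mirror.
Context {R : realType}.

Definition mirror {T : Type} (x : int -> T -> R) (k : int) (w : T) : R := - x (- k) w.

Lemma annihilation_times_mirror (x v : int -> R) (T : int -> \bar R) :
  annihilation_times x v T ->
  annihilation_times (fun k => - x (- k)) (fun k => - v (- k)) (T \o -%R).
Proof.
move=> [h1 h2]; split=> [i|i t] /=; first exact: h1.
rewrite h2; split=> -[t0 ti [j [ji m tj]]]; split=> //; exists (- j); split.
- by rewrite eqr_oppLR.
- by move: m; rewrite /meet !opprK; lra.
- by rewrite opprK.
- by rewrite eqr_opp.
- by move: m; rewrite /meet; lra.
- by [].
Qed.

Context {d : measure_display} {Omega : measurableType d}.
Variables (P : probability Omega R) (p : R) (x v : int -> Omega -> R).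

Lemma gap_mirror k w : gap (mirror x) k w = gap x (- k - 1) w.
Proof.
rewrite /gap /mirror opprK addrC.
by rewrite (_ : - k - 1 + 1 = - k) ?subrK // (_ : - k - 1 = - (k + 1)) // opprD.
Qed.

Lemma regular_mirror w : regular x v w -> regular (mirror x) (mirror v) w.
Proof.
move=> [g s r l]; split=> [k|k|N|N].
- by rewrite gap_mirror.
- by rewrite /mirror; case: (s (- k)) => ->;
    [constructor 3|constructor 2|constructor 1]; rewrite ?opprK ?oppr0.
- have [j [Nj gj]] := l N; exists j; split=> //; rewrite gap_mirror.
  by rewrite (_ : - Posz j - 1 = Negz j) //; lia.
- have [j [Nj gj]] := r N; exists j; split=> //; rewrite gap_mirror.
  by rewrite (_ : - Negz j - 1 = Posz j) //; lia.
Qed.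

Lemma spread_gaps_mirror : spread_gaps P x -> spread_gaps P (mirror x).
Proof.
move=> h k; have := h (- k - 1).
by have -> : gap (mirror x) k = gap x (- k - 1) by apply/funext => w; rewrite gap_mirror.
Qed.

(** Reflection permutes the independent family by [sigma] and changes the sign of the speeds, whose
    law is symmetric; gaps keep their sign because order and sign are both reversed. *)
Lemma annihilation_model_mirror : annihilation_model P p x v ->
  annihilation_model P p (mirror x) (mirror v).
Proof.
move=> [x0 mY law indep].
pose sigma (k : int + int) : int + int :=
  match k with inl i => inl (- i - 1) | inr i => inr (- i) end.
pose g (k : int + int) (r : R) := if k is inl _ then r else - r.
have sigmaK : involutive sigma.
  by case=> i /=; [congr inl; lia|rewrite opprK].
have YE k : gaps_and_speeds (mirror x) (mirror v) k =
    g k \o gaps_and_speeds x v (sigma k).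
  by case: k => i; apply/funext => w /=; rewrite ?gap_mirror.
have mg k : measurable_fun setT (g k).
  by case: k => i; [exact: measurable_id|exact/measurable_funN/measurable_id].
have mpre k (B : set R) : measurable B -> measurable (g k @^-1` B).
  by move=> mB; rewrite -[_ @^-1` _]setTI; exact: mg.
split.
- by move=> w; rewrite /mirror oppr0 x0 oppr0.
- by move=> k; rewrite YE; apply: measurableT_comp.
- move=> k A mA.
  have mA' : measurable (-%R @^-1` A) by exact: (mpre (inr 0)).
  have -> : pushforward P (mirror v k) A = pushforward P (v (- k)) (-%R @^-1` A) by [].
  rewrite (law _ _ mA') !speed_lawE //; congr EFin.
  have e r : (r \in -%R @^-1` A) = (- r \in A) by apply/idP/idP; rewrite !inE.
  by rewrite !e oppr0 opprK; ring.
- move=> s B us mB; pose B' k := g (sigma k) @^-1` B (sigma k).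
  have u' : uniq (map sigma s) by rewrite map_inj_uniq //; exact: inv_inj.
  have := indep _ B' u' (fun k => mpre _ _ (mB _)); rewrite !big_map.
  have e k : gaps_and_speeds x v (sigma k) @^-1` B' (sigma k) =
      gaps_and_speeds (mirror x) (mirror v) k @^-1` B k.
    by rewrite YE /B' sigmaK.
  by under eq_bigr do rewrite e; under [X in _ = X]eq_bigr do rewrite e.
Qed.

End mirror.

(** * A window of static particles around the origin *)

Definition window c : seq (int + int) :=
  [seq inr (Posz i - Posz c) | i <- iota 0 (c + c).+1].

Lemma mem_window c j : (j \in window c) = if j is inr i then - Posz c <= i <= Posz c else false.
Proof.
apply/mapP/idP => [[i]|].
  by rewrite mem_iota => /andP[? ?] ->; lia.
case: j => // i h; exists (absz (i + Posz c)%R); last by congr inr; lia.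
by rewrite mem_iota; lia.
Qed.

Section survival.
Context {R : realType} {d : measure_display} {Omega : measurableType d}.
Variables (P : probability Omega R) (p : R) (x v : int -> Omega -> R).
Hypothesis model : annihilation_model P p x v.
Hypothesis spread : spread_gaps P x.
Hypothesis p_bound : 3313 / 10000 <= p <= 1.

(** Phrased through the joint family of gaps and speeds, so that it is literally a cylinder. *)
Definition still_window c := [set w | forall j, j \in window c ->
  [set (0 : R)] (gaps_and_speeds x v j w)].

Lemma still_window_past c : in_past x v c.+1 (still_window c).
Proof.
apply: sub_sigma_algebra; exists (window c), (fun=> [set 0]); split=> //.
by move=> [i|i]; rewrite mem_window // /known /=; clear; lia.
Qed.

Lemma still_window_pos c : 0 < pr P (still_window c).
Proof.
have [_ mY law indep] := model.
have p0 : 0 < p by have /andP[] := p_bound; lra.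
have e : P (still_window c) = (p ^+ size (undup (window c)))%:E.
  have -> : still_window c = _ :=
    cylinder_bigsetI (gaps_and_speeds x v) (window c) (fun=> [set 0]).
  rewrite (indep _ _ (undup_uniq _)) //.
  have : {subset undup (window c) <= window c} by move=> j; rewrite mem_undup.
  elim: (undup _) => [|j s IH] h; first by rewrite big_nil.
  rewrite big_cons IH; last by move=> k ks; apply: h; rewrite inE ks orbT.
  have : j \in window c by apply: h; rewrite mem_head.
  rewrite mem_window; case: j {h} => // i _.
  rewrite (prE P) /= ?(pr_speed model) //; last first.
    by rewrite -[_ @^-1` _]setTI; exact: (mY (inr i)).
  rewrite [0 \in _]mem_set // !memNset /=; [|by move=> h; lra|by move=> h; lra].
  by rewrite !mulr0 add0r addr0 mulr1 exprS -EFinM.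
by rewrite /pr e /= exprn_gt0.
Qed.

Definition ever_hit c := \bigcup_m hit x v c m.

Lemma measurable_ever_hit c : measurable (ever_hit c).
Proof. by apply: bigcupT_measurable => m; exact: measurable_hit model _ _. Qed.

(** Level 0 is absorbing, so the events [hit] increase and a bound uniform in [m] passes to their
    union. Before any reading the state is level [c] in mode 0, of weight [z ^ c]. *)
Lemma ever_hit_bound c A : in_past x v c.+1 A ->
  pr P (A `&` ever_hit c) <= (199 / 200) ^+ c * pr P A.
Proof.
move=> hA; have mA := in_past_measurable model hA.
rewrite /ever_hit setI_bigcupr; apply: pr_bigcup_le.
- by move=> m; apply: measurableI => //; exact: measurable_hit model _ _.
- move=> m m' mm'; apply: setIS => w; rewrite /hit /= /explore -(subnKC mm') seg_cat foldl_cat.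
  exact: explore_absorbed.
- move=> m; have := @hit_bound _ _ _ _ _ _ _ model spread p_bound c m 0 c 0%N A.
  rewrite addn0 add0n => /(_ hA (fun _ _ => erefl)) h; apply: le_trans h _.
  by case: (c) => [|k]; rewrite ?mulr1.
Qed.

End survival.

(** * Positive probability of survival *)

Section main_argument.
Context {R : realType} {d : measure_display} {Omega : measurableType d}.
Variables (P : probability Omega R) (p : R) (x v : int -> Omega -> R).
Hypothesis model : annihilation_model P p x v.
Hypothesis spread : spread_gaps P x.
Hypothesis p_bound : 3313 / 10000 <= p <= 1.

Lemma still_window_mirror c : still_window (mirror x) (mirror v) c = still_window x v c.
Proof.
have winP y u w : still_window y u c w <-> forall i, - Posz c <= i <= Posz c -> u i w = 0 :> R.
  split=> [h i ic|h [i|i]]; rewrite ?mem_window //; last by move=> /h.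
  by have := h (inr i); rewrite mem_window => /(_ ic).
apply/seteqP; split=> w /winP h; apply/winP => i ic.
  have := h (- i); rewrite /mirror opprK => /(_ _)/eqP; rewrite oppr_eq0 => h'.
  by apply/eqP/h'; move: ic; clear; lia.
by rewrite /mirror h ?oppr0 //; move: ic; clear; lia.
Qed.

Lemma measurable_position k : measurable_fun setT (x k).
Proof.
have [x0 mY _ _] := model; have mg i : measurable_fun setT (gap x i) by exact: (mY (inl i)).
have m0 : measurable_fun setT (x 0).
  by rewrite (_ : x 0 = cst 0) //; apply/funext => w; rewrite x0.
case: k => n.
  elim: n => // n IH.
  rewrite (_ : x n.+1 = x n \+ gap x n); first exact: measurable_funD.
  by apply/funext => w /=; rewrite -position_succ (_ : n%:Z + 1 = n.+1%:Z) //; clear; lia.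
elim: n => [|n IH].
  rewrite (_ : x (Negz 0) = x 0 \- gap x (Negz 0)); first exact: measurable_funB.
  by apply/funext => w /=; rewrite /gap (_ : Negz 0 + 1 = 0) // subKr.
rewrite (_ : x (Negz n.+1) = x (Negz n) \- gap x (Negz n.+1)); first exact: measurable_funB.
by apply/funext => w /=; rewrite /gap (_ : Negz n.+1 + 1 = Negz n) ?subKr //; clear; lia.
Qed.

Let uncollided := [set w | forall j, ~ collides (x ^~ w) (v ^~ w) 0 j].

Let measurable_uncollided0 : measurable uncollided.
Proof.
apply: measurable_uncollided => i; first exact: measurable_position.
by have [_ mY _ _] := model; exact: (mY (inr i)).
Qed.

Let regular_survives w : regular x v w ->
  uncollided w <-> survives (fun k => x k w) (fun k => v k w) 0.
Proof.
move=> r; have [x0 _ _ _] := model.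
rewrite survivesE //.
- exact: regular_mono r.
- by case: r => _ + _ _ i => /(_ i)[] ->; apply/andP; split; lra.
- exact: regular_locally_finite (x0 w) r.
Qed.

(** A partner that destroys particle 0 comes from one of the two sides; [explore_hits] applies to
    the configuration or to its reflection. *)
Let explore_uncollided c w : regular x v w -> still_window x v c w ->
  ~ ever_hit x v c w -> ~ ever_hit (mirror x) (mirror v) c w -> uncollided w.
Proof.
move=> r sw nr nl j cj.
have [x0 _ _ _] := model; have mono := regular_mono r.
have vr : forall i, [\/ v i w = -1, v i w = 0 | v i w = 1] by case: r.
have vb i : -1 <= v i w <= 1 by case: (vr i) => ->; apply/andP; split; lra.
have lf := regular_locally_finite (x0 w) r.
have aT := annihilation_first_time mono vb lf.
set T := first_time _ _ in aT.
have T0 : T 0 = (meet_time (x ^~ w) (v ^~ w) 0 j)%:E by exact: first_timeE.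
set t := meet_time _ _ _ _ in T0.
have [t0 [l [_ l0 m Tl]]] := solution_partner ((solution_setT _ _ _).2 aT) Logic.I T0.
have vw i : - Posz c <= i <= Posz c -> v i w = 0.
  by move=> ic; have := sw (inr i); rewrite mem_window => /(_ ic).
have [lpos|lneg] : 0 < l \/ 0 < - l by move: l0; clear; lia.
  have [|k hk] := explore_hits mono vr aT (c := c) _ lpos T0 Tl m.
    by move=> i ic; apply: vw; move: ic; clear; lia.
  by apply: nr; exists k.
have r' := regular_mirror r.
have vr' : forall i, [\/ mirror v i w = -1, mirror v i w = 0 | mirror v i w = 1] by case: r'.
have aT' := annihilation_times_mirror aT.
have [||||k hk] := explore_hits (regular_mono r') vr' aT' (t := t) (c := c) _ lneg.
- by move=> i ic; rewrite /mirror vw ?oppr0 //; move: ic; clear; lia.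
- by rewrite /= oppr0.
- by rewrite /= opprK.
- by move: m; rewrite /meet /mirror oppr0 opprK; lra.
by apply: nl; exists k.
Qed.

Theorem still_particle_survives : still_particle_survives_wpp P x v.
Proof.
have [c hc] : exists c, (199 / 200 : R) ^+ c < 1 / 2.
  by apply: expr_small; [apply/andP; split|]; lra.
have [_ mY _ _] := model.
pose V := v 0 @^-1` [set 0]; pose H := ever_hit x v c.
pose H' := ever_hit (mirror x) (mirror v) c; pose A := still_window x v c.
have mV : measurable V by rewrite -[V]setTI; exact: (mY (inr 0)).
have model' := annihilation_model_mirror model.
have mH : measurable H by exact: measurable_ever_hit model _.
have mH' : measurable H' by exact: measurable_ever_hit model' _.
have mA : measurable A by apply: (in_past_measurable model (k := c.+1)); exact: still_window_past.
have A_pos : 0 < pr P A by exact: still_window_pos model p_bound c.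
have bH : pr P (A `&` H) <= (199 / 200) ^+ c * pr P A.
  by apply: (ever_hit_bound model spread p_bound); exact: still_window_past.
have bH' : pr P (A `&` H') <= (199 / 200) ^+ c * pr P A.
  apply: (ever_hit_bound model' (spread_gaps_mirror spread) p_bound).
  by rewrite /A -still_window_mirror; exact: still_window_past.
exists uncollided; split; first exact: measurable_uncollided0.
  apply: negligibleS (regular_ae model spread) => w /= h r; apply: h.
  exact: regular_survives.
have [N [mN N0 hN]] := regular_ae model spread.
have prN : pr P N = 0 by rewrite /pr N0.
have mEV : measurable (uncollided `&` V) by exact: measurableI.
have mHH : measurable (H `|` H') by exact: measurableU.
have sub : A `&` ~` (H `|` H') `<=` (uncollided `&` V) `|` N.
  move=> w [Aw nH]; case: (pselect (regular x v w)) => r; last by right; apply: hN.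
  left; split.
    by apply: (explore_uncollided r Aw) => h; apply: nH; [left|right].
  by have := Aw (inr 0); rewrite mem_window; apply; clear; lia.
have le1 : pr P (A `&` ~` (H `|` H')) <= pr P (uncollided `&` V).
  have mC : measurable (A `&` ~` (H `|` H')) by apply: measurableI => //; exact: measurableC.
  rewrite (pr_split P mC mN) -[leRHS]add0r; apply: lerD.
    by rewrite -prN; apply: pr_le => //; exact: measurableI.
  apply: pr_le => //; first by apply: measurableI => //; exact: measurableC.
  by move=> w [/sub[]].
have le2 : pr P (A `&` (H `|` H')) <= pr P (A `&` H) + pr P (A `&` H').
  have mAH : measurable (A `&` (H `|` H')) by exact: measurableI.
  rewrite (pr_split P mAH mH); apply: lerD; apply: pr_le => //;
    try by [exact: measurableI|apply: measurableI => //; exact: measurableC].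
    by move=> w [[]].
  by move=> w [[Aw [|]]].
have e := pr_split P mA mHH.
have lt : (199 / 200) ^+ c * pr P A < 1 / 2 * pr P A by rewrite ltr_pM2r.
have pos : 0 < pr P (uncollided `&` V) by lra.
have pV : pr P V = p.
  rewrite /V (pr_speed model) // [0 \in _]mem_set // !memNset /=; first by ring.
  - by move=> h; lra.
  - by move=> h; lra.
apply: divr_gt0; first exact: pos.
rewrite -/(pr P V) pV; have /andP[? _] := p_bound; lra.
Qed.

End main_argument.

(** * Particles on the integers *)

Section lattice.
Context {R : realType} {d : measure_display} {Omega : measurableType d}.
Variables (P : probability Omega R) (p : R) (x : int -> Omega -> R).
Variable v : int -> {RV P >-> R}.
Hypothesis lattice : lattice_model p x v.

Lemma gap_lattice k w : gap x k w = 1.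
Proof. by have [xk _ _] := lattice; rewrite /gap !xk intrD addrAC subrr add0r. Qed.

(** Every event about a constant gap is sure or impossible: one impossible event makes both sides
    vanish, and sure events drop out of both. *)
Lemma lattice_independent : mutually_independent P (gaps_and_speeds x v).
Proof.
have [_ _ indep] := lattice.
move=> s B us mB.
pose speeds := pmap (fun k : int + int => if k is inr i then Some i else None).
have u' : uniq (speeds s).
  elim: s us => //= k s IH /andP[ks /IH u]; case: k ks => // i ks /=; rewrite u andbT.
  apply: contra ks; rewrite mem_pmap => /mapP[[j|j] js //] [->].
  exact: js.
have := indep (speeds s) (fun i => B (inr i)) u' (fun i => mB _).
pose constants_ok (t : seq (int + int)) :=
  all (fun k => if k is inl _ then `[< B k 1 >] else true) t.
have inlE i : gaps_and_speeds x v (inl i) @^-1` B (inl i) =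
    if `[< B (inl i) 1 >] then setT else set0.
  by apply/seteqP; split=> w /=; rewrite gap_lattice; case: asboolP.
have setE t : \big[setI/setT]_(k <- t) (gaps_and_speeds x v k @^-1` B k) =
    if constants_ok t then \big[setI/setT]_(i <- speeds t) (v i @^-1` B (inr i)) else set0.
  elim: t => [|[i|i] t IH]; rewrite ?big_nil // big_cons IH /=.
    by rewrite inlE; case: asboolP => _; rewrite ?setTI ?set0I.
  by case: (constants_ok t); rewrite ?setI0 // big_cons.
have prodE t : (\prod_(k <- t) P (gaps_and_speeds x v k @^-1` B k) =
    if constants_ok t then \prod_(i <- speeds t) P (v i @^-1` B (inr i)) else 0)%E.
  elim: t => [|[i|i] t IH]; rewrite ?big_nil // big_cons IH /=.
    by rewrite inlE; case: asboolP => _; rewrite ?probability_setT ?mul1e ?measure0 ?mul0e.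
  by case: (constants_ok t); rewrite ?mule0 // big_cons.
by rewrite setE prodE; case: (constants_ok s) => //; rewrite measure0.
Qed.

Lemma annihilation_model_lattice : annihilation_model P p x v.
Proof.
have [xk law _] := lattice; split => //.
- move=> [k|k] /=; last exact: measurable_funPT.
  by rewrite (_ : gap x k = cst 1) //; apply/funext => w; rewrite gap_lattice.
- exact: lattice_independent.
Qed.

Lemma spread_gaps_lattice : spread_gaps P x.
Proof.
move=> k; have e (B : set R) : gap x k @^-1` B = if `[< B 1 >] then setT else set0.
  by apply/seteqP; split=> w /=; rewrite gap_lattice; case: asboolP.
split; rewrite e; case: asboolP => /= h; rewrite ?pr_setT ?pr_set0 //; lra.
Qed.

End lattice.

(** * Particles with exponential gaps *)

Section poisson.
Context {R : realType} {d : measure_display} {Omega : measurableType d}.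
Variables (P : probability Omega R) (p : R) (x v : int -> {RV P >-> R}).
Hypothesis poisson : poisson_model p x v.

Lemma measurable_gap_poisson k : measurable_fun setT (gap x k).
Proof. by apply: measurable_funB; exact: measurable_funPT. Qed.

Lemma annihilation_model_poisson : annihilation_model P p x v.
Proof.
have [x0 _ law indep] := poisson; split => //.
by move=> [k|k] /=; [exact: measurable_gap_poisson|exact: measurable_funPT].
Qed.

(** The tangent inequality at [-1] gives only 0; applied at [-1/8] and raised to the 8th power it
    gives [(7/8)^8 = 0.343...]. The upper bound is [2 <= expR 1]. *)
Lemma expRN1_bounds : 1 / 3 <= expR (- 1 : R) <= 1 / 2.
Proof.
have h8 : 7 / 8 <= expR (- (1 / 8) : R) by have := expR_ge1Dx (- (1 / 8) : R); lra.
have e8 : expR (- 1 : R) = expR (- (1 / 8)) ^+ 8.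
  by rewrite -expRM_natl; congr expR; lra.
have h1 := expR_ge1Dx (1 : R).
have e1 : expR (- 1 : R) * expR 1 = 1 by rewrite -expRD addrC subrr expR0.
apply/andP; split; last by have := expR_gt0 (- 1 : R); nra.
apply: (@le_trans _ _ ((7 / 8) ^+ 8)); first by rewrite !exprS expr0; lra.
by rewrite e8; apply: lerXn2r => //; rewrite nnegrE; lra.
Qed.

Lemma spread_gaps_poisson : spread_gaps P x.
Proof.
move=> k; have [_ law _ _] := poisson.
have lawk (B : set R) : measurable B -> pr P (gap x k @^-1` B) = fine (exponential_prob 1 B).
  by move=> mB; have := law k B mB; rewrite /pushforward /pr => ->.
have mpre (B : set R) : measurable B -> measurable (gap x k @^-1` B).
  by move=> mB; rewrite -[_ @^-1` _]setTI; exact: measurable_gap_poisson.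
have neg : pr P (gap x k @^-1` `]-oo, 0[) = 0.
  rewrite lawk // /exponential_prob integral0_eq // => r /=; rewrite in_itv /= => r0.
  by rewrite lt0_exponential_pdf.
have zero : pr P (gap x k @^-1` [set 0]) = 0.
  by rewrite lawk // /exponential_prob integral_set1.
have unit : pr P (gap x k @^-1` `[0, 1]) = 1 - expR (- 1).
  by rewrite lawk // exponential_prob_itv0c // mulr1.
have /andP[e1 e2] := expRN1_bounds.
split.
- have mle := mpre _ (measurable_ge (1 : R)).
  have := @pr_cover _ _ _ P [:: gap x k @^-1` [set r | (1 <= r)%R];
    gap x k @^-1` `]-oo, 0[; gap x k @^-1` `[0, 1]] setT measurableT.
  rewrite /= !setTI neg unit addr0 add0r pr_setT => h.
  suff : 1 <= pr P (gap x k @^-1` [set r | (1 <= r)%R]) + (1 - expR (- 1)) by lra.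
  apply: h => [C [<-|[<-|[<-|//]]]|w _ /=]; [by []|exact: mpre|exact: mpre|].
  rewrite !in_itv /=; have [?|?] := leP 1 (gap x k w); first by left.
  by right; have [?|?] := ltP (gap x k w) 0; [left|right; left; apply/ltW].
- suff : pr P (gap x k @^-1` `[0, 1]) <= pr P (gap x k @^-1` [set r | (r <= 1)%R]) by lra.
  apply: pr_le; [exact: mpre|exact: (mpre _ (measurable_le _))|].
  by move=> w /=; rewrite in_itv /= => /andP[].
- apply/eqP; rewrite eq_le pr_ge0 andbT.
  have mle := mpre _ (measurable_le (0 : R)).
  rewrite (pr_split P mle (mpre _ (measurable_set1 (0 : R)))) -[leRHS]addr0.
  apply: lerD.
    rewrite -[leRHS]zero; apply: pr_le; [|exact: mpre|by move=> w []].
    by apply: measurableI => //; exact: mpre.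
  rewrite -[leRHS]neg; apply: pr_le; [|exact: mpre|].
    by apply: measurableI => //; apply: measurableC; exact: mpre.
  move=> w /= [h1 h2]; rewrite in_itv /= lt_neqAle h1 andbT.
  by apply/eqP.
Qed.

End poisson.

Theorem corollary4 (R : realType) (p : R) (hp : 0 <= p <= 1) :
  (3325 / 10000 <= p ->
     forall (d : measure_display) (Omega : measurableType d)
       (P : probability Omega R) (x : int -> Omega -> R)
       (v : int -> {RV P >-> R}),
       lattice_model p x v -> still_particle_survives_wpp P x v)
  /\
  (3313 / 10000 <= p ->
     forall (d : measure_display) (Omega : measurableType d)
       (P : probability Omega R) (x v : int -> {RV P >-> R}),
       poisson_model p x v -> still_particle_survives_wpp P x v).
Proof.
have /andP[_ p1] := hp.
split=> p0 d Omega P x v model.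
  apply: (still_particle_survives (annihilation_model_lattice model)).
    exact: spread_gaps_lattice model.
  by rewrite p1 (le_trans _ p0) // ler_pM2r ?invr_gt0 ?ltr0n // ler_nat.
apply: (still_particle_survives (annihilation_model_poisson model)).
  exact: spread_gaps_poisson model.
exact/andP.
Qed.
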